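(* Let $X$ be a separable (real) Banach space and let $\mathcal{I} \in \{\mathcal{P}, \mathcal{P}_\infty, \mathcal{B}\}$ if $\dim(X) = \infty$, or $\mathcal{I} = \mathcal{P}$ if $\dim(X) < \infty$. Let $\langle X\rangle^{\mathcal I}_{\equiv} := \{\mu \in \mathcal{I} : X_\mu \text{ is linearly isometric to } X\}$. The following conditions are equivalent: (1) $\langle X\rangle^{\mathcal I}_{\equiv}$ is a $G_\delta$ subset of $\mathcal{I}$; (2) $\langle X\rangle^{\mathcal I}_{\equiv}$ is comeager in its closure in $\mathcal{I}$; (3) Player II has a winning strategy in the game $\operatorname{BMG}(X)$; (4) Player I does not have a winning strategy in the game $\operatorname{BMG}(X)$; (5) $X$ is a guarded Fraïssé Banach space.
   Context: All Banach spaces are real. For $C \geq 0$ and Banach spaces $Y, Z$, $\operatorname{Emb}_C(Y,Z)$ is the set of bounded linear operators $T\colon Y\to Z$ with $e^{-C}\|y\| \le \|Ty\| \le e^{C}\|y\|$ for all $y\in Y$. $\operatorname{Iso}(X)$ is the group of surjective linear isometries of $X$. Codings. $V$ is the $\mathbb{Q}$-vector space of finitely supported rational sequences, and $c_{00}$ the real vector space of finitely supported real sequences. $\mathcal{P}$ is the space of all pseudonorms on $V$ with the topology of pointwise convergence; each $\mu\in\mathcal P$ is identified with its extension to a pseudonorm on $c_{00}$. $X_\mu$ is the completion of the quotient of $(c_{00},\mu)$ by $\{x : \mu(x)=0\}$. $\mathcal{P}_\infty$ is the set of $\mu\in\mathcal{P}$ with $X_\mu$ infinite-dimensional, and $\mathcal{B}$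 the set of $\mu\in\mathcal{P}_\infty$ whose extension to $c_{00}$ is a norm; both carry the subspace topology. All three are Polish. Ages. $\operatorname{BM}$ is the set of isometry classes of finite-dimensional real normed spaces, topologized as the disjoint union over $n$ of the sets $\operatorname{BM}_n$ of isometry classes of $n$-dimensional spaces, each with the metric $d_{\operatorname{BM}}(E,F)=\inf\{\log(\|T\|\|T^{-1}\|) : T\colon E\to F \text{ isomorphism}\}$. $\operatorname{Age}(X)\subseteq\operatorname{BM}$ is the set of (isometry classes of) finite-dimensional spaces isometric to a subspace of $X$, and $\operatorname{Age}_{cl}(X)$ is its closure in $\operatorname{BM}$. Directed limits. Let $(E_n)$ be Banach spaces and $f_n\colon E_n\to E_{n+1}$ linear maps with $\prod_n\|f_n\|<\infty$; put $f_{n,k}=f_{k-1}\circ\cdots\circ f_n$ for $n<k$ and $f_{n,n}=\operatorname{Id}_{E_n}$. Let $E$ be the quotient of the Banach space of bounded sequences $(x_n)\in\prod_n E_n$ (sup norm) by the subspace of sequences with $\|x_n\|\to0$. Let $f_{n,\infty}\colon E_n\to E$ send $x$ to the class of the sequence whose $k$-th term is $0$ for $k<n$ and $f_{n,k}(x)$ for $k\ge n$. Then $\varinjlim(E_n,f_n):=\overline{\bigcup_n f_{n,\infty}(E_n)}\subseteq E$. Game $\operatorname{BMG}(X)$. Player I first plays $E_1,\varepsilon_1$; Player II plays $E_2,f_1,\varepsilon_2$; Player I plays $E_3,f_2,\varepsilon_3$; Player II plays $E_4,f_3,\varepsilon_4$; and so on, where $E_n\in\operatorname{Age}_{cl}(X)$,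 $\varepsilon_n>0$, $\varepsilon_{n+1}<\varepsilon_n$ and $f_n\in\operatorname{Emb}_{\varepsilon_n}(E_n,E_{n+1})$ for all $n\geq 1$. Player II wins if $\sum_n\varepsilon_n<\infty$ and $\varinjlim(E_n,f_n)$ is isometric to $X$; otherwise Player I wins. Guarded Fraïssé Banach spaces. A separable Banach space $X$ is guarded Fraïssé if it satisfies one of the following two equivalent properties: (gF-1) for every finite-dimensional subspace $E\subseteq X$ and every $\varepsilon>0$ there exist $\delta>0$ and a finite-dimensional subspace $F\subseteq X$ with $E\subseteq F$ such that for all $\iota,\iota'\in\operatorname{Emb}_\delta(F,X)$ there is $T\in\operatorname{Iso}(X)$ with $\|\iota'|_E-T\circ\iota|_E\|<\varepsilon$; (gF-2) for every finite-dimensional subspace $E\subseteq X$ and every $\varepsilon>0$ there exist $F\in\operatorname{Age}_{cl}(X)$, $\phi\in\operatorname{Emb}_\varepsilon(E,F)$ and $\delta>0$ such that for every $G\in\operatorname{Age}_{cl}(X)$, $\psi\in\operatorname{Emb}_\delta(F,G)$ and $\eta>0$ there is $\iota\in\operatorname{Emb}_\eta(G,X)$ with $\|\operatorname{Id}_E-\iota\circ\psi\circ\phi\|<\varepsilon$. *)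

(* Defs.v *)
From HB Require Import structures.
From mathcomp Require Import all_boot all_order all_algebra.
From mathcomp Require Import generic_quotient ring_quotient.
From mathcomp Require Import all_classical all_reals all_analysis.
From mathcomp Require Import ring lra.

Set Implicit Arguments.
Unset Strict Implicit.
Unset Printing Implicit Defensive.

Import Order.TTheory GRing.Theory Num.Theory.
Import numFieldNormedType.Exports.

Local Open Scope classical_set_scope.
Local Open Scope ring_scope.

Section LinearSubspaces.
Context {R : realType}.

Record subspace_of (V : lmodType R) := Subspace {
  subspace_set :> set V ;
  subspace0 : subspace_set 0 ;
  subspaceL : forall (a : R) x y,
    subspace_set x -> subspace_set y -> subspace_set (a *: x + y) }.

Arguments subspace_set {V} s _ : rename.
Arguments subspace0 {V} s : rename.
Arguments subspaceL {V} s a x y _ _ : rename.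

Section SubType.
Context {V : lmodType R} (E : subspace_of V).

Definition subspace_pred : {pred V} := fun x => x \in (E : set V).

Fact subspace_pred_closed : submod_closed subspace_pred.
Proof.
split; first by apply/mem_set/subspace0.
by move=> a x y /set_mem xE /set_mem yE; apply/mem_set/subspaceL.
Qed.

HB.instance Definition _ :=
  GRing.isSubmodClosed.Build R V subspace_pred subspace_pred_closed.

Record subspace_type := SubspaceElt {
  subspace_val :> V ; subspace_valP : subspace_val \in subspace_pred }.

HB.instance Definition _ := [isSub for subspace_val].
HB.instance Definition _ := [Choice of subspace_type by <:].
HB.instance Definition _ := [SubChoice_isSubLmodule of subspace_type by <:].

End SubType.

Section Inclusion.
Context {V : lmodType R} (E F : subspace_of V) (EF : E `<=` F).

Fact subspace_incl_subproof (x : subspace_type E) :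
  subspace_val x \in subspace_pred F.
Proof. by apply/mem_set/EF/set_mem; exact: subspace_valP. Qed.

Definition subspace_incl (x : subspace_type E) : subspace_type F :=
  SubspaceElt (subspace_incl_subproof x).

End Inclusion.

Section SubNormed.
Context {V : normedModType R} (E : subspace_of V).
Local Notation T := (subspace_type E).

Definition subspace_norm (x : T) : R := `|subspace_val x|.

Fact subspace_ler_normD (x y : T) :
  subspace_norm (x + y) <= subspace_norm x + subspace_norm y.
Proof. exact: ler_normD. Qed.

Fact subspace_normrZ (a : R) (x : T) :
  subspace_norm (a *: x) = `|a| * subspace_norm x.
Proof. exact: normrZ. Qed.

Fact subspace_normr0_eq0 (x : T) : subspace_norm x = 0 -> x = 0.
Proof. by move/normr0_eq0 => x0; apply: val_inj. Qed.

HB.instance Definition _ := Lmodule_isNormed.Build R T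
  subspace_ler_normD subspace_normrZ subspace_normr0_eq0.

End SubNormed.

Definition finite_dim (V : lmodType R) : Prop :=
  exists (n : nat) (e : 'I_n -> V),
    forall x, exists c : 'I_n -> R, x = \sum_i c i *: e i.

End LinearSubspaces.

Section SeminormQuotient.
Context {R : realType}.

Record seminorm (V : lmodType R) := Seminorm {
  seminorm_fun :> V -> R ;
  seminormD : forall x y,
    seminorm_fun (x + y) <= seminorm_fun x + seminorm_fun y ;
  seminormZ : forall (a : R) x, seminorm_fun (a *: x) = `|a| * seminorm_fun x }.

Section Quotient.
Context {V : lmodType R} (p : seminorm V).

Lemma seminorm0 : p 0 = 0.
Proof. by rewrite -(scale0r 0) seminormZ normr0 mul0r. Qed.

Lemma seminormN x : p (- x) = p x.
Proof. by rewrite -scaleN1r seminormZ normrN1 mul1r. Qed.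

Lemma seminorm_ge0 x : 0 <= p x.
Proof. by have := seminormD p x (- x); rewrite subrr seminorm0 seminormN => h; lra. Qed.

Lemma seminorm_dist x y : `|p x - p y| <= p (x - y).
Proof.
have h a b : p a <= p (a - b) + p b.
  by have := seminormD p (a - b) b; rewrite subrK.
have hx := h x y; have := h y x; rewrite -(seminormN (y - x)) opprB => hy.
by rewrite ler_norml; lra.
Qed.

Definition seminorm_ker : {pred V} := fun x => p x == 0.

Fact seminorm_ker_closed : submod_closed seminorm_ker.
Proof.
split; first by rewrite /in_mem/= /seminorm_ker seminorm0.
move=> a x y /eqP x0 /eqP y0; apply/eqP/le_anti; rewrite seminorm_ge0 andbT.
by apply: (le_trans (seminormD _ _ _)); rewrite seminormZ x0 y0 mulr0 addr0.
Qed.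

HB.instance Definition _ :=
  GRing.isSubmodClosed.Build R V seminorm_ker seminorm_ker_closed.

Definition seminorm_quot : Type := {ideal_quot seminorm_ker}.
HB.instance Definition _ := GRing.Zmodule.on seminorm_quot.
HB.instance Definition _ := EqQuotient.on seminorm_quot.

Local Notation Q := seminorm_quot.
Local Open Scope quotient_scope.

Definition to_quot (x : V) : Q := \pi_(Q) x.

Lemma to_quot_eq x y : to_quot x = to_quot y <-> p (x - y) = 0.
Proof.
by split=> [/eqmodP | xy0]; [move/eqP | apply/eqmodP/eqP].
Qed.


Definition quot_scale (a : R) (x : Q) : Q := to_quot (a *: repr x).

Lemma quot_scaleE a x : quot_scale a (to_quot x) = to_quot (a *: x).
Proof.
apply/to_quot_eq; rewrite -scalerBr seminormZ (_ : p _ = 0) ?mulr0//.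
by apply/to_quot_eq; rewrite /to_quot reprK.
Qed.

Lemma to_quot_surj (x : Q) : exists y, x = to_quot y.
Proof. by exists (repr x); rewrite /to_quot reprK. Qed.

Lemma to_quotD x y : to_quot (x + y) = to_quot x + to_quot y.
Proof. by rewrite /to_quot !piE. Qed.

Fact quot_scaleA a b x : quot_scale a (quot_scale b x) = quot_scale (a * b) x.
Proof. by have [y ->] := to_quot_surj x; rewrite !quot_scaleE scalerA. Qed.

Fact quot_scale1 : left_id 1 quot_scale.
Proof.
by move=> x; have [y ->] := to_quot_surj x; rewrite !quot_scaleE scale1r.
Qed.

Fact quot_scaleDr : right_distributive quot_scale +%R.
Proof.
move=> a x y; have [x' ->] := to_quot_surj x; have [y' ->] := to_quot_surj y.
by rewrite -to_quotD !quot_scaleE scalerDr to_quotD.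
Qed.

Fact quot_scaleDl x : {morph quot_scale^~ x : a b / a + b}.
Proof.
move=> a b; have [y ->] := to_quot_surj x.
by rewrite !quot_scaleE scalerDl to_quotD.
Qed.

HB.instance Definition _ := GRing.Zmodule_isLmodule.Build R Q
  quot_scaleA quot_scale1 quot_scaleDr quot_scaleDl.

Definition quot_norm (x : Q) : R := p (repr x).

Lemma quot_normE x : quot_norm (to_quot x) = p x.
Proof.
apply/eqP; rewrite -subr_eq0 -normr_le0.
apply: (le_trans (seminorm_dist _ _)); rewrite (_ : p _ = 0)//.
by apply/to_quot_eq; rewrite /to_quot reprK.
Qed.

Fact quot_ler_normD x y : quot_norm (x + y) <= quot_norm x + quot_norm y.
Proof.
have [x' ->] := to_quot_surj x; have [y' ->] := to_quot_surj y.
by rewrite -to_quotD !quot_normE seminormD.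
Qed.

Fact quot_normrZ a x : quot_norm (a *: x) = `|a| * quot_norm x.
Proof.
have [y ->] := to_quot_surj x.
by rewrite [_ *: _]quot_scaleE !quot_normE seminormZ.
Qed.

Fact quot_normr0_eq0 x : quot_norm x = 0 -> x = 0.
Proof.
have [y ->] := to_quot_surj x; rewrite quot_normE => y0.
have -> : 0 = to_quot 0 by rewrite /to_quot !piE.
by apply/to_quot_eq; rewrite subr0.
Qed.

HB.instance Definition _ := Lmodule_isNormed.Build R Q
  quot_ler_normD quot_normrZ quot_normr0_eq0.

Lemma to_quot_norm x : `|to_quot x| = p x.
Proof. exact: quot_normE. Qed.

Lemma to_quotZ a x : to_quot (a *: x) = a *: to_quot x.
Proof. by rewrite [RHS]quot_scaleE. Qed.

End Quotient.
End SeminormQuotient.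

Section NormedQuotient.
Context {R : realType} {V : normedModType R} (N : subspace_of V).

Let dists (x : V) : set R := [set `|x - z| | z in subspace_set N].

Let dists_n0 x : dists x !=set0.
Proof. by exists `|x - 0|, 0 => //; exact: subspace0. Qed.

Let dists_lb x : lbound (dists x) 0.
Proof. by move=> _ [z _ <-]. Qed.

Definition subspace_dist (x : V) : R := inf (dists x).

Let subspace_dist_le x z : subspace_set N z -> subspace_dist x <= `|x - z|.
Proof. by move=> Nz; apply: ge_inf; [exists 0; exact: dists_lb|exists z]. Qed.

Let subspace_dist_glb x r :
  (forall z, subspace_set N z -> r <= `|x - z|) -> r <= subspace_dist x.
Proof. by move=> h; apply: lb_le_inf => // _ [z Nz <-]; exact: h. Qed.

Let subspaceZ a z : subspace_set N z -> subspace_set N (a *: z).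
Proof.
by move=> Nz; rewrite -[_ *: _]addr0; apply: subspaceL => //; exact: subspace0.
Qed.

Fact subspace_distD x y :
  subspace_dist (x + y) <= subspace_dist x + subspace_dist y.
Proof.
rewrite -lerBlDr; apply: subspace_dist_glb => z Nz.
rewrite lerBlDr -lerBlDl; apply: subspace_dist_glb => w Nw.
rewrite lerBlDl; apply: (@le_trans _ _ `|x + y - (z + w)|).
  by apply: subspace_dist_le; rewrite -[z]scale1r; exact: subspaceL.
by rewrite opprD addrACA ler_normD.
Qed.

Fact subspace_distZ a x : subspace_dist (a *: x) = `|a| * subspace_dist x.
Proof.
have le_scale b y : subspace_dist (b *: y) <= `|b| * subspace_dist y.
  have [->|b0] := eqVneq b 0.
    rewrite normr0 mul0r scale0r; apply: (le_trans (subspace_dist_le _ (subspace0 N))).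
    by rewrite subrr normr0.
  rewrite -ler_pdivrMl ?normr_gt0//; apply: subspace_dist_glb => z Nz.
  rewrite ler_pdivrMl ?normr_gt0// -normrZ scalerBr.
  exact/subspace_dist_le/subspaceZ.
apply/le_anti; rewrite le_scale/=.
have [->|a0] := eqVneq a 0.
  by rewrite normr0 mul0r; apply: subspace_dist_glb.
rewrite -ler_pdivlMl ?normr_gt0// -normfV -{1}[x](scalerK a0).
exact: le_scale.
Qed.

Definition dist_seminorm : seminorm V := Seminorm subspace_distD subspace_distZ.

(* V / N with the quotient norm; since the kernel of the distance to N is the
   closure of N, this is the usual quotient when N is closed. *)
Definition normed_quot : normedModType R := seminorm_quot dist_seminorm.

End NormedQuotient.

Section Completion.
Context {R : realType} (Y : normedModType R).

Let le_seq_cvg (u v : nat -> R) (a b : R) :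
  u @ \oo --> a -> v @ \oo --> b -> (forall n, u n <= v n) -> a <= b.
Proof.
move=> ua vb uv; rewrite -subr_le0.
have h : (u - v) @ \oo --> a - b by exact: cvgB.
by apply: (cvgr_to_le h); apply: nearW => n; rewrite /= subr_le0.
Qed.

Definition cauchy_seqs : set (nat -> Y) := [set s | cauchy (s @ \oo)].

Let cauchy_seqsP (s : nat -> Y) :
  cauchy_seqs s <-> forall e : R, 0 < e ->
    exists N, forall m n, (N <= m)%N -> (N <= n)%N -> `|s m - s n| < e.
Proof.
split=> [/cauchyP cs e e0|h].
  have [x [N _ /= sN]] := cs (e / 2) (divr_gt0 e0 (ltr0n _ 2)).
  exists N => m n Nm Nn; rewrite -(subrK x (s m)) -addrA.
  have := sN m Nm; have := sN n Nn; rewrite -!ball_normE/= => h1 h2.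
  apply: (le_lt_trans (ler_normD _ _)); rewrite (splitr e) ltrD//.
  by rewrite distrC.
apply/cauchyP => e e0; have [N sN] := h e e0.
exists (s N); exists N => // n /= Nn; rewrite -ball_normE/=.
exact: sN.
Qed.

Fact cauchy_seqs0 : cauchy_seqs 0.
Proof. by apply/cauchy_seqsP => e e0; exists 0 => m n _ _; rewrite subrr normr0. Qed.

Fact cauchy_seqsL (a : R) s t :
  cauchy_seqs s -> cauchy_seqs t -> cauchy_seqs (a *: s + t).
Proof.
move=> /cauchy_seqsP cs /cauchy_seqsP ct; apply/cauchy_seqsP => e e0.
have a0 : 0 < `|a| + 1 by rewrite ltr_wpDl.
have e2 : 0 < e / 2 by rewrite divr_gt0.
have [N sN] := cs (e / 2 / (`|a| + 1)) (divr_gt0 e2 a0).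
have [M tM] := ct _ e2.
exists (maxn N M) => m n; rewrite !geq_max => /andP[Nm Mm] /andP[Nn Mn].
rewrite [X in `|X|](_ : _ = a *: (s m - s n) + (t m - t n)); last first.
  by rewrite scalerBr opprD addrACA.
apply: (le_lt_trans (ler_normD _ _)); rewrite (splitr e) ltr_leD//.
  rewrite normrZ; have := sN m n Nm Nn; rewrite ltr_pdivlMr// => h.
  by apply: le_lt_trans h; rewrite mulrC ler_wpM2l// lerDl.
by apply/ltW/tM.
Qed.

Definition cauchy_subspace : subspace_of (nat -> Y) :=
  Subspace cauchy_seqs0 cauchy_seqsL.

Local Notation C := (subspace_type cauchy_subspace).

Definition cauchy_norm (s : C) : R :=
  limn (fun n => `|subspace_val s n| : R).

Let cauchy_elt (s : C) : cauchy_seqs (subspace_val s).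
Proof. exact/set_mem/subspace_valP. Qed.

Let cauchy_norm_cvg (s : C) :
  (fun n => `|subspace_val s n| : R) @ \oo --> cauchy_norm s.
Proof.
have /cauchy_seqsP cs := cauchy_elt s.
apply/cauchy_cvgP/cauchyP => e e0; have [N sN] := cs e e0.
exists `|subspace_val s N|, N => // n /= Nn; rewrite -ball_normE/=.
by apply: (le_lt_trans (ler_dist_dist _ _)); exact: sN.
Qed.

Fact cauchy_normD s t : cauchy_norm (s + t) <= cauchy_norm s + cauchy_norm t.
Proof.
apply: (le_seq_cvg (@cauchy_norm_cvg (s + t))
  (cvgD (@cauchy_norm_cvg s) (@cauchy_norm_cvg t))) => n.
exact: ler_normD.
Qed.

Fact cauchy_normZ a s : cauchy_norm (a *: s) = `|a| * cauchy_norm s.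
Proof.
have h : (fun n => `|a| * `|subspace_val s n|) @ \oo --> `|a| * cauchy_norm s.
  by apply: cvgMl_tmp; exact: cauchy_norm_cvg.
have e : (fun n => `|subspace_val (a *: s) n| : R) =
         (fun n => `|a| * `|subspace_val s n|).
  by apply/funext => n; rewrite -normrZ.
by rewrite {1}/cauchy_norm e; exact: (cvg_lim (@Rhausdorff R) h).
Qed.

Definition cauchy_seminorm : seminorm C := Seminorm cauchy_normD cauchy_normZ.

Definition completion : Type := seminorm_quot cauchy_seminorm.
HB.instance Definition _ := NormedModule.on completion.

Let cst_cauchy (y : Y) : (fun=> y) \in subspace_pred cauchy_subspace.
Proof.
by apply/mem_set/cauchy_seqsP => e e0; exists 0 => m n _ _; rewrite subrr normr0.
Qed.

Definition to_completion (y : Y) : completion :=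
  to_quot cauchy_seminorm (SubspaceElt (cst_cauchy y)).

Fact to_completion_linear : linear to_completion.
Proof.
move=> a x y; rewrite /to_completion -to_quotZ -to_quotD.
congr (to_quot _ _); apply: val_inj; exact: erefl.
Qed.

HB.instance Definition _ :=
  GRing.isLinear.Build R Y completion _ to_completion to_completion_linear.

Lemma to_completion_norm y : `|to_completion y| = `|y|.
Proof. rewrite to_quot_norm /= /cauchy_norm /=; apply: cvg_lim => //; exact: cvg_cst. Qed.

Let approx (s : C) (e : R) : 0 < e -> exists N, forall m, (N <= m)%N ->
  `|to_completion (subspace_val s m) - to_quot cauchy_seminorm s| <= e.
Proof.
move=> e0; have /cauchy_seqsP/(_ e e0)[N sN] := cauchy_elt s.
exists N => m Nm; rewrite -[- to_quot _ _]scaleN1r -to_quotZ -to_quotD to_quot_norm.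
apply: (cvgr_to_le (@cauchy_norm_cvg _)).
exists N => // n /= Nn; apply/ltW.
by rewrite /= scaleN1r; exact: sN.
Qed.

Lemma to_completion_dense : dense (range to_completion).
Proof.
move=> O [x Ox] oO; have [s xE] := to_quot_surj (x : seminorm_quot _).
have /nbhs_ballP[e /= e0 eO] : nbhs x O by exact: open_nbhs_nbhs.
have [N sN] := approx s (divr_gt0 e0 (ltr0n R 2)).
exists (to_completion (subspace_val s N)); split; last by exists (subspace_val s N).
apply: eO; rewrite -ball_normE/= distrC xE.
by apply: (le_lt_trans (sN N (leqnn N))); rewrite ltr_pdivrMr// ltr_pMr// ltr1n.
Qed.

Fact completion_complete (F : set_system completion) :
  ProperFilter F -> cauchy F -> cvg F.
Proof.
move=> FF /cauchyP cF.
have i0 n : 0 < n.+1%:R^-1 :> R by rewrite invr_gt0.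
have /choice[y yF] : forall n, exists y : Y,
    F (ball (to_completion y) (2 * n.+1%:R^-1)).
  move=> n; have [x Fx] := cF _ (i0 n).
  have [w [xw [y _ yE]]] : ball x n.+1%:R^-1 `&` range to_completion !=set0.
    apply: to_completion_dense; first by exists x; exact: ballxx.
    exact: ball_open.
  exists y; apply: filterS Fx => z; move: xw; rewrite -yE.
  rewrite -!ball_normE/= => h1 h2; rewrite -(subrK x (to_completion y)) -addrA.
  apply: (le_lt_trans (ler_normD _ _)).
  by rewrite mulrDl mul1r ltrD// distrC.
have small (e : R) : 0 < e -> exists N, forall n, (N <= n)%N -> 4 * n.+1%:R^-1 < e.
  move=> e0; have [N _ NP] := near_infty_natSinv_lt (PosNum (divr_gt0 e0 (ltr0n R 4))).
  by exists N => n Nn; rewrite mulrC -ltr_pdivlMr//; exact: NP.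
have ydist m n : `|y m - y n| < 2 * m.+1%:R^-1 + 2 * n.+1%:R^-1.
  have [z [mz nz]] := filter_ex (filterI (yF m) (yF n)).
  rewrite -to_completion_norm linearB/= -(subrK z (to_completion (y m))) -addrA.
  move: mz nz; rewrite -!ball_normE/= => h1 h2.
  by apply: (le_lt_trans (ler_normD _ _)); rewrite ltrD// distrC.
have cy : y \in subspace_pred cauchy_subspace.
  apply/mem_set/cauchy_seqsP => e e0; have [N NP] := small e e0.
  exists N => m n Nm Nn; apply: (lt_trans (ydist m n)).
  move: (NP m Nm) (NP n Nn).
  move: (m.+1%:R^-1 : R) (n.+1%:R^-1 : R) => u v hu hv; lra.
pose l : completion := to_quot cauchy_seminorm (SubspaceElt cy).
apply/cvg_ex; exists l; apply/cvg_ballP => e e0.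
have e20 : 0 < e / 2 by rewrite divr_gt0.
have [N NP] := small _ e20; have [M MP] := approx (SubspaceElt cy) e20.
pose n := maxn N M; have := yF n; apply: filterS => z.
rewrite -!ball_normE/= => h.
rewrite -(subrK (to_completion (y n)) l) -addrA (splitr e).
apply: (le_lt_trans (ler_normD _ _)); apply: ler_ltD.
  by rewrite distrC; apply: MP; rewrite leq_maxr.
apply: (lt_trans h); move: (NP n (leq_maxl _ _)) (i0 n).
by move: (n.+1%:R^-1 : R) => u h1 h2; lra.
Qed.

HB.instance Definition _ :=
  Uniform_isComplete.Build completion completion_complete.

End Completion.

Section BoundedSequences.
Context {R : realType} (E : nat -> normedModType R).

Definition seq_prod : Type := forall n, E n.

HB.instance Definition _ := gen_eqMixin seq_prod.
HB.instance Definition _ := gen_choiceMixin seq_prod.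

Let add (s t : seq_prod) : seq_prod := fun n => s n + t n.
Let opp (s : seq_prod) : seq_prod := fun n => - s n.
Let scale (a : R) (s : seq_prod) : seq_prod := fun n => a *: s n.

Let addA : associative add.
Proof. by move=> s t u; apply/functional_extensionality_dep => n; exact: addrA. Qed.

Let addC : commutative add.
Proof. by move=> s t; apply/functional_extensionality_dep => n; exact: addrC. Qed.

Let add0 : left_id ((fun n => 0) : seq_prod) add.
Proof. by move=> s; apply/functional_extensionality_dep => n; exact: add0r. Qed.

Let addN : left_inverse ((fun n => 0) : seq_prod) opp add.
Proof. by move=> s; apply/functional_extensionality_dep => n; exact: addNr. Qed.

HB.instance Definition _ := GRing.isZmodule.Build seq_prod addA addC add0 addN.

Let scaleA a b s : scale a (scale b s) = scale (a * b) s.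
Proof. by apply/functional_extensionality_dep => n; exact: scalerA. Qed.

Let scale1 : left_id 1 scale.
Proof. by move=> s; apply/functional_extensionality_dep => n; exact: scale1r. Qed.

Let scaleDr : right_distributive scale +%R.
Proof. by move=> a s t; apply/functional_extensionality_dep => n; exact: scalerDr. Qed.

Let scaleDl s : {morph scale^~ s : a b / a + b}.
Proof. by move=> a b; apply/functional_extensionality_dep => n; exact: scalerDl. Qed.

HB.instance Definition _ := GRing.Zmodule_isLmodule.Build R seq_prod
  scaleA scale1 scaleDr scaleDl.

Definition bounded_seqs : set seq_prod :=
  [set s | exists M : R, forall n, `|s n| <= M].

Fact bounded_seqs0 : bounded_seqs 0.
Proof. by exists 0 => n; rewrite normr0. Qed.

Fact bounded_seqsL (a : R) s t :
  bounded_seqs s -> bounded_seqs t -> bounded_seqs (a *: s + t).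
Proof.
move=> [M sM] [N tN]; exists (`|a| * M + N) => n.
apply: (le_trans (ler_normD _ _)); apply: lerD => //.
by rewrite [leLHS]normrZ; apply: ler_wpM2l => //; exact: sM.
Qed.

Definition bounded_subspace : subspace_of seq_prod :=
  Subspace bounded_seqs0 bounded_seqsL.

Definition linfty : Type := subspace_type bounded_subspace.
HB.instance Definition _ := GRing.Lmodule.on linfty.

Definition linfty_seq (s : linfty) : seq_prod := subspace_val s.

Definition linfty_norm (s : linfty) : R := sup (range (fun n => `|linfty_seq s n|)).

Let linfty_norm_ub (s : linfty) n : `|linfty_seq s n| <= linfty_norm s.
Proof.
have [M sM] : bounded_seqs (linfty_seq s) by exact/set_mem/subspace_valP.
by apply: ub_le_sup; [exists M => _ [k _ <-]|exists n].
Qed.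

Let linfty_norm_lub (s : linfty) r :
  (forall n, `|linfty_seq s n| <= r) -> linfty_norm s <= r.
Proof.
move=> sr; apply: ge_sup; first by exists `|linfty_seq s 0|, 0.
by move=> _ [n _ <-].
Qed.

Fact linfty_normD s t : linfty_norm (s + t) <= linfty_norm s + linfty_norm t.
Proof.
apply: linfty_norm_lub => n; apply: (le_trans (ler_normD _ _)).
exact: (lerD (linfty_norm_ub s n) (linfty_norm_ub t n)).
Qed.

Fact linfty_normZ (a : R) s : linfty_norm (a *: s) = `|a| * linfty_norm s.
Proof.
have le_scale b t : linfty_norm (b *: t) <= `|b| * linfty_norm t.
  apply: linfty_norm_lub => n; rewrite [leLHS]normrZ ler_wpM2l//.
  exact: (linfty_norm_ub t n).
apply/le_anti; rewrite le_scale/=.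
have [->|a0] := eqVneq a 0.
  by rewrite normr0 mul0r; exact: (le_trans (normr_ge0 _) (linfty_norm_ub (0 *: s) 0)).
rewrite -ler_pdivlMl ?normr_gt0// -normfV -{1}[s](scalerK a0).
exact: le_scale.
Qed.

Fact linfty_norm0_eq0 s : linfty_norm s = 0 -> s = 0.
Proof.
move=> s0; apply: val_inj; apply/functional_extensionality_dep => n.
have : `|linfty_seq s n| <= 0 by rewrite -s0; exact: linfty_norm_ub.
by rewrite normr_le0 => /eqP.
Qed.

HB.instance Definition _ := Lmodule_isNormed.Build R linfty
  linfty_normD linfty_normZ linfty_norm0_eq0.

Definition null_seqs : set linfty :=
  [set s | (fun n => `|linfty_seq s n|) @ \oo --> (0 : R)].

Fact null_seqs0 : null_seqs 0.
Proof.
rewrite /null_seqs/=; under eq_fun do rewrite normr0.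
exact: cvg_cst.
Qed.

Fact null_seqsL (a : R) s t :
  null_seqs s -> null_seqs t -> null_seqs (a *: s + t).
Proof.
rewrite /null_seqs/= => s0 t0.
have h : (fun n => `|a| * `|linfty_seq s n| + `|linfty_seq t n|) @ \oo --> (0 : R).
  rewrite -[X in _ --> X]addr0 -[X in X + _](mulr0 `|a|).
  by apply: cvgD => //; apply: cvgMl_tmp.
apply: (squeeze_cvgr _ (cvg_cst 0) h); apply: nearW => n.
by rewrite normr_ge0/= -normrZ; exact: ler_normD.
Qed.

Definition c0_subspace : subspace_of linfty := Subspace null_seqs0 null_seqsL.

End BoundedSequences.

Section DirectedLimit.
Context {R : realType} (E : nat -> normedModType R).
Context (f : forall n, {linear E n -> E n.+1}).

(* f_{n, n + d} *)
Fixpoint transition (n d : nat) (x : E n) : E (d + n)%N :=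
  match d return E (d + n)%N with
  | 0%N => x
  | d'.+1 => f (d' + n) (transition d' x)
  end.

(* s is the sequence whose class is f_{n, oo} x *)
Definition orbit_seq (n : nat) (x : E n) (s : linfty E) : Prop :=
  (forall k, (k < n)%N -> linfty_seq s k = 0) /\
  (forall d, linfty_seq s (d + n)%N = transition d x).

Definition dirlim_ambient : normedModType R := normed_quot (c0_subspace E).

Definition dirlim : set dirlim_ambient :=
  closure (\bigcup_n [set y | exists (x : E n) (s : linfty E),
    orbit_seq x s /\ y = to_quot (dist_seminorm (c0_subspace E)) s]).

End DirectedLimit.

Section PseudonormExtension.
Context {R : realType}.
Local Notation V := {poly rat}.
Local Notation c00 := {poly R}.

(* The space V of finitely supported rational sequences is {poly rat} and c_00
   is {poly R}, a polynomial being identified with its sequence of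
   coefficients. *)
Definition rat_c00 (v : V) : c00 := map_poly ratr v.

Definition pseudonorms : set {ptws {poly rat} -> R} :=
  [set mu | (forall x y, mu (x + y) <= mu x + mu y) /\
            (forall (q : rat) x, mu (q *: x) = `|ratr q| * mu x)].

Definition extends (mu : V -> R) (nu : seminorm c00) : Prop :=
  forall v, nu (rat_c00 v) = mu v.

HB.instance Definition _ := gen_eqMixin (seminorm c00).
HB.instance Definition _ := gen_choiceMixin (seminorm c00).

Fact zero_seminormD (x y : c00) : (0 : R) <= 0 + 0. Proof. by rewrite addr0. Qed.

Fact zero_seminormZ (a : R) (x : c00) : (0 : R) = `|a| * 0.
Proof. by rewrite mulr0. Qed.

Definition zero_seminorm : seminorm c00 :=
  @Seminorm R c00 (fun=> 0) zero_seminormD zero_seminormZ.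

(* The unique extension of a pseudonorm on V to c_00: existence and uniqueness
   are extends_exists and extends_unique below; zero_seminorm is a dummy value
   used when mu is not a pseudonorm. *)
Definition pseudonorm_ext (mu : V -> R) : seminorm c00 :=
  xget zero_seminorm [set nu | extends mu nu].

Let rat_c00X i : rat_c00 'X^i = 'X^i.
Proof. exact: map_polyXn. Qed.

Let rat_c00D v w : rat_c00 (v + w) = rat_c00 v + rat_c00 w.
Proof. exact: rmorphD. Qed.

Let rat_c00Z q v : rat_c00 (q *: v) = ratr q *: rat_c00 v.
Proof. by rewrite /rat_c00 map_polyZ. Qed.

Let wnorm (c : nat -> R) (x : c00) : R := \sum_(i < size x) `|x`_i| * c i.

Let wnormE c (x : c00) m : (size x <= m)%N ->
  wnorm c x = \sum_(i < m) `|x`_i| * c i.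
Proof.
move=> xm; rewrite /wnorm (big_ord_widen m (fun i => `|x`_i| * c i) xm).
rewrite big_mkcond; apply: eq_bigr => i _; case: ltnP => // xi.
by rewrite nth_default// normr0 mul0r.
Qed.

Let wnormD c x y : (forall i, 0 <= c i) ->
  wnorm c (x + y) <= wnorm c x + wnorm c y.
Proof.
move=> c0; pose m := maxn (size x) (size y).
rewrite (@wnormE c (x + y) m) ?size_polyD// (@wnormE c x m) ?leq_maxl//.
rewrite (@wnormE c y m) ?leq_maxr// -big_split/=; apply: ler_sum => i _.
by rewrite coefD -mulrDl ler_wpM2r// ler_normD.
Qed.

Let wnormZ c a x : wnorm c (a *: x) = `|a| * wnorm c x.
Proof.
rewrite (@wnormE c (a *: x) (size x)) ?size_scale_leq// mulr_sumr.
by apply: eq_bigr => i _; rewrite coefZ normrM mulrA.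
Qed.

Let wnorm_ge0 c x : (forall i, 0 <= c i) -> 0 <= wnorm c x.
Proof. by move=> c0; apply: sumr_ge0 => i _; rewrite mulr_ge0. Qed.

Let rat_approx (c e : R) : 0 < e -> exists q : rat, `|c - ratr q| < e.
Proof.
move=> e0; have : c - e < c + e by lra.
move=> /rat_in_itvoo[q]; rewrite in_itv/= => /andP[h1 h2].
by exists q; rewrite ltr_norml; apply/andP; split; lra.
Qed.

Let c00_approx c (x : c00) (e : R) : (forall i, 0 <= c i) -> 0 < e ->
  exists v, wnorm c (x - rat_c00 v) < e.
Proof.
move=> c0 e0; pose K : R := 1 + \sum_(i < size x) c i.
have K0 : 0 < K by rewrite ltr_wpDr// sumr_ge0.
have /choice[q qP] : forall i, exists q : rat, `|x`_i - ratr q| < e / K.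
  by move=> i; apply: rat_approx; rewrite divr_gt0.
pose v : V := \poly_(i < size x) q i; exists v.
have vE i : (i < size x)%N -> (x - rat_c00 v)`_i = x`_i - ratr (q i).
  by move=> xi; rewrite coefB coef_map coef_poly xi.
rewrite (@wnormE c _ (size x)); last first.
  rewrite (leq_trans (size_polyD _ _))// size_polyN geq_max leqnn/=.
  by rewrite (leq_trans (size_poly _ _))// size_poly.
apply: (@le_lt_trans _ _ (\sum_(i < size x) e / K * c i)).
  by apply: ler_sum => i _; rewrite vE// ler_wpM2r// ltW.
rewrite -mulr_sumr mulrAC ltr_pdivrMr// ltr_pM2l//.
by rewrite /K ltrDr.
Qed.

Let seminorm_wnorm (nu : seminorm c00) x : nu x <= wnorm (fun i => nu 'X^i) x.
Proof.
rewrite /wnorm -{1}(coefK x) poly_def.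
elim/big_ind2: _ => [|a b c d ab cd|i _]; first by rewrite seminorm0.
  by apply: (le_trans (seminormD _ _ _)); exact: lerD.
by rewrite seminormZ.
Qed.

Lemma extends_unique mu nu nu' : extends mu nu -> extends mu nu' -> nu =1 nu'.
Proof.
move=> munu munu' x; apply/eqP; rewrite -subr_eq0 -normr_le0.
apply/ler_addgt0Pr => e e0; rewrite add0r.
pose c i := mu 'X^i.
have cE : c = fun i => nu 'X^i by apply/funext => i; rewrite /c -munu rat_c00X.
have cE' : c = fun i => nu' 'X^i by apply/funext => i; rewrite /c -munu' rat_c00X.
have c0 i : 0 <= c i by rewrite cE seminorm_ge0.
have [v vx] := c00_approx x c0 (divr_gt0 e0 (ltr0n R 2)).
have h := le_trans (seminorm_dist nu x (rat_c00 v)) (seminorm_wnorm nu _).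
have h' := le_trans (seminorm_dist nu' x (rat_c00 v)) (seminorm_wnorm nu' _).
rewrite -cE munu in h; rewrite -cE' munu' in h'.
have -> : nu x - nu' x = (nu x - mu v) - (nu' x - mu v) by ring.
apply: (le_trans (ler_normB _ _)); rewrite (splitr e) lerD//.
  exact: (le_trans h (ltW vx)).
exact: (le_trans h' (ltW vx)).
Qed.

Lemma extends_exists mu : pseudonorms mu -> exists nu, extends mu nu.
Proof.
move=> [muD muZ]; pose c i : R := mu 'X^i.
have mu0 : mu 0 = 0 by rewrite -(scale0r (0 : V)) muZ rmorph0 normr0 mul0r.
have muN v : mu (- v) = mu v by rewrite -scaleN1r muZ rmorphN rmorph1 normrN1 mul1r.
have mu_ge0 v : 0 <= mu v.
  by have := muD v (- v); rewrite subrr mu0 muN => h; lra.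
have c0 i : 0 <= c i by exact: mu_ge0.
have mu_wnorm v : mu v <= wnorm c (rat_c00 v).
  rewrite /wnorm size_map_poly -{1}(coefK v) poly_def.
  elim/big_ind2: _ => [|a b d e' ab cd|i _]; first by rewrite mu0.
    by apply: (le_trans (muD _ _)); exact: lerD.
  by rewrite muZ coef_map.
pose D x v := mu v + wnorm c (x - rat_c00 v).
have D0 x v : 0 <= D x v by rewrite addr_ge0// wnorm_ge0.
pose nu x : R := inf (range (D x)).
have nu_le x v : nu x <= D x v.
  by apply: ge_inf; [exists 0 => _ [w _ <-]|exists v].
have nu_glb x r : (forall v, r <= D x v) -> r <= nu x.
  by move=> h; apply: lb_le_inf; [exists (D x 0), 0|move=> _ [v _ <-]].
have nuD x y : nu (x + y) <= nu x + nu y.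
  rewrite -lerBlDr; apply/nu_glb => v; rewrite lerBlDr -lerBlDl.
  apply/nu_glb => w; rewrite lerBlDl; apply: (le_trans (nu_le _ (v + w))).
  rewrite /D rat_c00D opprD addrACA [leRHS]addrACA lerD ?muD//.
  exact: wnormD.
have nu_scale a x : nu (a *: x) <= `|a| * nu x.
  apply/ler_addgt0Pr => e e0.
  have [->|a0] := eqVneq a 0.
    rewrite scale0r normr0 mul0r add0r (le_trans (nu_le 0 0))//.
    rewrite /D mu0 /rat_c00 rmorph0 subrr add0r /wnorm size_poly0 big_ord0.
    exact: ltW.
  rewrite -lerBlDr -ler_pdivrMl ?normr_gt0//; apply/nu_glb => v.
  rewrite ler_pdivrMl ?normr_gt0// lerBlDr.
  pose K := 1 + (mu v + wnorm c (rat_c00 v)).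
  have K0 : 0 < K by rewrite ltr_wpDr// addr_ge0// wnorm_ge0.
  have [q qa] := rat_approx a (divr_gt0 e0 K0).
  apply: (le_trans (nu_le _ (q *: v))); rewrite /D muZ rat_c00Z.
  have -> : a *: x - ratr q *: rat_c00 v =
            a *: (x - rat_c00 v) + (a - ratr q) *: rat_c00 v.
    by rewrite scalerBr scalerBl addrA subrK.
  have h1 : `|ratr q| * mu v <= (`|a| + `|a - ratr q|) * mu v.
    rewrite ler_wpM2r// -{1}(subrK a (ratr q)) addrC distrC.
    exact: ler_normD.
  have h2 := wnormD (a *: (x - rat_c00 v)) ((a - ratr q) *: rat_c00 v) c0.
  rewrite !wnormZ in h2.
  have h3 : `|a - ratr q| * K <= e by rewrite -ler_pdivlMr// ltW.
  have h4 : 0 <= `|a - ratr q| by [].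
  move: h1 h2 h3 h4; rewrite /K.
  move: (wnorm c (_ + _)) (wnorm c (x - _)) (wnorm c (rat_c00 v)) => A B C.
  move: (`|a - ratr q|) => d h1 h2 h3 h4.
  apply: (le_trans (lerD h1 h2)); lra.
have nuZ a x : nu (a *: x) = `|a| * nu x.
  apply/le_anti; rewrite nu_scale/=.
  have [->|a0] := eqVneq a 0.
    by rewrite normr0 mul0r; apply/nu_glb.
  rewrite -ler_pdivlMl ?normr_gt0// -normfV -{1}[x](scalerK a0).
  exact: nu_scale.
exists (Seminorm nuD nuZ) => v /=; apply/le_anti/andP; split.
  apply: (le_trans (nu_le _ v)); rewrite /D subrr /wnorm size_poly0 big_ord0.
  by rewrite addr0.
apply/nu_glb => w; rewrite /D.
have -> : rat_c00 v - rat_c00 w = rat_c00 (v - w) by rewrite /rat_c00 rmorphB.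
apply: (@le_trans _ _ (mu w + mu (v - w))); last by rewrite lerD2l.
by rewrite -{1}(subrKC w v) muD.
Qed.

Lemma pseudonorm_extP mu : pseudonorms mu -> extends mu (pseudonorm_ext mu).
Proof.
by move=> /extends_exists[nu munu]; exact: (xgetPex zero_seminorm (ex_intro _ nu munu)).
Qed.

End PseudonormExtension.

Section Codings.
Context {R : realType}.

Definition X_ (mu : {poly rat} -> R) : completeNormedModType R :=
  completion (seminorm_quot (pseudonorm_ext mu)).

Definition pseudonorms_infty : set {ptws {poly rat} -> R} :=
  [set mu | pseudonorms mu /\ ~ finite_dim (X_ mu)].

Definition norms_infty : set {ptws {poly rat} -> R} :=
  [set mu | pseudonorms_infty mu /\
            forall x, pseudonorm_ext mu x = 0 -> x = 0].

End Codings.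

Arguments pseudonorms R : clear implicits.
Arguments pseudonorms_infty R : clear implicits.
Arguments norms_infty R : clear implicits.

Section Meager.
Context {T : topologicalType}.

Definition nowhere_dense (A : set T) : Prop := (closure A)° = set0.

Definition meager (A : set T) : Prop :=
  exists2 F : (set T)^nat,
    (forall n, nowhere_dense (F n)) & A `<=` \bigcup_n F n.

Definition comeager (A : set T) : Prop := meager (~` A).

Definition separable : Prop := exists2 D : set T, countable D & dense D.

End Meager.

Arguments separable T : clear implicits.

Definition comeager_in_closure (T : topologicalType) (A : set T) : Prop :=
  comeager [set x : closure A | A (set_val x)].

Section Operators.
Context {R : realType}.
Implicit Types Y Z : normedModType R.

Definition Emb (C : R) Y Z : set {linear Y -> Z} :=
  [set T | forall y, expR (- C) * `|y| <= `|T y| <= expR C * `|y|].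

Definition isometric_embedding Y Z (T : {linear Y -> Z}) : Prop :=
  forall y, `|T y| = `|y|.

Definition Iso Y : set {linear Y -> Y} :=
  [set T | isometric_embedding T /\ range T = setT].

Definition isometric Y Z : Prop :=
  exists T : {linear Y -> Z}, isometric_embedding T /\ range T = setT.

Definition isometric_onto Y Z (A : set Z) : Prop :=
  exists T : {linear Y -> Z}, isometric_embedding T /\ range T = A.

Definition opnorm Y Z (f : Y -> Z) : R :=
  sup [set `|f y| | y in [set y | `|y| <= 1]].

End Operators.

Section Age.
Context {R : realType}.
Implicit Types E F X : normedModType R.

(* The value is +oo when there is no isomorphism, that is, when the dimensions
   differ: this makes BM the disjoint union of the BM_n. *)
Definition d_BM E F : \bar R :=
  ereal_inf [set r : \bar R | exists (T : {linear E -> F}) (S : {linear F -> E}),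
    [/\ cancel T S, cancel S T & r = (ln (opnorm T * opnorm S))%:E]].

Definition Age X E : Prop :=
  finite_dim E /\ exists T : {linear E -> X}, isometric_embedding T.

(* As all notions here are invariant under isometry, subsets of BM are
   represented by predicates on spaces rather than on isometry classes *)
Definition Age_cl X F : Prop :=
  finite_dim F /\
  forall e : R, 0 < e -> exists2 E, Age X E & (d_BM E F < e%:E)%E.

End Age.

Section Game.
Context {R : realType} (X : normedModType R).

Record opening := Opening {
  opening_space : normedModType R ;
  opening_eps : R ;
  opening_age : Age_cl X opening_space ;
  opening_eps_gt0 : 0 < opening_eps }.

Record game_move (E : normedModType R) (eps : R) := Move {
  move_space : normedModType R ;
  move_map : {linear E -> move_space} ;
  move_eps : R ;
  move_age : Age_cl X move_space ;
  move_emb : Emb eps move_map ;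
  move_eps_gt0 : 0 < move_eps ;
  move_eps_lt : move_eps < eps }.

(* position n E eps: n moves have been played, E and eps being the space and
   the real number played last *)
Inductive position : nat -> normedModType R -> R -> Type :=
| FirstMove (o : opening) : position 1 (opening_space o) (opening_eps o)
| NextMove n E eps (p : position n E eps) (m : game_move E eps) :
    position n.+1 (move_space m) (move_eps m).

Definition strategy := forall n E eps, position n E eps -> game_move E eps.

(* The n-th move of the game, for n >= 1, is (run_space (n - 1),
   run_map (n - 2), run_eps (n - 1)). *)
Record run := Run {
  run_space : nat -> normedModType R ;
  run_map : forall n, {linear run_space n -> run_space n.+1} ;
  run_eps : nat -> R ;
  run_age : forall n, Age_cl X (run_space n) ;
  run_emb : forall n, Emb (run_eps n) (run_map n) ;
  run_eps_gt0 : forall n, 0 < run_eps n ;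
  run_eps_lt : forall n, run_eps n.+1 < run_eps n }.

Definition run_opening (r : run) : opening :=
  Opening (run_age r 0) (run_eps_gt0 r 0).

Definition run_move (r : run) (n : nat) : game_move (run_space r n) (run_eps r n) :=
  Move (run_age r n.+1) (@run_emb r n) (run_eps_gt0 r n.+1) (run_eps_lt r n).

Fixpoint run_position (r : run) (n : nat) :
    position n.+1 (run_space r n) (run_eps r n) :=
  match n with
  | 0%N => FirstMove (run_opening r)
  | n'.+1 => NextMove (run_position r n') (run_move r n')
  end.

(* run_move r n is the (n + 2)-nd move of the game; it is made by Player II if n
   is even and by Player I if n is odd. *)
Definition follows_II (s : strategy) (r : run) : Prop :=
  forall n, ~~ odd n -> run_move r n = s _ _ _ (run_position r n).

Definition follows_I (o : opening) (s : strategy) (r : run) : Prop :=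
  run_opening r = o /\
  forall n, odd n -> run_move r n = s _ _ _ (run_position r n).

Definition wins_II (r : run) : Prop :=
  cvgn (series (run_eps r)) /\ isometric_onto X (dirlim (run_map r)).

Definition II_has_winning_strategy : Prop :=
  exists s : strategy, forall r, follows_II s r -> wins_II r.

Definition I_has_winning_strategy : Prop :=
  exists (o : opening) (s : strategy),
    forall r, follows_I o s r -> ~ wins_II r.

End Game.

Section GuardedFraisse.
Context {R : realType} (X : completeNormedModType R).

Definition gF1 : Prop :=
  forall (E : subspace_of X) (eps : R), finite_dim (subspace_type E) -> 0 < eps ->
  exists (delta : R) (F : subspace_of X) (EF : E `<=` F),
    [/\ 0 < delta, finite_dim (subspace_type F) &
      forall i i' : {linear subspace_type F -> X}, Emb delta i -> Emb delta i' ->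
      exists T : {linear X -> X}, Iso T /\
        opnorm (fun x : subspace_type E =>
          i' (subspace_incl EF x) - T (i (subspace_incl EF x))) < eps].

Definition gF2 : Prop :=
  forall (E : subspace_of X) (eps : R), finite_dim (subspace_type E) -> 0 < eps ->
  exists (F : normedModType R) (phi : {linear subspace_type E -> F}) (delta : R),
    [/\ Age_cl X F, Emb eps phi, 0 < delta &
      forall (G : normedModType R) (psi : {linear F -> G}) (eta : R),
        Age_cl X G -> Emb delta psi -> 0 < eta ->
      exists2 i : {linear G -> X}, Emb eta i &
        opnorm (fun x : subspace_type E => subspace_val x - i (psi (phi x))) < eps].

Definition guarded_Fraisse : Prop := separable X /\ (gF1 \/ gF2).

End GuardedFraisse.

Definition isometry_class (R : realType) (X : normedModType R)
    (I : set {ptws {poly rat} -> R}) : set I :=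
  [set mu | isometric (X_ (set_val mu)) X].

Arguments isometry_class {R} X I _.

(* Main.v *)
Require Import Defs.
From HB Require Import structures.
From mathcomp Require Import all_boot all_order all_algebra.
From mathcomp Require Import all_classical all_reals all_analysis.
From mathcomp Require Import borel_hierarchy.
From mathcomp Require Import ring lra zify.

Import Order.TTheory GRing.Theory Num.Theory.
Import numFieldNormedType.Exports.
Local Open Scope classical_set_scope.
Local Open Scope ring_scope.

Set Implicit Arguments.
Unset Strict Implicit.
Unset Printing Implicit Defensive.

(** The theorem compares three ways of saying that X is determined by its
    finite-dimensional subspaces up to small errors. The common language is that of
    types of sequences: near_type N r a b says that the linear combinations of the
    first N terms of a and of b have the same norms, with an error of at most r times
    the l1 norm of the coefficients. A pseudonorm is the type of the unit vectors in
    the space that it codes, and its neighbourhoods are given by near_type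
    (nbhs_near, near_nbhs). A code of X is the type of a sequence of X with dense span.

    Weak amalgamation makes the class a countable intersection of open sets. The
    second guarded condition says that every finite tuple of X is the beginning of a
    tuple, its guard, such that the tuples of X that continue an almost copy of the
    guard are almost copied in X with little effect on the initial tuple
    (gF2_guarded). Two complete spaces that are guarded for each other, one of which
    has almost the finite tuples of the other, are isometric by a back-and-forth
    construction in which only the guarded parts are kept at each stage
    (back_and_forth). Let x be a dense sequence in X. That the unit vectors of a coded
    space are guarded by tuples of terms of x, and that over these guards all tuples of
    terms of x are realized, are countably many conditions on the type; they can be
    arranged to be open (guard_condition_near, extension_condition_near) and they hold
    exactly for the codes of X (conditions_isometric, conditions_transfer). Hence the
    class is Gdelta (guarded_Gdelta), and as such it is comeager in its closure
    (Gdelta_comeager).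

    From category to the game, in infinite dimension. Comeagerness provides countably
    many conditions on types such that every linearly independent sequence with dense
    span in X can be perturbed and prolonged to meet any given one of them, and which
    jointly imply that the coded space is isometric to X (comeager_conditions). This
    has the same meaning for the three spaces of codes, since the codes of independent
    sequences belong to all of them. Player II meets the conditions one by one: at each
    turn the space played last is almost embedded in X, its basis is perturbed and
    prolonged there, and the span of the new sequence is played, with a precision so
    small that the condition survives all later distortions (data_step_II). The chosen
    bases converge in the direct limit to a sequence whose type meets all conditions,
    so that the limit is isometric to X (modelled_run_won). In finite dimension
    Player II keeps playing X, and compactness shows that the limit, which is almost
    isometric to X with any precision, is isometric to X (finite_dim_winning).

    The two players cannot both have winning strategies (winning_II_not_I). Finally,
    suppose that the second guarded condition fails for some E and e. Then Player I
    starts with E and ensures that after each of its moves no almost isometric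
    embedding of the new space in X brings any embedding of E in the previous space
    close to the inclusion of E. Each embedding of E can be defeated by the failure of
    the condition, and a finite net of them is defeated successively (defeat_all). An
    isometry from the limit to X would provide an undefeated embedding at some stage
    (good_run_not_won). Thus, if Player I has no winning strategy, the second
    condition holds (not_I_gF2); it is also implied by the first (gF1_gF2). *)

(** * Linear combinations and approximate types *)

Section LinearCombinations.
Context {R : realType} {V : lmodType R}.
Implicit Types (x y : nat -> V) (p q : {poly R}).

(** Coefficient families are polynomials: the linear combinations of the first n terms
    of x are the lcp x p with size p <= n, and substituting combinations in
    combinations is lcp again, by linearity. *)
Definition lcp x p : V := \sum_(i < size p) p`_i *: x i.

Lemma lcpE m x p : (size p <= m)%N -> lcp x p = \sum_(i < m) p`_i *: x i.
Proof.
move=> pm; rewrite /lcp (big_ord_widen m (fun i => p`_i *: x i) pm).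
rewrite big_mkcond; apply: eq_bigr => i _; case: ltnP => // pi.
by rewrite nth_default// scale0r.
Qed.

Fact lcp_is_linear x : linear (lcp x).
Proof.
move=> a p q; pose m := maxn (size p) (size q).
have pm : (size p <= m)%N by exact: leq_maxl.
have qm : (size q <= m)%N by exact: leq_maxr.
rewrite (lcpE x pm) (lcpE x qm) (@lcpE m); last first.
  rewrite (leq_trans (size_polyD _ _))// geq_max qm andbT.
  exact: leq_trans (size_scale_leq _ _) pm.
rewrite scaler_sumr -big_split/=; apply: eq_bigr => i _.
by rewrite coefD coefZ scalerDl scalerA.
Qed.

HB.instance Definition _ x :=
  GRing.isLinear.Build R {poly R} V _ (lcp x) (lcp_is_linear x).

Lemma lcpX x i : lcp x 'X^i = x i.
Proof.
rewrite /lcp size_polyXn big_ord_recr/= big1 ?add0r ?coefXn ?eqxx ?scale1r//.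
by move=> j _; rewrite coefXn ltn_eqF// scale0r.
Qed.

Lemma eq_lcp n x y p : (size p <= n)%N -> (forall i, (i < n)%N -> x i = y i) ->
  lcp x p = lcp y p.
Proof.
move=> pn xy; apply: eq_bigr => i _; rewrite xy//.
exact: leq_trans (ltn_ord i) pn.
Qed.

End LinearCombinations.

Lemma lcp_map (R : realType) (V W : lmodType R) (f : {linear V -> W})
    (x : nat -> V) p : f (lcp x p) = lcp (fun i => f (x i)) p.
Proof. by rewrite linear_sum; apply: eq_bigr => i _; rewrite linearZ. Qed.

Lemma lcpB (R : realType) (V : lmodType R) (x y : nat -> V) p :
  lcp x p - lcp y p = lcp (fun i => x i - y i) p.
Proof. by rewrite /lcp -sumrB; apply: eq_bigr => i _; rewrite scalerBr. Qed.

Section CoefficientNorm.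
Context {R : realType}.
Implicit Types p q : {poly R}.

Definition l1 p : R := \sum_(i < size p) `|p`_i|.

Lemma l1E m p : (size p <= m)%N -> l1 p = \sum_(i < m) `|p`_i|.
Proof.
move=> pm; rewrite /l1 (big_ord_widen m (fun i => `|p`_i|) pm).
rewrite big_mkcond; apply: eq_bigr => i _; case: ltnP => // pi.
by rewrite nth_default// normr0.
Qed.

Lemma l1_ge0 p : 0 <= l1 p. Proof. exact: sumr_ge0. Qed.

Lemma l1D p q : l1 (p + q) <= l1 p + l1 q.
Proof.
pose m := maxn (size p) (size q).
rewrite (@l1E m (p + q)) ?size_polyD// (@l1E m p) ?leq_maxl//.
rewrite (@l1E m q) ?leq_maxr// -big_split/=; apply: ler_sum => i _.
by rewrite coefD ler_normD.
Qed.

Lemma l1Z a p : l1 (a *: p) = `|a| * l1 p.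
Proof.
rewrite (@l1E (size p)) ?size_scale_leq// mulr_sumr.
by apply: eq_bigr => i _; rewrite coefZ normrM.
Qed.

Lemma l1X i : l1 'X^i = 1.
Proof.
rewrite /l1 size_polyXn big_ord_recr/= big1 ?add0r ?coefXn ?eqxx ?normr1//.
by move=> j _; rewrite coefXn ltn_eqF// normr0.
Qed.

Lemma l1_coef p i : `|p`_i| <= l1 p.
Proof.
case: (ltnP i (size p)) => [ip|pi]; last by rewrite nth_default// normr0 l1_ge0.
by rewrite /l1 (bigD1 (Ordinal ip))//= lerDl sumr_ge0.
Qed.

(** Stated for an arbitrary function in place of a norm because it is applied both to
    norms and to l1 itself. *)
Lemma lcp_le (V : lmodType R) (nu : V -> R) n M (x : nat -> V) p :
    nu 0 = 0 -> (forall u v, nu (u + v) <= nu u + nu v) ->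
    (forall a u, nu (a *: u) = `|a| * nu u) -> (size p <= n)%N ->
  (forall i, (i < n)%N -> nu (x i) <= M) -> nu (lcp x p) <= l1 p * M.
Proof.
move=> nu0 nuD nuZ pn xM; rewrite /lcp /l1 mulr_suml.
elim/big_ind2 : _ => [|a b c d ab cd|i _]; first by rewrite nu0.
  by apply: (le_trans (nuD _ _)); exact: lerD.
by rewrite nuZ ler_wpM2l// xM// (leq_trans (ltn_ord i) pn).
Qed.

Lemma norm_lcp_le (V : normedModType R) n M (x : nat -> V) p :
    (size p <= n)%N ->
  (forall i, (i < n)%N -> `|x i| <= M) -> `|lcp x p| <= l1 p * M.
Proof.
by apply: lcp_le => //[|u v|a u]; [exact: normr0|exact: ler_normD|exact: normrZ].
Qed.

Lemma l1_lcp_le n M (W : nat -> {poly R}) p : (size p <= n)%N ->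
  (forall i, (i < n)%N -> l1 (W i) <= M) -> l1 (lcp W p) <= l1 p * M.
Proof.
apply: lcp_le => [|u v|a u]; [|exact: l1D|exact: l1Z].
by rewrite /l1 size_poly0 big_ord0.
Qed.

Lemma size_lcp n m (W : nat -> {poly R}) p : (size p <= n)%N ->
  (forall i, (i < n)%N -> (size (W i) <= m)%N) -> (size (lcp W p) <= m)%N.
Proof.
move=> pn Wm; apply: (leq_trans (size_sum _ _ _)); apply/bigmax_leqP => i _.
by rewrite (leq_trans (size_scale_leq _ _))// Wm// (leq_trans (ltn_ord i) pn).
Qed.

End CoefficientNorm.

Lemma finite_bound (R : realType) (f : nat -> R) n :
  exists2 M, 0 < M & forall i, (i < n)%N -> f i <= M.
Proof.
elim: n => [|n [M M0 fM]]; first by exists 1.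
exists (Num.max M (f n)); first by rewrite lt_max M0.
move=> i; rewrite ltnS leq_eqVlt => /predU1P[->|/fM fiM].
  by rewrite le_max lexx orbT.
by rewrite le_max fiM.
Qed.

Lemma finite_bound_nat (f : nat -> nat) n :
  exists M, forall i, (i < n)%N -> (f i <= M)%N.
Proof.
elim: n => [|n [M fM]]; first by exists 0%N.
exists (maxn M (f n)) => i; rewrite ltnS leq_eqVlt => /predU1P[->|/fM fiM].
  exact: leq_maxr.
by rewrite (leq_trans fiM)// leq_maxl.
Qed.

Section Near.
Context {R : realType}.
Implicit Types Y Z W : normedModType R.

(** The notion of approximation used throughout, for sequences in possibly different
    spaces. The error is measured against the l1 norm of the coefficients and not
    against the norm of the combination, so that it makes sense for dependent terms
    and is stable under small perturbations. *)
Definition near_type N (r : R) Y Z (a : nat -> Y) (b : nat -> Z) : Prop :=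
  forall p : {poly R}, (size p <= N)%N -> `| `|lcp a p| - `|lcp b p| | <= r * l1 p.

Lemma near_sym N r Y Z (a : nat -> Y) (b : nat -> Z) :
  near_type N r a b -> near_type N r b a.
Proof. by move=> h p pN; rewrite distrC h. Qed.

Lemma near_trans N r s Y Z W (a : nat -> Y) (b : nat -> Z) (c : nat -> W) :
  near_type N r a b -> near_type N s b c -> near_type N (r + s) a c.
Proof.
move=> ab bc p pN; rewrite -(subrK `|lcp b p| `|lcp a p|) -addrA.
by rewrite (le_trans (ler_normD _ _))// mulrDl lerD// ?ab ?bc.
Qed.

Lemma near_le N M r s Y Z (a : nat -> Y) (b : nat -> Z) :
  (N <= M)%N -> r <= s -> near_type M r a b -> near_type N s a b.
Proof.
move=> NM rs ab p pN; apply: (le_trans (ab p (leq_trans pN NM))).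
by rewrite ler_wpM2r// l1_ge0.
Qed.

Lemma near_dist N r Y (a b : nat -> Y) :
  (forall i, (i < N)%N -> `|a i - b i| <= r) -> near_type N r a b.
Proof.
move=> ab p pN; apply: (le_trans (ler_dist_dist _ _)).
by rewrite lcpB mulrC (norm_lcp_le pN).
Qed.

Lemma near_eq N Y (a b : nat -> Y) :
  (forall i, (i < N)%N -> a i = b i) -> near_type N 0 a b.
Proof. by move=> ab; apply: near_dist => i /ab ->; rewrite subrr normr0. Qed.

Lemma near_lcp N N' r K (w : nat -> {poly R}) Y Z (a : nat -> Y) (b : nat -> Z) :
    0 <= r -> near_type N r a b ->
    (forall i, (i < N')%N -> (size (w i) <= N)%N /\ l1 (w i) <= K) ->
  near_type N' (r * K) (fun i => lcp a (w i)) (fun i => lcp b (w i)).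
Proof.
move=> r0 ab wK p pN; rewrite -!lcp_map.
have ws : (size (lcp w p) <= N)%N by apply: size_lcp pN _ => i /wK[].
apply: (le_trans (ab _ ws)); rewrite -mulrA ler_wpM2l// mulrC.
by apply: l1_lcp_le pN _ => i /wK[].
Qed.

Lemma near_reindex N N' r (f : nat -> nat) Y Z (a : nat -> Y) (b : nat -> Z) :
    0 <= r -> near_type N r a b -> (forall i, (i < N')%N -> (f i < N)%N) ->
  near_type N' r (fun i => a (f i)) (fun i => b (f i)).
Proof.
move=> r0 ab fN; rewrite -[r]mulr1.
have := @near_lcp N N' r 1 (fun i => 'X^(f i)) _ _ a b r0 ab.
under eq_fun do rewrite lcpX; under [X in near_type _ _ _ X]eq_fun do rewrite lcpX.
by apply => i /fN fi; rewrite size_polyXn l1X.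
Qed.

Lemma near_isometry N r Y Y' Z (T : {linear Y -> Y'}) (a : nat -> Y) (b : nat -> Z) :
  isometric_embedding T -> near_type N r (fun i => T (a i)) b <-> near_type N r a b.
Proof.
by move=> iT; split=> ab p /ab; rewrite -lcp_map iT.
Qed.

Lemma near_norm N r Y Z (a : nat -> Y) (b : nat -> Z)
    (p : {poly R}) M : near_type N r a b ->
  (size p <= N)%N -> r * l1 p <= M -> `|lcp a p| <= `|lcp b p| + M.
Proof.
move=> ab pN pM; have := ab _ pN; rewrite ler_distl => /andP[_ h].
by apply: le_trans h _; rewrite lerD2l.
Qed.

End Near.

(** * Isometries and sequences with dense span *)

Section Completeness.
Context {R : realType}.
Implicit Types X Y Z : normedModType R.

Definition seq_complete Z : Prop := forall u : nat -> Z,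
  (forall e, 0 < e -> exists N, forall m n, (N <= m)%N -> (N <= n)%N ->
    `|u m - u n| < e) ->
  exists l, forall e, 0 < e -> exists N, forall n, (N <= n)%N -> `|u n - l| < e.

Lemma complete_seq_complete (Z : completeNormedModType R) : seq_complete Z.
Proof.
move=> u cu; have /cvg_ex[l ul] : cvgn u.
  apply/cauchy_cvgP/cauchyP => e e0; have [N uN] := cu e e0.
  exists (u N); exists N => // n /= Nn; rewrite -ball_normE/=; exact: uN.
exists l => e e0; have /cvgrPdist_lt/(_ e e0)[N _ NP] := ul.
by exists N => n /NP; rewrite distrC.
Qed.

Lemma eq_small Z (u v : Z) : (forall e, 0 < e -> `|u - v| <= e) -> u = v.
Proof.
move=> h; apply/eqP; rewrite -subr_eq0 -normr_le0.
by apply/ler_addgt0Pr => e e0; rewrite add0r h.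
Qed.

Lemma seq_inv_lt (e : R) : 0 < e ->
  exists N, forall n, (N <= n)%N -> n.+1%:R^-1 < e.
Proof.
move=> e0; have [N _ NP] := near_infty_natSinv_lt (PosNum e0).
by exists N => n Nn; exact: NP.
Qed.

Definition dense_span Z (z : nat -> Z) : Prop :=
  forall w e, 0 < e -> exists p, `|w - lcp z p| < e.

(** The closure of the set of pairs (lcp x p, lcp z p) is the graph of the isometry:
    equality of the norms makes it single valued, density and completeness make it
    total. *)
Lemma isometry_extension X Z (x : nat -> X) (z : nat -> Z) :
    seq_complete Z -> dense_span x -> (forall p, `|lcp x p| = `|lcp z p|) ->
  exists T : {linear X -> Z}, isometric_embedding T /\ forall i, T (x i) = z i.
Proof.
move=> Zc xd xz.
pose G u w := forall e, 0 < e -> exists p, `|u - lcp x p| < e /\ `|w - lcp z p| < e.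
have Gex u : exists w, G u w.
  have i0 n : 0 < n.+1%:R^-1 :> R by rewrite invr_gt0.
  have /choice[p pu] : forall n, exists p, `|u - lcp x p| < n.+1%:R^-1.
    by move=> n; exact: xd.
  have [w ww] : exists w, forall e, 0 < e ->
      exists N, forall n, (N <= n)%N -> `|lcp z (p n) - w| < e.
    apply: Zc => e e0; have [N NP] := seq_inv_lt (divr_gt0 e0 (ltr0n R 2)).
    exists N => m n Nm Nn; rewrite -raddfB -xz raddfB/=.
    rewrite -(subrK u (lcp x _)) -addrA (le_lt_trans (ler_normD _ _))//.
    rewrite (splitr e) ltrD//; last exact: lt_trans (pu n) (NP _ Nn).
    by rewrite distrC; exact: lt_trans (pu m) (NP _ Nm).
  exists w => e e0; have [N NP] := ww e e0; have [M MP] := seq_inv_lt e0.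
  exists (p (maxn N M)); split; last by rewrite distrC NP ?leq_maxl.
  exact: lt_trans (pu _) (MP _ (leq_maxr _ _)).
have Gnorm u w : G u w -> `|w| = `|u|.
  move=> Guw; apply: eq_small => e e0.
  have [p [h1 h2]] := Guw (e / 2) (divr_gt0 e0 (ltr0n R 2)).
  have := ler_dist_dist w (lcp z p); have := ler_dist_dist u (lcp x p).
  rewrite xz => h3 h4.
  rewrite ler_norml; move: h3 h4; rewrite !ler_norml => /andP[] ? ? /andP[] ? ?.
  apply/andP; split; lra.
have Glin a u w u' w' : G u w -> G u' w' -> G (a *: u + u') (a *: w + w').
  move=> g g' e e0; pose d := e / (`|a| + 2).
  have a0 : 0 < `|a| + 2 by rewrite ltr_wpDl.
  have d0 : 0 < d by rewrite divr_gt0.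
  have [p [h1 h2]] := g d d0; have [q [h3 h4]] := g' d d0.
  exists (a *: p + q); rewrite (linearP (lcp x)) (linearP (lcp z))/=.
  have de : `|a| * d + d < e.
    have -> : e = d * (`|a| + 2) by rewrite /d divfK// gt_eqF.
    by lra.
  have bnd (N : normedModType R) (b b' c c' : N) : `|b - c| < d -> `|b' - c'| < d ->
    `|a *: b + b' - (a *: c + c')| < e.
  move=> bc bc'; rewrite opprD addrACA -scalerBr.
    apply: le_lt_trans de; rewrite (le_trans (ler_normD _ _))//.
    by rewrite normrZ lerD// ?ler_wpM2l// ltW.
by split; exact: bnd.
pose T u := projT1 (cid (Gex u)); have TG u : G u (T u) := projT2 (cid (Gex u)).
have Guniq u w : G u w -> w = T u.
  move=> g; have := Gnorm _ _ (Glin (-1) _ _ _ _ g (TG u)).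
  by rewrite !scaleN1r addNr normr0 => /normr0_eq0/eqP; rewrite addrC subr_eq0 => /eqP.
have Tlin : linear T by move=> a u v; apply/esym/Guniq/Glin.
pose TL := GRing.isLinear.Build R X Z _ T Tlin.
pose TT : {linear X -> Z} := HB.pack T TL.
exists TT; split=> [u|i]; first exact: Gnorm.
apply/esym/Guniq => e e0; exists 'X^i.
by rewrite !lcpX !subrr !normr0.
Qed.

(** The range of an isometry is complete, hence closed. *)
Lemma isometry_range_closed X Z (T : {linear X -> Z}) :
    seq_complete X -> isometric_embedding T ->
  forall w, (forall e, 0 < e -> exists u, `|w - T u| < e) -> exists u, w = T u.
Proof.
move=> Xc iT w wT.
have i0 n : 0 < n.+1%:R^-1 :> R by rewrite invr_gt0.
have /choice[u uw] : forall n, exists u, `|w - T u| < n.+1%:R^-1.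
  by move=> n; exact: wT.
have [l ul] : exists l, forall e, 0 < e ->
    exists N, forall n, (N <= n)%N -> `|u n - l| < e.
  apply: Xc => e e0; have [N NP] := seq_inv_lt (divr_gt0 e0 (ltr0n R 2)).
  exists N => m n Nm Nn; rewrite -iT raddfB/= -(subrK w (T (u m))) -addrA.
  rewrite (le_lt_trans (ler_normD _ _))// (splitr e) ltrD//.
    by rewrite distrC; exact: lt_trans (uw m) (NP _ Nm).
  exact: lt_trans (uw n) (NP _ Nn).
exists l; apply: eq_small => e e0.
have e20 := divr_gt0 e0 (ltr0n R 2).
have [N NP] := ul _ e20; have [M MP] := seq_inv_lt e20; pose n := maxn N M.
rewrite -(subrK (T (u n)) w) -addrA (le_trans (ler_normD _ _))// (splitr e).
rewrite lerD ?(ltW (lt_trans (uw n) (MP _ (leq_maxr _ _))))//.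
by rewrite -raddfB iT ltW// NP// leq_maxl.
Qed.

Lemma isometry_surjective X Z (T : {linear X -> Z}) (z : nat -> Z) :
    seq_complete X -> isometric_embedding T -> dense_span z ->
  (forall i, exists u, T u = z i) -> range T = setT.
Proof.
move=> Xc iT zd Tz; apply/seteqP; split=> // w _.
have [u ->] : exists u, w = T u; last by exists u.
apply: isometry_range_closed => // e e0; have [p wp] := zd w e e0.
have /choice[x xz] := Tz; exists (lcp x p); rewrite lcp_map.
by under eq_fun do rewrite xz.
Qed.

Lemma isometric_dense_span X Z (x : nat -> X) (z : nat -> Z) :
    seq_complete X -> seq_complete Z -> dense_span x -> dense_span z ->
  (forall p, `|lcp x p| = `|lcp z p|) -> isometric X Z.
Proof.
move=> Xc Zc xd zd xz; have [T [iT Tx]] := isometry_extension Zc xd xz.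
exists T; split=> //; apply: isometry_surjective zd _ => // i.
by exists (x i).
Qed.

Lemma isometric_inverse X Z (T : {linear X -> Z}) : isometric_embedding T ->
  range T = setT -> exists S : {linear Z -> X},
  [/\ isometric_embedding S, cancel T S & cancel S T].
Proof.
move=> iT rT; have /choice[S TS] : forall w, exists u, T u = w.
  by move=> w; have [u _ <-] : range T w by [rewrite rT]; exists u.
have Tinj u v : T u = T v -> u = v.
  by move=> uv; apply/eqP; rewrite -subr_eq0 -normr_eq0 -iT raddfB/= uv subrr normr0.
have Slin : linear S by move=> a u v; apply: Tinj; rewrite linearP/= !TS.
pose SS : {linear Z -> X} := HB.pack S (GRing.isLinear.Build R Z X _ S Slin).
exists SS; split=> [w|u|w]; last exact: TS.
  by rewrite -[in RHS](TS w) iT.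
by apply: Tinj; rewrite TS.
Qed.

Lemma dense_span_surj X Z (T : {linear X -> Z}) (x : nat -> X) :
    isometric_embedding T -> range T = setT -> dense_span x ->
  dense_span (fun i => T (x i)).
Proof.
move=> iT rT xd w e e0; have : range T w by rewrite rT.
move=> [u _ <-]; have [p up] := xd u e e0; exists p.
by rewrite -lcp_map -raddfB iT.
Qed.

End Completeness.


(** * Finite-dimensional spaces *)

Section FiniteDimension.
Context {R : realType}.

Definition independent N (V : lmodType R) (b : nat -> V) : Prop :=
  forall p : {poly R}, (size p <= N)%N -> lcp b p = 0 -> p = 0.

Definition spanning N (V : lmodType R) (b : nat -> V) : Prop :=
  forall x, exists2 p : {poly R}, (size p <= N)%N & x = lcp b p.

Lemma lcp_inj N (V : lmodType R) (b : nat -> V) (p q : {poly R}) :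
  independent N b -> (size p <= N)%N -> (size q <= N)%N ->
  lcp b p = lcp b q -> p = q.
Proof.
move=> bi pN qN pq; apply/eqP; rewrite -subr_eq0; apply/eqP/bi.
  by rewrite (leq_trans (size_polyD _ _))// size_polyN geq_max pN.
by rewrite raddfB/= pq subrr.
Qed.

Lemma eq_independent N (V : lmodType R) (b b' : nat -> V) :
  (forall i, (i < N)%N -> b i = b' i) -> independent N b -> independent N b'.
Proof. by move=> bb' bi p pN; rewrite -(eq_lcp pN bb'); exact: bi. Qed.

Lemma independent_inj N (V W : lmodType R) (f : {linear V -> W}) (b : nat -> V) :
    (forall x, f x = 0 -> x = 0) -> independent N b ->
  independent N (fun i => f (b i)).
Proof. by move=> fi bi p pN; rewrite -lcp_map => /fi; exact: bi. Qed.

Lemma independentS N (V : lmodType R) (b : nat -> V) : independent N b ->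
    ~ (exists2 p : {poly R}, (size p <= N)%N & b N = lcp b p) ->
  independent N.+1 b.
Proof.
move=> bi bN p pN p0.
have pS : p = \poly_(i < N) p`_i + p`_N *: 'X^N.
  apply/polyP => i; rewrite coefD coefZ coef_poly coefXn.
  case: ltngtP => [iN|Ni|->]; rewrite ?mulr0 ?mulr1 ?addr0 ?add0r//.
  by rewrite nth_default// (leq_trans pN).
have : lcp b (\poly_(i < N) p`_i) + p`_N *: b N = 0.
  by rewrite -p0 [in RHS]pS raddfD/= linearZ/= lcpX.
have [p'0|p'0 h] := eqVneq p`_N 0.
  rewrite p'0 scale0r addr0 => /(bi _ (size_poly _ _)) h.
  by rewrite pS h p'0 scale0r addr0.
exfalso; apply: bN; exists (- (p`_N)^-1 *: \poly_(i < N) p`_i).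
  by rewrite (leq_trans (size_scale_leq _ _))// size_poly.
apply: (scalerI p'0); rewrite linearZ/= scalerA mulrN divff// scaleN1r.
by apply/eqP; rewrite -addr_eq0 addrC h.
Qed.

(** The vectors of a finite spanning family are examined one after the other, and
    adjoined when they are not yet in the span. *)
Lemma basis_extension (V : lmodType R) N (u : nat -> V) : finite_dim V ->
    independent N u ->
  exists n b, [/\ (N <= n)%N, independent n b, spanning n b &
    forall i, (i < N)%N -> b i = u i].
Proof.
move=> [m [e eV]] ui.
suff H : forall k, (k <= m)%N -> exists n b,
    [/\ (N <= n)%N, independent n b, forall i : 'I_m, (i < k)%N ->
      exists2 p : {poly R}, (size p <= n)%N & e i = lcp b p
      & forall i, (i < N)%N -> b i = u i].
  have [n [b [? ? be ?]]] := H m (leqnn m); exists n, b; split=> // x.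
  have [c ->] := eV x; have /choice[w wP] : forall i : 'I_m, exists p : {poly R},
      (size p <= n)%N /\ e i = lcp b p.
    by move=> i; have [p ? ?] := be i (ltn_ord i); exists p.
  exists (\sum_i c i *: w i).
    rewrite (leq_trans (size_sum _ _ _))//; apply/bigmax_leqP => i _.
    by rewrite (leq_trans (size_scale_leq _ _))//; case: (wP i).
  rewrite linear_sum; apply: eq_bigr => i _; rewrite linearZ/=.
  by congr (_ *: _); case: (wP i).
elim=> [_|k IH km]; first by exists N, u.
have [n [b [Nn bi be bu]]] := IH (ltnW km); pose ek := e (Ordinal km).
have [[p pn ekp]|nek] := pselect (exists2 p : {poly R}, (size p <= n)%N & ek = lcp b p).
  exists n, b; split=> // i; rewrite ltnS leq_eqVlt => /predU1P[ik|/be//].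
  by exists p => //; rewrite -ekp; congr e; exact: val_inj.
pose b' i := if i == n then ek else b i.
have b'b i : (i < n)%N -> b i = b' i by move=> /ltn_eqF; rewrite /b' => ->.
exists n.+1, b'; split; first exact: leqW.
- apply: independentS; first exact: eq_independent b'b _.
  rewrite /b' eqxx => -[p pn h]; apply: nek; exists p => //.
  by rewrite h; apply/esym/(eq_lcp pn b'b).
- move=> i; rewrite ltnS leq_eqVlt => /predU1P[ik|/be[p pn eip]].
    exists 'X^n; first by rewrite size_polyXn.
    by rewrite lcpX /b' eqxx; congr e; exact: val_inj.
  by exists p; [exact: leqW|rewrite eip; exact: eq_lcp b'b].
- by move=> i iN; rewrite -b'b ?bu// (leq_trans iN).
Qed.

Lemma basis_map n (V W : lmodType R) (b : nat -> V) (c : nat -> W) :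
    independent n b -> spanning n b ->
  exists f : {linear V -> W},
    forall p : {poly R}, (size p <= n)%N -> f (lcp b p) = lcp c p.
Proof.
move=> bi bs; have /choice[k kP] : forall x, exists p : {poly R},
    (size p <= n)%N /\ x = lcp b p by move=> x; have [p ? ?] := bs x; exists p.
have klin : linear k.
  move=> a x y; have [[? xk] [? yk]] := (kP x, kP y); have [? h] := kP (a *: x + y).
  apply: (lcp_inj bi) => //; last by rewrite linearP/= -h -xk -yk.
  rewrite (leq_trans (size_polyD _ _))// geq_max andbC.
  by rewrite (leq_trans (size_scale_leq _ _))// andbT.
pose K : {linear V -> {poly R}} := HB.pack k (GRing.isLinear.Build R V _ _ k klin).
exists (lcp c \o K)%FUN => p pn /=; congr lcp.
by have [? h] := kP (lcp b p); apply/esym/(lcp_inj bi).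
Qed.

Lemma finite_dim_range N (V : lmodType R) (b : nat -> V) :
  spanning N b -> finite_dim V.
Proof.
move=> bs; exists N, (fun i => b i) => x; have [p pN ->] := bs x.
by exists (fun i => p`_i); rewrite (lcpE b pN).
Qed.

(** Equivalence of the norms in finite dimension: the norm of the combination attains
    its minimum on the compact unit sphere of the coefficients, and the minimum is
    positive by independence. *)
Lemma independent_bound N (V : normedModType R) (b : nat -> V) :
    independent N b -> exists2 K, 0 < K &
  forall p : {poly R}, (size p <= N)%N -> l1 p <= K * `|lcp b p|.
Proof.
case: N => [|N] bi.
  exists 1 => // p; rewrite leqn0 size_poly_eq0 => /eqP ->.
  by rewrite /l1 size_poly0 big_ord0 mulr_ge0.
pose P (v : 'rV[R]_N.+1) : {poly R} := \poly_(i < N.+1) v ord0 (inord i).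
pose f (v : 'rV[R]_N.+1) : R := `|lcp b (P v)|.
have PE v i : (P v)`_(nat_of_ord i) = v ord0 i.
  by rewrite coef_poly ltn_ord inord_val.
have PB v w : P v - P w = P (v - w).
  apply/polyP => i; rewrite coefB !coef_poly; case: ifP; rewrite ?subr0// => _.
  by rewrite !mxE.
have normE (v : 'rV[R]_N.+1) : `|v| = \big[Num.max/0]_ij `|v ij.1 ij.2|.
  exact: mx_normrE.
have l1P v : l1 (P v) <= N.+1%:R * `|v|.
  rewrite (@l1E _ N.+1) ?size_poly//.
  have -> : N.+1%:R * `|v| = \sum_(i < N.+1) `|v| by rewrite sumr_const card_ord mulr_natl.
  apply: ler_sum => i _; rewrite PE (normE v).
  exact: (@le_bigmax _ _ _ 0 (fun ij => `|v ij.1 ij.2|) (ord0, i)).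
have [M M0 bM] := finite_bound (fun i => `|b i|) N.+1.
have fcont : continuous f.
  move=> v; have Fv : Filter (nbhs v) by exact: nbhs_filter.
  apply/cvgrPdist_lt => e e0; pose d := e / 2 / (N.+1%:R * M).
  have NM0 : 0 < N.+1%:R * M by rewrite mulr_gt0.
  have d0 : 0 < d by rewrite !divr_gt0.
  apply: filterS (nbhsx_ballx v _ d0) => w vw.
  apply: (le_lt_trans (ler_dist_dist _ _)); rewrite -raddfB PB/=.
  apply: (le_lt_trans (norm_lcp_le (size_poly _ _) bM)).
  apply: (@le_lt_trans _ _ (N.+1%:R * d * M)).
    rewrite ler_wpM2r// ?(ltW M0)// (l1E (size_poly _ _)).
    have -> : N.+1%:R * d = \sum_(i < N.+1) d by rewrite sumr_const card_ord mulr_natl.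
    apply: ler_sum => i _; rewrite PE !mxE; apply/ltW.
    by have [_ /(_ ord0 i)] := vw.
  by rewrite mulrAC mulrC /d divfK ?gt_eqF// ltr_pdivrMr// ltr_pMr// ltr1n.
pose S : set 'rV[R]_N.+1 := [set v | `|v| = 1].
have S0 : S !=set0.
  exists (const_mx 1); rewrite /S/= normE; apply/le_anti/andP; split.
    by apply/bigmax_leP; split=> // i _; rewrite mxE normr1.
  apply: le_trans (@le_bigmax _ _ _ 0 (fun ij => `|_ ij.1 ij.2|) (ord0, ord0)).
  by rewrite mxE normr1.
have Scpt : compact S.
  apply: bounded_closed_compact.
    exists 1; split=> // z z1 v vS.
    have v1 : `|v| = 1 := vS; suff : `|v| <= z by [].
    by rewrite v1; exact: ltW.
  apply: (@closed_comp _ _ (fun v : 'rV[R]_N.+1 => `|v|) [set 1]).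
    by move=> v _; exact: norm_continuous.
  exact: closed_eq.
have [c Sc cmin] := EVT_min_rV S0 Scpt (continuous_subspaceT fcont).
have c1 : `|c| = 1 by rewrite inE in Sc.
have fc0 : 0 < f c.
  rewrite normr_gt0; apply/eqP => /(bi _ (size_poly _ _)) Pc0.
  suff c0 : c = 0 by move: c1; rewrite c0 normr0 => /esym/eqP; rewrite oner_eq0.
  by apply/rowP => i; rewrite -PE [P c]Pc0 coef0 mxE.
exists (N.+1%:R / f c) => [|p pN]; first by rewrite divr_gt0.
pose v : 'rV[R]_N.+1 := \row_i p`_i.
have Pv : P v = p.
  apply/polyP => i; rewrite coef_poly; case: ltnP => iN.
    by rewrite mxE inordK.
  by rewrite nth_default// (leq_trans pN).
have [v0|v0] := eqVneq v 0.
  rewrite -Pv v0 (_ : P 0 = 0) ?raddf0 ?normr0 ?mulr0 /l1 ?size_poly0 ?big_ord0//.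
  by apply/polyP => i; rewrite coef0 coef_poly mxE if_same.
have nv0 : 0 < `|v| by rewrite normr_gt0.
rewrite -[in leLHS]Pv (le_trans (l1P v))// mulrAC -mulrA ler_wpM2l//.
rewrite ler_pdivlMr//.
have := cmin (`|v|^-1 *: v); rewrite inE /S/= normrZ normfV normr_id mulVf ?gt_eqF//.
move=> /(_ erefl); rewrite /f (_ : P (_ *: v) = `|v|^-1 *: p); last first.
  by apply/polyP => i; rewrite coefZ -Pv !coef_poly !mxE; case: ifP; rewrite ?mulr0.
by rewrite linearZ/= normrZ normfV normr_id ler_pdivlMl.
Qed.

Lemma basis_exists (V : normedModType R) : finite_dim V ->
  exists n (b : nat -> V) K, [/\ independent n b, spanning n b, 0 < K &
    forall p : {poly R}, (size p <= n)%N -> l1 p <= K * `|lcp b p|].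
Proof.
move=> fV; have ind0 : independent 0 (fun=> 0 : V).
  by move=> p; rewrite leqn0 size_poly_eq0 => /eqP.
have [n [b [_ bi bs _]]] := basis_extension fV ind0.
by have [K K0 bK] := independent_bound bi; exists n, b, K.
Qed.

(** A matrix with more rows than columns has a nonzero vector in its left kernel. *)
Lemma independent_card n m (V : lmodType R) (b c : nat -> V) :
  spanning n b -> independent m c -> (m <= n)%N.
Proof.
move=> bs ci; rewrite leqNgt; apply/negP => nm.
have /choice[w wP] : forall i : nat, exists p : {poly R},
    (size p <= n)%N /\ c i = lcp b p.
  by move=> i; have [p ? ?] := bs (c i); exists p.
pose A : 'M[R]_(m, n) := \matrix_(i, j) (w i)`_j.
have : kermx A != 0.
  rewrite -mxrank_eq0 mxrank_ker subn_eq0 -ltnNge.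
  exact: leq_ltn_trans (rank_leq_col A) nm.
move=> /rowV0Pn[v /sub_kermxP vA /negP]; apply; apply/eqP.
pose p : {poly R} := \sum_(i < m) v ord0 i *: 'X^i.
have pE (i : 'I_m) : p`_i = v ord0 i.
  rewrite /p coef_sum (bigD1 i)//= coefZ coefXn eqxx mulr1 big1 ?addr0// => j ji.
  by rewrite coefZ coefXn (eq_sym (i : nat)) (negbTE (ji : (j != i :> nat))) mulr0.
suff p0 : p = 0 by apply/rowP => i; rewrite -pE p0 coef0 mxE.
apply: ci.
  rewrite (leq_trans (size_sum _ _ _))//; apply/bigmax_leqP => i _.
  by rewrite (leq_trans (size_scale_leq _ _))// size_polyXn ltn_ord.
rewrite linear_sum/= (_ : \sum_i _ = lcp b (\sum_(i < m) v ord0 i *: w i)).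
  rewrite (_ : \sum_(i < m) _ = 0) ?raddf0//; apply/polyP => j; rewrite coef0 coef_sum.
  case: (ltnP j n) => [jn|nj].
    have /rowP/(_ (Ordinal jn)) := vA; rewrite !mxE => vA0.
    rewrite -[RHS]vA0; apply: eq_bigr => i _; by rewrite mxE coefZ.
  apply: big1 => i _; rewrite coefZ nth_default ?mulr0//.
  by have [wn _] := wP i; exact: leq_trans nj.
rewrite linear_sum; apply: eq_bigr => i _; rewrite !linearZ/= lcpX.
by have [_ ->] := wP i.
Qed.

Lemma independent_infinite_dim (V : lmodType R) (h : nat -> V) :
  (forall N, independent N h) -> ~ finite_dim V.
Proof.
move=> hi fV; have [n [b [_ _ bs _]]] := basis_extension fV (hi 0%N).
by have := independent_card bs (hi n.+1); rewrite ltnn.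
Qed.

Lemma spanning_card n m (V : lmodType R) (b c : nat -> V) :
  spanning n b -> independent m c -> (n <= m)%N -> spanning m c.
Proof.
move=> bs ci nm x.
have [//|nx] := pselect (exists2 p : {poly R}, (size p <= m)%N & x = lcp c p).
pose c' i := if i == m then x else c i.
have c'c i : (i < m)%N -> c i = c' i by move=> /ltn_eqF; rewrite /c' => ->.
suff /(independent_card bs) : independent m.+1 c' by rewrite ltnNge nm.
apply: independentS; first exact: eq_independent c'c _.
rewrite /c' eqxx => -[p pm xp]; apply: nx; exists p => //.
by rewrite xp; apply/esym/(eq_lcp pm c'c).
Qed.

End FiniteDimension.

(** * Codes and the topology of types *)

Section RationalNet.
Context {R : realType}.

Lemma rat_c00_coef (v : {poly rat}) i : (rat_c00 v)`_i = ratr v`_i :> R.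
Proof. by rewrite coef_map. Qed.

Lemma size_rat_c00 (v : {poly rat}) : (size (rat_c00 v : {poly R}) <= size v)%N.
Proof. by rewrite /rat_c00 size_map_poly. Qed.

(** The coefficients are rounded down to a multiple of 1/(Q+1). *)
Lemma rational_net N (t : R) : 0 < t -> exists S : seq {poly rat},
  forall p : {poly R}, (size p <= N)%N -> l1 p <= 1 ->
  exists v, [/\ v \in S, (size v <= N)%N & l1 (p - rat_c00 v) <= t].
Proof.
move=> t0; have s0 : 0 < t / N.+1%:R by rewrite divr_gt0.
have [Q /(_ Q (leqnn _)) Qt] := seq_inv_lt s0; pose K := (Q.+1 * 2)%N.
have Q0 : 0 < Q.+1%:R :> R by [].
pose P (f : {ffun 'I_N.+1 -> 'I_K.+1}) : {poly rat} :=
  \poly_(i < N) ((f (inord i) : nat)%:R / Q.+1%:R - 1).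
exists [seq P f | f : {ffun 'I_N.+1 -> 'I_K.+1}] => p pN p1.
have c0 i : 0 <= (p`_i + 1) * Q.+1%:R.
  rewrite mulr_ge0//; have := le_trans (l1_coef p i) p1.
  by rewrite ler_norml => /andP[? _]; lra.
pose k i := Num.trunc ((p`_i + 1) * Q.+1%:R).
have kK i : (k i < K.+1)%N.
  have /andP[h _] := Num.Theory.truncn_itv (c0 i).
  rewrite ltnS -(ler_nat R); apply: (le_trans h); rewrite natrM mulrC ler_wpM2l//.
  by have := le_trans (l1_coef p i) p1; rewrite ler_norml => /andP[_ ?]; lra.
pose f : {ffun 'I_N.+1 -> 'I_K.+1} := [ffun i : 'I_N.+1 => Ordinal (kK i)].
exists (P f); split; first by apply: map_f; rewrite mem_enum.
  exact: size_poly.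
have sz : (size (p - rat_c00 (P f))%R <= N)%N.
  rewrite (leq_trans (size_polyD _ _))// size_polyN geq_max pN/=.
  exact: leq_trans (size_rat_c00 _) (size_poly _ _).
rewrite (l1E sz); apply: (@le_trans _ _ (\sum_(i < N) t / N.+1%:R)).
  apply: ler_sum => i _; rewrite coefB rat_c00_coef coef_poly ltn_ord ffunE/=.
  rewrite inordK ?(leq_trans (ltn_ord i))// rmorphB rmorph1 fmorph_div !rmorph_nat.
  have /andP[h1 h2] := Num.Theory.truncn_itv (c0 i); rewrite -/(k i) in h1 h2.
  have -> : p`_i - ((k i)%:R / Q.+1%:R - 1) =
      ((p`_i + 1) * Q.+1%:R - (k i)%:R) / Q.+1%:R.
    by rewrite mulrBl mulfK ?gt_eqF//; ring.
  rewrite normrM normfV (gtr0_norm Q0) ltW// (le_lt_trans _ Qt)//.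
  rewrite ler_piMl ?invr_ge0// ger0_norm ?subr_ge0//.
  by move: h2; rewrite -natr1; lra.
by rewrite sumr_const card_ord -[_ *+ N]mulr_natr mulrAC ler_pdivrMr// ler_pM2l// ler_nat.
Qed.

End RationalNet.

Section CodedSpaces.
Context {R : realType}.
Local Notation V := {poly rat}.
Implicit Types mu nu : V -> R.

(** The unit vectors of c_00, here the monomials, as elements of the coded space. *)
Definition gen mu (i : nat) : X_ mu :=
  to_completion (to_quot (pseudonorm_ext mu) 'X^i).

Fact to_quot_is_linear (W : lmodType R) (nu : seminorm W) : linear (to_quot nu).
Proof. by move=> a x y; rewrite to_quotD to_quotZ. Qed.

HB.instance Definition _ (W : lmodType R) (nu : seminorm W) :=
  GRing.isLinear.Build R W (seminorm_quot nu) _ (to_quot nu) (to_quot_is_linear nu).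

Lemma polyXn_lcp (p : {poly R}) : lcp (fun i => 'X^i) p = p.
Proof. by rewrite /lcp -poly_def coefK. Qed.

Lemma lcp_gen mu p : lcp (gen mu) p = to_completion (to_quot (pseudonorm_ext mu) p).
Proof.
rewrite -[in RHS](polyXn_lcp p) !lcp_map.
by [].
Qed.

Lemma norm_lcp_gen mu p : `|lcp (gen mu) p| = pseudonorm_ext mu p.
Proof. by rewrite lcp_gen to_completion_norm to_quot_norm. Qed.

Lemma norm_lcp_gen_rat mu v : pseudonorms R mu -> `|lcp (gen mu) (rat_c00 v)| = mu v.
Proof. by move=> /pseudonorm_extP h; rewrite norm_lcp_gen h. Qed.

Lemma gen_dense mu : dense_span (gen mu).
Proof.
move=> w e e0.
have [u [wu [q _ qu]]] : ball w e `&` range (@to_completion R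
    (seminorm_quot (pseudonorm_ext mu))) !=set0.
  apply: to_completion_dense; first by exists w; exact: ballxx.
  exact: ball_open.
have [p qp] := to_quot_surj q; exists p.
by move: wu; rewrite lcp_gen -qp qu -ball_normE.
Qed.

(** The codes of a space are the codes of its sequences with dense span, which is what
    reduces statements about codes to statements about sequences. *)
Definition code (X : normedModType R) (h : nat -> X) : {ptws V -> R} :=
  fun v => `|lcp h (rat_c00 v)|.

Lemma code_pseudonorm (X : normedModType R) (h : nat -> X) : pseudonorms R (code h).
Proof.
split=> [v w|q v]; rewrite /code /rat_c00 ?rmorphD ?raddfD ?ler_normD//.
by rewrite map_polyZ linearZ normrZ.
Qed.

Lemma code_near (X : normedModType R) (h : nat -> X) p :
  `|lcp (gen (code h)) p| = `|lcp h p|.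
Proof.
have nD q q' : `|lcp h (q + q')| <= `|lcp h q| + `|lcp h q'|.
  by rewrite raddfD ler_normD.
have nZ a q : `|lcp h (a *: q)| = `|a| * `|lcp h q| by rewrite linearZ normrZ.
rewrite norm_lcp_gen; apply: (extends_unique (mu := code h) (nu' := Seminorm nD nZ)).
  exact/pseudonorm_extP/code_pseudonorm.
by [].
Qed.

Lemma isometric_code (X : completeNormedModType R) (h : nat -> X) :
  dense_span h -> isometric (X_ (code h)) X.
Proof.
move=> hd; apply: isometric_dense_span (@gen_dense (code h)) hd _.
- exact: complete_seq_complete.
- exact: complete_seq_complete.
- exact: code_near.
Qed.

Lemma isometric_codeP (X : completeNormedModType R) mu : pseudonorms R mu ->
  isometric (X_ mu) X -> exists2 h : nat -> X, dense_span h & mu = code h.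
Proof.
move=> muP [T [iT rT]]; exists (fun i => T (gen mu i)).
  exact: dense_span_surj rT (@gen_dense mu).
by apply/funext => v; rewrite /code -lcp_map iT norm_lcp_gen_rat.
Qed.

Lemma ptws_cvg (F : set_system {ptws V -> R}) mu : Filter F ->
    (forall v e, 0 < e -> F [set nu | `|mu v - nu v| < e]) ->
  F --> (mu : {ptws V -> R}).
Proof.
move=> FF h; apply/cvg_sup => v A [_ [[B Bop <-] Bmu BA]].
have /nbhs_ballP[e /= e0 eB] : nbhs (mu v) B by exact: open_nbhs_nbhs.
by apply: filterS (h v e e0) => nu nue; apply/BA/eB; rewrite -ball_normE.
Qed.

(** Pointwise convergence of pseudonorms amounts to convergence of the types of all
    finite initial segments of the unit vectors. In this direction, the value of a
    pseudonorm at a vector is read off from a segment that contains its support. *)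
Lemma nbhs_near mu (U : set {ptws V -> R}) : pseudonorms R mu ->
    nbhs (mu : {ptws V -> R}) U ->
  exists N r, 0 < r /\ forall nu, pseudonorms R nu ->
    near_type N r (gen nu) (gen mu) -> U nu.
Proof.
move=> muP muU.
pose F : set_system {ptws V -> R} := [set P | exists N r, 0 < r /\
  forall nu, pseudonorms R nu -> near_type N r (gen nu) (gen mu) -> P nu].
have FF : Filter F.
  split; first by exists 0%N, 1.
    move=> P Q [N [r [r0 NP]]] [M [s [s0 MQ]]]; exists (maxn N M), (Num.min r s).
    split; first by rewrite lt_min r0.
    move=> nu nuP h; split; [apply: NP => //|apply: MQ => //]; apply: near_le h.
    - exact: leq_maxl.
    - by rewrite ge_min lexx.
    - exact: leq_maxr.
    - by rewrite ge_min lexx orbT.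
  by move=> P Q PQ [N [r [r0 NP]]]; exists N, r; split=> // nu nuP /NP; auto.
suff /(_ U muU) : F --> (mu : {ptws V -> R}) by [].
apply: ptws_cvg => v e e0.
have l0 : 0 < l1 (rat_c00 v : {poly R}) + 1 by rewrite ltr_wpDl// l1_ge0.
exists (size v), (e / (l1 (rat_c00 v : {poly R}) + 1)); split; first by rewrite divr_gt0.
move=> nu nuP /(_ _ (size_rat_c00 v)); rewrite !norm_lcp_gen_rat// distrC.
move=> /le_lt_trans; apply; rewrite mulrAC ltr_pdivrMr// ltr_pM2l//.
by rewrite ltrDl.
Qed.

(** Finitely many values of nu control its type up to r: those at the unit vectors
    bound the norms, and then those at a finite net of rational combinations are
    enough. *)
Lemma near_filter (F : set_system (V -> R)) mu N (r : R) : Filter F ->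
    (forall v e, 0 < e -> F [set nu | `|nu v - mu v| < e]) ->
    pseudonorms R mu -> 0 < r ->
  F [set nu | pseudonorms R nu -> near_type N r (gen nu) (gen mu)].
Proof.
move=> FF F_pt muP r0.
have F_seq (S : seq V) s : 0 < s ->
    F [set nu | forall v, v \in S -> `|nu v - mu v| < s].
  move=> s0; elim: S => [|v S IH].
    rewrite (_ : [set _ | _] = setT); first exact: filterT.
    by apply/seteqP; split.
  apply: filterS (filterI (F_pt v s s0) IH) => nu [h1 h2] w.
  by rewrite inE => /predU1P[->//|]; exact: h2.
have [M M0 bM] := finite_bound (fun i => `|gen mu i|) N.
have t0 : 0 < r / (2 * (M * 2 + 1)) by rewrite divr_gt0//; lra.
have [S SP] := rational_net N t0.
pose E := [seq ('X^i : V) | i <- iota 0 N].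
have r20 : 0 < r / 2 by rewrite divr_gt0.
apply: filterS (filterI (F_seq S _ r20) (F_seq E _ ltr01)) => nu [nS nE] nuP.
have bN i : (i < N)%N -> `|gen nu i| <= M + 1.
  move=> iN; have : ('X^i : V) \in E by apply: map_f; rewrite mem_iota.
  move=> /nE; rewrite -!norm_lcp_gen_rat// /rat_c00 map_polyXn !lcpX.
  by have := bM _ iN; rewrite ltr_norml => ? /andP[_ ?]; lra.
suff H (p : {poly R}) : (size p <= N)%N -> l1 p <= 1 ->
    `| `|lcp (gen nu) p| - `|lcp (gen mu) p| | <= r.
  move=> p pN; have [p0|p0] := eqVneq (l1 p) 0.
    have -> : p = 0.
      by apply/polyP => i; have := l1_coef p i; rewrite p0 normr_le0 coef0 => /eqP.
    by rewrite !raddf0 !normr0 subrr normr0 mulr_ge0 ?l1_ge0// ltW.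
  have lp0 : 0 < l1 p by rewrite lt0r p0 l1_ge0.
  have := H ((l1 p)^-1 *: p); rewrite l1Z normfV (gtr0_norm lp0) mulVf// => Hp.
  have := Hp (leq_trans (size_scale_leq _ _) pN) (lexx _).
  have i0 : 0 < (l1 p)^-1 by rewrite invr_gt0.
  have nZ (Y : normedModType R) (y : nat -> Y) :
      `|lcp y ((l1 p)^-1 *: p)| = (l1 p)^-1 * `|lcp y p|.
    by rewrite linearZ/= normrZ (gtr0_norm i0).
  rewrite !nZ -mulrBr [X in X <= _](@normrM R) (gtr0_norm i0).
  by rewrite ler_pdivrMl// mulrC.
move=> pN p1; have [v [vS vN pv]] := SP p pN p1.
have szpv : (size (p - rat_c00 v)%R <= N)%N.
  rewrite (leq_trans (size_polyD _ _))// size_polyN geq_max pN/=.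
  exact: leq_trans (size_rat_c00 _) vN.
have d (Y : normedModType R) (y : nat -> Y) K : 0 <= K -> (forall i, (i < N)%N -> `|y i| <= K) ->
    `| `|lcp y p| - `|lcp y (rat_c00 v)| | <= r / (2 * (M * 2 + 1)) * K.
  move=> K0 yK; apply: (le_trans (ler_dist_dist _ _)); rewrite -raddfB.
  by rewrite (le_trans (norm_lcp_le szpv yK))// ler_wpM2r.
have d1 := d _ _ _ (addr_ge0 (ltW M0) ler01) bN; have d2 := d _ _ _ (ltW M0) bM.
have := nS _ vS; rewrite -!norm_lcp_gen_rat// => d3.
have tE : r / (2 * (M * 2 + 1)) * (M + 1) + r / (2 * (M * 2 + 1)) * M = r / 2.
  rewrite -mulrDr (_ : M + 1 + M = M * 2 + 1); last by ring.
  by rewrite invfM mulrA divfK// gt_eqF// ltr_wpDl// mulr_ge0// ltW.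
move: d1 d2 d3 tE; move: (r / (2 * (M * 2 + 1)) * (M + 1)) => A.
move: (r / (2 * (M * 2 + 1)) * M) => B.
move: `|lcp (gen nu) p| `|lcp (gen nu) (rat_c00 v)| => a a'.
move: `|lcp (gen mu) p| `|lcp (gen mu) (rat_c00 v)| => b b'.
rewrite !(@ler_norml R) !(@ltr_norml R) => /andP[? ?] /andP[? ?] /andP[? ?] ?.
by apply/andP; split; lra.
Qed.

Lemma near_nbhs mu N (r : R) : pseudonorms R mu -> 0 < r ->
  nbhs (mu : {ptws V -> R}) [set nu | pseudonorms R nu ->
    near_type N r (gen nu) (gen mu)].
Proof.
move=> muP r0; have FF : Filter (nbhs (mu : {ptws V -> R})) by exact: nbhs_filter.
suff h v s : 0 < s -> nbhs (mu : {ptws V -> R}) [set nu | `|nu v - mu v| < s].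
  exact: (near_filter N FF h muP r0).
move=> s0; have h : nbhs (mu v) [set r : R | `|r - mu v| < s].
  apply: filterS (nbhsx_ballx (mu v) s s0) => x.
  by rewrite -ball_normE /= distrC.
exact: (@proj_continuous V (fun=> R) v mu _ h).
Qed.

End CodedSpaces.

(** * Guards *)

Lemma indexed_choice (T : Type) (P : nat -> T -> Prop) (Q : nat -> T -> T -> Prop) :
    (exists t, P 0%N t) ->
    (forall n t, P n t -> exists t', P n.+1 t' /\ Q n t t') ->
  exists s : nat -> T, forall n, P n (s n) /\ Q n (s n) (s n.+1).
Proof.
move=> /cid[t0 Pt0] PQ.
have next n (t : {t | P n t}) : {t' : {t' | P n.+1 t'} | Q n (projT1 t) (projT1 t')}.
  by case: t => t Pt; have /cid[t' [Pt' Qt']] := PQ n t Pt; exists (exist _ t' Pt').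
pose s := fix s n : {t | P n t} :=
  if n is m.+1 then projT1 (next m (s m)) else exist _ t0 Pt0.
exists (fun n => projT1 (s n)) => n; split; first by case: (s n).
by rewrite /=; case: (next n (s n)).
Qed.

(** The 2-adic valuation of n + 1 returns to every value; this lets the constructions
    below treat every term of a sequence with arbitrarily small errors. *)
Lemma infinitely_often : exists s : nat -> nat, forall j m, exists2 n, (m <= n)%N & s n = j.
Proof.
exists (fun n => logn 2 n.+1) => j m; exists (2 ^ j * (2 * m).+1).-1.
  by have := expn_gt0 2 j; nia.
rewrite prednK ?muln_gt0 ?expn_gt0// lognM ?expn_gt0// pfactorK//.
by rewrite lognE/= dvdn2 /= oddM/= addn0.
Qed.

Lemma half_power_lt (R : realType) (e : R) : 0 < e ->
  exists N, forall n, (N <= n)%N -> 2^-1 ^+ n < e.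
Proof.
move=> e0; have [N NP] := seq_inv_lt e0; exists N => n /NP; apply: le_lt_trans.
rewrite exprVn lef_pV2 ?posrE ?exprn_gt0// -natrX ler_nat.
exact: ltn_expl.
Qed.

Lemma geometric_limit (R : realType) (Z : normedModType R) (u : nat -> Z) m0 :
    seq_complete Z ->
    (forall m, (m0 <= m)%N -> `|u m.+1 - u m| <= 2^-1 ^+ m) ->
  exists l, forall m, (m0 <= m)%N -> `|u m - l| <= 2 * 2^-1 ^+ m.
Proof.
move=> Zc um.
have ud m d : (m0 <= m)%N -> `|u (m + d)%N - u m| <= 2 * 2^-1 ^+ m - 2 * 2^-1 ^+ (m + d).
  move=> m0m; elim: d => [|d IH]; first by rewrite addn0 !subrr normr0.
  rewrite -(subrK (u (m + d)%N) (u _)) -addrA (le_trans (ler_normD _ _))//.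
  have := um (m + d)%N (leq_trans m0m (leq_addr _ _)); rewrite -addnS => h.
  apply: (le_trans (lerD h IH)); rewrite addnS exprS; lra.
have p0 m : 0 < 2^-1 ^+ m :> R by rewrite exprn_gt0.
have ud' m n : (m0 <= m)%N -> (m <= n)%N -> `|u n - u m| <= 2 * 2^-1 ^+ m.
  move=> h mn; have := ud m (n - m)%N h; rewrite subnKC// => /le_trans; apply.
  by have := p0 n; lra.
have [l ul] : exists l, forall e, 0 < e ->
    exists N, forall n, (N <= n)%N -> `|u n - l| < e.
  apply: Zc => e e0; have [N NP] := half_power_lt (divr_gt0 e0 (ltr0n R 4)).
  exists (maxn N m0) => m n; rewrite !geq_max => /andP[Nm mm] /andP[Nn nm].
  have h : `|u m - u (maxn N m0)| <= 2 * 2^-1 ^+ (maxn N m0).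
    by apply: ud'; rewrite ?leq_maxr// geq_max Nm.
  have h' : `|u n - u (maxn N m0)| <= 2 * 2^-1 ^+ (maxn N m0).
    by apply: ud'; rewrite ?leq_maxr// geq_max Nn.
  rewrite -(subrK (u (maxn N m0)) (u m)) -addrA (le_lt_trans (ler_normD _ _))//.
  rewrite [X in _ + X]distrC; have := NP _ (leq_maxl N m0); lra.
exists l => m h; apply/ler_addgt0Pr => e e0; have [N NP] := ul e e0.
rewrite -(subrK (u (maxn m N)) (u m)) -addrA (le_trans (ler_normD _ _))//.
by rewrite lerD ?(ltW (NP _ (leq_maxr _ _)))// distrC ud'// leq_maxl.
Qed.

Lemma dense_span_approx (R : realType) (Z : normedModType R) (z z' : nat -> Z) :
    dense_span z -> (forall j e, 0 < e -> exists p, `|z j - lcp z' p| < e) ->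
  dense_span z'.
Proof.
move=> zd zz' w e e0; have e20 := divr_gt0 e0 (ltr0n R 2).
have [p wp] := zd w _ e20.
have l0 : 0 < l1 p + 1 by rewrite ltr_wpDl// l1_ge0.
have /choice[q qP] : forall j, exists q, `|z j - lcp z' q| < e / 2 / (l1 p + 1).
  by move=> j; apply: zz'; rewrite divr_gt0.
exists (lcp q p); rewrite (lcp_map (lcp z')) -(subrK (lcp z p) w) -addrA.
rewrite (le_lt_trans (ler_normD _ _))// (splitr e) ltrD//.
rewrite lcpB.
apply: (@le_lt_trans _ _ (l1 p * (e / 2 / (l1 p + 1)))).
  by apply: norm_lcp_le (leqnn _) _ => i _; exact: ltW.
by rewrite mulrA ltr_pdivrMr// mulrC ltr_pM2l// ltrDl.
Qed.

Section Guards.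
Context {R : realType}.
Implicit Types X Y : normedModType R.

Lemma near_pair N r X Y (a : nat -> X) (b : nat -> Y) (p q : {poly R}) K :
    near_type N r a b -> 0 <= r -> (size p <= N)%N -> (size q <= N)%N ->
    l1 p + l1 q <= K ->
  `|lcp a p - lcp a q| <= `|lcp b p - lcp b q| + r * K.
Proof.
move=> ab r0 pN qN pqK; rewrite -!raddfB; apply: near_norm ab _ _.
  by rewrite (leq_trans (size_polyD _ _))// size_polyN geq_max pN.
rewrite ler_wpM2l//; apply: le_trans pqK; apply: (le_trans (l1D _ _)).
by rewrite -(scaleN1r q) l1Z normrN1 mul1r.
Qed.

Definition seq_cat (T : Type) N (a b : nat -> T) i := if (i < N)%N then a i else b (i - N)%N.

Lemma seq_catl (T : Type) N (a b : nat -> T) i : (i < N)%N -> seq_cat N a b i = a i.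
Proof. by rewrite /seq_cat => ->. Qed.

Lemma seq_catr (T : Type) N (a b : nat -> T) i : seq_cat N a b (N + i)%N = b i.
Proof. by rewrite /seq_cat ltnNge leq_addr/= addKn. Qed.

(** Weak amalgamation in terms of sequences: the tuples of X that continue an almost
    copy of the first N terms of b are copied in Y, but only the first k terms
    are required to stay in place, up to e. *)
Definition guard X Y (b : nat -> Y) k N (r e : R) : Prop :=
  forall M (c : nat -> X), (N <= M)%N -> near_type N r c b -> forall eta, 0 < eta ->
    exists d : nat -> Y, near_type M eta d c /\ forall i, (i < k)%N -> `|d i - b i| < e.

Definition guarded X Y : Prop := forall (b : nat -> Y) k e, 0 < e ->
  exists b' N r, [/\ (k <= N)%N, 0 < r, forall i, (i < k)%N -> b' i = b i &
    guard X b' k N r e].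

Lemma guard_le X Y (b : nat -> Y) k N r r' e : r' <= r ->
  guard X b k N r e -> guard X b k N r' e.
Proof. by move=> rr' g M c NM cb; apply: g => //; exact: near_le cb. Qed.

Lemma lcp_reindex (V : lmodType R) (c : nat -> V) (f : nat -> nat) (p : {poly R}) :
  lcp c (lcp (fun j => 'X^(f j)) p) = lcp (fun j => c (f j)) p.
Proof.
by rewrite (lcp_map (lcp c)); apply: eq_lcp (leqnn _) _ => i _ /=; rewrite lcpX.
Qed.

(** A small perturbation of a guard is a guard, so that its terms may be replaced by
    combinations of terms of y, and then by the terms of y themselves. *)
Lemma guarded_dense X Y (y : nat -> Y) k e : guarded X Y -> dense_span y -> 0 < e ->
  exists N r, [/\ (k <= N)%N, 0 < r & guard X y k N r e].
Proof.
move=> gXY yd e0.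
have [b [N' [r' [kN' r'0 by_ gb]]]] := gXY y k (e / 2) (divr_gt0 e0 (ltr0n R 2)).
have /choice[w wP] : forall i, exists p : {poly R}, `|b i - lcp y p| <= r' / 2 /\
    ((i < k)%N -> p = 'X^i).
  move=> i; case: ltnP => [ik|_].
    by exists 'X^i; rewrite lcpX by_// subrr normr0 ltW// divr_gt0.
  have [p bp] := yd (b i) (r' / 2) (divr_gt0 r'0 (ltr0n R 2)).
  by exists p; split=> //; exact: ltW.
have [K K0 wK] := finite_bound (fun i => l1 (w i)) N'.
have [S wS] := finite_bound_nat (fun i => size (w i)) N'.
exists (maxn k S), (r' / (2 * K)); split; first exact: leq_maxl.
  by rewrite divr_gt0// mulr_gt0.
move=> M c NM cy eta eta0.
pose C := seq_cat N' (fun i => lcp c (w i)) c.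
have Cb : near_type N' r' C b.
  have h1 : near_type N' 0 C (fun i => lcp c (w i)) by apply: near_eq => i; exact: seq_catl.
  have h2 : near_type N' (r' / 2) (fun i => lcp c (w i)) (fun i => lcp y (w i)).
    have -> : r' / 2 = r' / (2 * K) * K by field; rewrite gt_eqF.
    apply: near_lcp cy _ => [|i iN']; first by rewrite divr_ge0 ?mulr_ge0// ltW.
    by rewrite wK// (leq_trans (wS i iN'))// leq_maxr.
  have h3 : near_type N' (r' / 2) (fun i => lcp y (w i)) b.
    by apply: near_dist => i _; rewrite distrC; have [] := wP i.
  by have := near_trans h1 (near_trans h2 h3); rewrite add0r -splitr.
pose eta' := Num.min eta (e / 4).
have eta'0 : 0 < eta' by rewrite lt_min eta0 divr_gt0.
have [D [DC Db]] := gb (N' + M)%N C (leq_addr _ _) Cb eta' eta'0.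
exists (fun i => D (N' + i)%N); split=> [|i ik].
  have := @near_reindex _ (N' + M)%N M _ (fun i => N' + i)%N _ _ D C (ltW eta'0) DC.
  rewrite (_ : (fun i => C _) = c); last by apply/funext => i; rewrite /C seq_catr.
  move=> h; apply: (near_le (leqnn _) _ (h _)); first by rewrite ge_min lexx.
  by move=> i; rewrite ltn_add2l.
have iN' := leq_trans ik kN'.
have iM : (N' + i < N' + M)%N.
  by rewrite ltn_add2l (leq_trans ik)// (leq_trans _ NM)// leq_maxl.
have h : l1 ('X^(N' + i) : {poly R}) + l1 'X^i <= 2 by rewrite !l1X; lra.
have := near_pair DC (ltW eta'0) _ _ h; rewrite !size_polyXn !lcpX /C seq_catr.
rewrite seq_catl// (wP i).2// lcpX subrr normr0 add0r => /(_ iM) h1.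
have {}h1 := h1 (leq_trans iN' (leq_addr _ _)).
have h2 := Db i ik; rewrite by_// in h2.
rewrite -(subrK (D i) (D _)) -addrA (le_lt_trans (ler_normD _ _))//.
have : eta' <= e / 4 by rewrite ge_min lexx orbT.
by lra.
Qed.

(** Conversely it suffices to guard the initial segments of one sequence with
    dense span, since other tuples are almost combinations of its terms. *)
Lemma dense_guarded X Y (y : nat -> Y) : dense_span y ->
    (forall k e, 0 < e -> exists N r, [/\ (k <= N)%N, 0 < r & guard X y k N r e]) ->
  guarded X Y.
Proof.
move=> yd yg b k e e0; have e80 := divr_gt0 e0 (ltr0n R 8).
have /choice[w wb] : forall i, exists p : {poly R}, `|b i - lcp y p| < e / 8.
  by move=> i; exact: yd.
have [L L0 wL] := finite_bound (fun i => l1 (w i)) k.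
have [K wK] := finite_bound_nat (fun i => size (w i)) k.
have L10 : 0 < 1 + L by rewrite ltr_wpDl// ltW.
pose t := e / 8 / (1 + L); have t0 : 0 < t by rewrite divr_gt0.
have tE : t * (1 + L) = e / 8 by rewrite /t divfK// gt_eqF.
have [N [r [KN r0 gy]]] := yg K t t0.
pose b' := seq_cat k b y; pose r' := Num.min r t.
have r'0 : 0 < r' by rewrite lt_min r0.
exists b', (k + N)%N, r'; split=> //; first exact: leq_addr.
  by move=> i; exact: seq_catl.
move=> M c NM cb eta eta0.
pose c' := seq_cat N (fun i => c (k + i)%N) c.
have c'y : near_type N r c' y.
  have h1 : near_type N 0 c' (fun i => c (k + i)%N) by apply: near_eq => i; exact: seq_catl.
  have := @near_reindex _ (k + N)%N N _ (fun i => k + i)%N _ _ c b' (ltW r'0) cb.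
  rewrite (_ : (fun i => b' _) = y); last by apply/funext => i; rewrite /b' seq_catr.
  move=> h2; have := near_trans h1 (h2 _); rewrite add0r => h3.
  apply: (near_le (leqnn _) _ (h3 _)); first by rewrite ge_min lexx.
  by move=> i; rewrite ltn_add2l.
pose eta' := Num.min eta t; have eta'0 : 0 < eta' by rewrite lt_min eta0.
have [D [Dc Dy]] := gy (N + M)%N c' (leq_addr _ _) c'y eta' eta'0.
exists (fun i => D (N + i)%N); split=> [|i ik].
  have := @near_reindex _ (N + M)%N M _ (fun i => N + i)%N _ _ D c' (ltW eta'0) Dc.
  rewrite (_ : (fun i => c' _) = c); last by apply/funext => i; rewrite /c' seq_catr.
  move=> h; apply: (near_le (leqnn _) _ (h _)); first by rewrite ge_min lexx.
  by move=> i; rewrite ltn_add2l.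
have wiL := wL i ik; have wiK := wK i ik.
have d1 : `|D (N + i)%N - lcp D (w i)| <= `|c i - lcp (fun j => c (k + j)%N) (w i)| + eta' * (1 + L).
  have h : l1 ('X^(N + i) : {poly R}) + l1 (w i) <= 1 + L by rewrite l1X lerD2l.
  have := near_pair Dc (ltW eta'0) _ _ h; rewrite !size_polyXn !lcpX /c' seq_catr.
  rewrite (eq_lcp (leq_trans wiK KN) (@seq_catl _ N (fun j => c (k + j)%N) c)).
  apply; last by rewrite (leq_trans wiK)// (leq_trans KN)// leq_addr.
  by rewrite ltn_add2l (leq_trans ik)// (leq_trans _ NM)// leq_addr.
have d2 : `|c i - lcp (fun j => c (k + j)%N) (w i)| <= `|b i - lcp y (w i)| + r' * (1 + L).
  pose w' : {poly R} := lcp (fun j => 'X^(k + j)) (w i).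
  have h : l1 ('X^i : {poly R}) + l1 w' <= 1 + L.
    rewrite l1X lerD2l; apply: le_trans wiL; rewrite -[leRHS]mulr1.
    by apply: (l1_lcp_le (leqnn _)) => j _; rewrite l1X.
  have := near_pair cb (ltW r'0) _ _ h; rewrite !size_polyXn /w' !lcp_reindex !lcpX.
  rewrite {1}/b' seq_catl// (_ : (fun j => b' _) = y); last first.
    by apply/funext => j; rewrite /b' seq_catr.
  apply; first by rewrite (leq_trans ik)// leq_addr.
  apply: (size_lcp (leqnn _)) => j jw; rewrite size_polyXn ltn_add2l.
  by rewrite (leq_trans jw)// (leq_trans wiK).
have d3 : `|lcp D (w i) - lcp y (w i)| <= L * t.
  rewrite lcpB.
  apply: (le_trans (norm_lcp_le wiK _)) => [j jK|]; first exact/ltW/Dy.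
  by rewrite ler_wpM2r// ltW.
have d4 := wb i.
have e1 : eta' * (1 + L) <= e / 8 by rewrite -tE ler_wpM2r ?(ltW L10)// ge_min lexx orbT.
have e2 : r' * (1 + L) <= e / 8 by rewrite -tE ler_wpM2r ?(ltW L10)// ge_min lexx orbT.
have e3 : L * t <= e / 8 by rewrite -tE mulrC ler_wpM2l ?(ltW t0)// lerDr.
rewrite /b' seq_catl//.
rewrite /= (_ : D (N + i)%N - b i = (D (N + i)%N - lcp D (w i)) + (lcp D (w i) - lcp y (w i)) +
    (lcp y (w i) - b i)); last first.
  by rewrite (addrA (_ - _) (lcp D (w i))) subrK addrA subrK.
rewrite distrC in d4.
apply: (le_lt_trans (ler_normD _ _)); have := ler_normD (D (N + i)%N - lcp D (w i)) (lcp D (w i) - lcp y (w i)).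
rewrite (distrC (b i)) in d2; lra.
Qed.

End Guards.

(** * The back-and-forth construction *)

Section BackAndForth.
Context {R : realType} (X Y : normedModType R).

(** A stage of the construction: almost the same type for the first pi_size terms of
    the two sequences, of which only the first pi_fixed are kept by the later stages,
    up to small errors. *)
Record partial_isometry := PartialIsometry {
  pi_dom : nat -> X ; pi_img : nat -> Y ; pi_fixed : nat ; pi_size : nat ; pi_err : R }.

Local Notation eps n := (2^-1 ^+ n : R).

Definition pi_valid n (s : partial_isometry) : Prop :=
  [/\ (n <= pi_fixed s <= pi_size s)%N, 0 < pi_err s <= eps n,
    guard Y (pi_dom s) (pi_fixed s) (pi_size s) (pi_err s) (eps n) &
    near_type (pi_size s) (pi_err s) (pi_img s) (pi_dom s)].

Definition pi_step (x0 : X) (y0 : Y) n (s s' : partial_isometry) : Prop :=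
  [/\ (pi_fixed s <= pi_fixed s')%N,
      forall i, (i < pi_fixed s)%N -> `|pi_dom s' i - pi_dom s i| <= eps n,
      forall i, (i < pi_fixed s)%N -> `|pi_img s' i - pi_img s i| <= eps n,
      exists2 i, (i < pi_fixed s')%N & `|pi_dom s' i - x0| <= eps n &
      exists2 i, (i < pi_fixed s')%N & `|pi_img s' i - y0| <= eps n].

Let eps_gt0 n : 0 < eps n. Proof. by rewrite exprn_gt0. Qed.

(** One round: y0 is added on the right and the result is guarded there, so that
    the guard on the left provides an almost copy on the left; then x0 is added
    and the result guarded on the left, and the guard on the right provides an
    almost copy on the right. *)
Lemma back_and_forth_step x0 y0 n s : guarded Y X -> guarded X Y -> pi_valid n s ->
  exists s', pi_valid n.+1 s' /\ pi_step x0 y0 n s s'.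
Proof.
case: s => x y k N r gYX gXY [/=] /andP[nk kN] /andP[r0 rn] gx yx.
have [y2 [N2 [r2 [NN2 r20 y2E gy]]]] := gXY (seq_cat N y (fun=> y0)) N.+1 _ (eps_gt0 n).
have y2y i : (i < N)%N -> y2 i = y i.
  by move=> iN; rewrite y2E ?seq_catl// ltnW.
have y2N : y2 N = y0 by rewrite y2E// /seq_cat ltnn.
have y2x : near_type N r y2 x.
  by have := near_trans (near_eq y2y) yx; rewrite add0r.
have [d [dy2 dx]] := gx N2 y2 (ltnW NN2) y2x r2 r20.
have [x' [N' [r' [NN' r'0 x'E gx']]]] :=
  gYX (seq_cat N2 d (fun=> x0)) N2.+1 _ (eps_gt0 n.+1).
have x'd i : (i < N2)%N -> x' i = d i.
  by move=> iN; rewrite x'E ?seq_catl// ltnW.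
have x'N : x' N2 = x0 by rewrite x'E// /seq_cat ltnn.
have x'y2 : near_type N2 r2 x' y2.
  by have := near_trans (near_eq x'd) dy2; rewrite add0r.
pose r'' := Num.min r' (eps n.+1).
have r''0 : 0 < r'' by rewrite lt_min r'0 eps_gt0.
have [y' [y'x' y'y2]] := gy N' x' (ltnW NN') x'y2 r'' r''0.
exists (PartialIsometry x' y' N2.+1 N' r''); split; split => //=.
- by rewrite NN' andbT ltnS (leq_trans nk)// (leq_trans kN)// ltnW.
- by rewrite r''0 ge_min lexx orbT.
- by apply: guard_le gx'; rewrite ge_min lexx.
- by rewrite (leq_trans kN)// ltnW// ltnW.
- move=> i ik; have iN := leq_trans ik kN; rewrite x'd ?(ltW (dx _ ik))//.
  by rewrite (leq_trans iN)// ltnW.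
- move=> i ik; have iN := leq_trans ik kN; rewrite -(y2y i iN).
  by rewrite ltW// y'y2// ltnW.
- by exists N2 => //; rewrite x'N subrr normr0 ltW.
- by exists N; rewrite ?leqW// -y2N ltW// y'y2.
Qed.

(** The two sequences of a stage converge, each term moving by at most 2^-n from stage n
    on; the limits have the same norms and, as all terms of x0 and y0 are treated,
    dense spans. *)
Theorem back_and_forth (x0 : nat -> X) (y0 : nat -> Y) :
    seq_complete X -> seq_complete Y -> dense_span x0 -> dense_span y0 ->
    guarded Y X -> guarded X Y ->
    (forall (a : nat -> X) N eta, 0 < eta -> exists b : nat -> Y, near_type N eta b a) ->
  isometric X Y.
Proof.
move=> Xc Yc x0d y0d gYX gXY age; have [sg sgP] := infinitely_often.
have [s sP] : exists s, forall n, pi_valid n (s n) /\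
    pi_step (x0 (sg n)) (y0 (sg n)) n (s n) (s n.+1).
  apply: (@indexed_choice _ pi_valid (fun n => pi_step (x0 (sg n)) (y0 (sg n)) n)) =>
    [|n t]; last exact: back_and_forth_step.
  have [x [N [r [_ r0 _ gx]]]] := gYX (fun=> 0) 0%N 1 ltr01.
  have r'0 : 0 < Num.min r 1 by rewrite lt_min r0 ltr01.
  have [y yx] := age x N _ r'0.
  exists (PartialIsometry x y 0 N (Num.min r 1)); split=> //=.
    by rewrite r'0 expr0 ge_min lexx orbT.
  by apply: guard_le gx; rewrite ge_min lexx.
have fixed n : (n <= pi_fixed (s n))%N by have [[/andP[]]] := sP n.
have fixed_mono m n : (m <= n)%N -> (pi_fixed (s m) <= pi_fixed (s n))%N.
  move=> /subnKC <-; elim: (n - m)%N => [|d IH]; first by rewrite addn0.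
  by rewrite (leq_trans IH)// addnS; have [_ []] := sP (m + d)%N.
have limit (Z : normedModType R) (zn : nat -> nat -> Z) : seq_complete Z ->
    (forall n i, (i < pi_fixed (s n))%N -> `|zn n.+1 i - zn n i| <= eps n) ->
    exists z : nat -> Z,
      forall n i, (i < pi_fixed (s n))%N -> `|zn n i - z i| <= 2 * eps n.
  move=> Zc zns; suff /choice[z zP] : forall i, exists l : Z, forall n,
      (i < pi_fixed (s n))%N -> `|zn n i - l| <= 2 * eps n by exists z => n i; exact: zP.
  move=> i; have [m im mmin] := ex_minnP (ex_intro (fun n => (i < pi_fixed (s n))%N) _ (fixed i.+1)).
  have [l lP] := geometric_limit Zc (fun n mn => zns n i (leq_trans im (fixed_mono m n mn))).
  by exists l => n /mmin; exact: lP.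
have limit_dense (Z : normedModType R) (zn : nat -> nat -> Z) (z z0 : nat -> Z) :
    (forall n i, (i < pi_fixed (s n))%N -> `|zn n i - z i| <= 2 * eps n) ->
    (forall n, exists2 i, (i < pi_fixed (s n.+1))%N & `|zn n.+1 i - z0 (sg n)| <= eps n) ->
    dense_span z0 -> dense_span z.
  move=> h2 h1 zd; apply: dense_span_approx zd _ => j e e0.
  have [M MP] := half_power_lt (divr_gt0 e0 (ltr0n R 2)).
  have [n Mn sn] := sgP j M; have [i ik zi] := h1 n; exists 'X^i; rewrite lcpX -sn.
  rewrite -(subrK (zn n.+1 i) (z0 _)) -addrA (le_lt_trans (ler_normD _ _))//.
  rewrite distrC; have := h2 _ _ ik; have := MP n Mn; rewrite exprS; lra.
have [x xP] := limit X (fun n => pi_dom (s n)) Xc (fun n => let: conj _ (And5 _ h _ _ _) := sP n in h).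
have [y yP] := limit Y (fun n => pi_img (s n)) Yc (fun n => let: conj _ (And5 _ _ h _ _) := sP n in h).
have xd : dense_span x.
  by apply: limit_dense xP _ x0d => n; have [_ []] := sP n.
have yd : dense_span y.
  by apply: limit_dense yP _ y0d => n; have [_ []] := sP n.
apply: isometric_dense_span Xc Yc xd yd _ => p; apply/eqP; rewrite -subr_eq0 -normr_le0.
apply/ler_addgt0Pr => e e0; rewrite add0r.
have l0 : 0 < 5 * (l1 p + 1) by rewrite mulr_gt0// ltr_wpDl// l1_ge0.
have [M MP] := half_power_lt (divr_gt0 e0 l0); pose n := maxn M (size p).
have pn : (size p <= pi_fixed (s n))%N by rewrite (leq_trans _ (fixed n))// leq_maxr.
have [[/andP[_ kN] /andP[_ rn] _ yx] _] := sP n.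
have h1 : near_type (size p) (2 * eps n) (pi_dom (s n)) x.
  by apply: near_dist => i ip; apply: xP; exact: leq_trans pn.
have h2 : near_type (size p) (2 * eps n) (pi_img (s n)) y.
  by apply: near_dist => i ip; apply: yP; exact: leq_trans pn.
have h3 := near_le (leq_trans pn kN) rn yx.
have := near_trans (near_sym h1) (near_trans (near_sym h3) h2) (leqnn _).
move=> /le_trans; apply; have -> : 2 * eps n + (eps n + 2 * eps n) = 5 * eps n by ring.
have := ltW (MP n (leq_maxl _ _)); rewrite ler_pdivlMr//.
rewrite mulrCA mulrA; apply: le_trans; rewrite -!mulrA.
by rewrite ler_wpM2l// ler_wpM2l// ?(ltW (eps_gt0 n))// lerDl.
Qed.

End BackAndForth.

(** * Countably many conditions that characterize a guarded space *)

Section GuardConditions.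
Context {R : realType} (X : normedModType R) (x : nat -> X).
Implicit Type Y : normedModType R.

(** A guard described inside X alone: a sequence of another space is compared with
    it through its type only, so that this yields conditions on types. *)
Definition amalgam_guard (a : nat -> X) k N (r e : R) : Prop :=
  forall M (c c' : nat -> X), (N <= M)%N -> near_type N r c a -> near_type N r c' a ->
    forall eta, 0 < eta -> exists d d' : nat -> X,
      [/\ near_type M eta d c, near_type M eta d' c' &
          forall i, (i < k)%N -> `|d i - d' i| <= e].

Lemma guard_amalgam (a : nat -> X) k N r e :
  guard X a k N r (e / 2) -> amalgam_guard a k N r e.
Proof.
move=> g M c c' NM ca c'a eta eta0.
have [d [dc da]] := g M c NM ca eta eta0.
have [d' [dc' da']] := g M c' NM c'a eta eta0.
exists d, d'; split=> // i ik; rewrite -(subrK (a i) (d i)) -addrA.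
rewrite (le_trans (ler_normD _ _))// (splitr e) lerD ?ltW ?da//.
by rewrite distrC da'.
Qed.

Lemma amalgam_guard_near (a a' : nat -> X) k N r s t e : near_type N s a' a ->
  r + s <= t -> amalgam_guard a k N t e -> amalgam_guard a' k N r e.
Proof.
move=> aa' rst g M c c' NM ca c'a; apply: g => //.
  exact: near_le (near_trans ca aa').
exact: near_le (near_trans c'a aa').
Qed.

Definition inv (n : nat) : R := n.+1%:R^-1.

Lemma inv_gt0 n : 0 < inv n. Proof. by rewrite invr_gt0. Qed.

#[local] Hint Resolve inv_gt0 : core.

Lemma inv_le m n : (m <= n)%N -> inv n <= inv m.
Proof. by move=> mn; rewrite lef_pV2 ?posrE// ler_nat ltnS. Qed.

(** There are only countably many such tuples and, when x is dense, they approximate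
    all the tuples of X. *)
Definition tup (al : seq nat) i : X := x (nth 0%N al i).

(** The initial segments of y are guarded as far as X is concerned. The margin s makes
    the condition open in the type of y. *)
Definition guard_condition Y (y : nat -> Y) k l : Prop :=
  exists al N q s, [/\ (k <= N)%N && (l <= q)%N, 0 < s,
    amalgam_guard (tup al) k N (inv q) (inv l) &
    near_type N (inv q - s) y (tup al)].

(** The tuples of X that continue an almost copy of a guard are realized in Y. The
    hypothesis on y is closed in its type and the conclusion, thanks to the margin
    s, is open, so that the whole is open. *)
Definition extension_condition Y (y : nat -> Y) (al ga : seq nat) k N M q l m : Prop :=
  (k <= N)%N -> (N <= M)%N -> amalgam_guard (tup al) k N (inv q) (inv l) ->
  near_type N (inv q) (tup ga) (tup al) -> near_type N (inv q) y (tup al) ->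
  exists (d : nat -> Y) s, [/\ 0 < s, near_type M (inv m - s) d (tup ga) &
    forall i, (i < k)%N -> `|d i - y i| <= 3 * inv l - s].

Hypothesis xd : forall z e, 0 < e -> exists j, `|z - x j| < e.

Lemma tup_dense (a : nat -> X) N s : 0 < s ->
  exists al, near_type N s a (tup al).
Proof.
move=> s0; have /choice[f fP] : forall i, exists j, `|a i - x j| < s.
  by move=> i; exact: xd.
exists (mkseq f N); apply: near_dist => i iN; rewrite /tup nth_mkseq//.
exact: ltW.
Qed.

Lemma inv_small e : 0 < e -> exists n, inv n < e.
Proof. by move=> /seq_inv_lt[N /(_ N (leqnn N))]; exists N. Qed.

Lemma guarded_guard_condition (h : nat -> X) k l :
  guarded X X -> dense_span h -> guard_condition h k l.
Proof.
move=> gX hd; have [N [r [kN r0 gh]]] := guarded_dense k gX hd (divr_gt0 (inv_gt0 l) (ltr0n R 2)).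
have [q0 /(_ _ (leq_maxl q0 l))] := seq_inv_lt (divr_gt0 r0 (ltr0n R 2)).
move: (leq_maxr q0 l); set q := maxn q0 l => lq qr.
have s0 : 0 < inv q / 2 by rewrite divr_gt0.
have [al hal] := tup_dense h N s0.
exists al, N, q, (inv q / 2); split=> //.
- by rewrite kN.
- apply: amalgam_guard_near (near_sym hal) _ (guard_amalgam gh).
  by move: qr s0; rewrite -/(inv q); lra.
- by rewrite {1}(splitr (inv q)) addrK.
Qed.

(** Let b guard the beginning of h in X. The tuples ga and b both continue an almost
    copy of the guard al, hence amalgamate in X; and the amalgam, which continues an
    almost copy of b, can be brought back next to h. *)
Lemma guarded_extension_condition (h : nat -> X) al ga k N M q l m :
  guarded X X -> extension_condition h al ga k N M q l m.
Proof.
move=> gX kN NM gal gaal hal.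
have [b [N' [r' [NN' r'0 bh gb]]]] := gX h N _ (divr_gt0 (inv_gt0 l) (ltr0n R 2)).
have bal : near_type N (inv q) b (tup al).
  by have := near_trans (near_eq bh) hal; rewrite add0r.
pose t := Num.min r' (Num.min (inv m / 4) (inv l / 8)).
have t0 : 0 < t by rewrite !lt_min r'0 !divr_gt0.
have tr' : t <= r' by rewrite ge_min lexx.
have tm : t <= inv m / 4 by rewrite !ge_min lexx orbT.
have tl : t <= inv l / 8 by rewrite !ge_min lexx !orbT.
have NM1 : (N <= maxn M N')%N by rewrite (leq_trans NM)// leq_maxl.
have [d [d' [dga d'b dd']]] := gal _ _ _ NM1 gaal bal t t0.
pose C := seq_cat N' d' d.
have Cb : near_type N' r' C b.
  have h1 : near_type N' 0 C d' by apply: near_eq => i; exact: seq_catl.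
  have := near_trans h1 (near_le (leq_maxr M N') tr' d'b).
  by rewrite add0r.
have [f [fC fb]] := gb (N' + M)%N C (leq_addr _ _) Cb t t0.
exists (fun i => f (N' + i)%N), (Num.min (inv m / 2) (inv l)); split.
- by rewrite lt_min inv_gt0 divr_gt0.
- have := @near_reindex _ (N' + M)%N M _ (fun i => N' + i)%N _ _ f C (ltW t0) fC.
  rewrite (_ : (fun i => C _) = d); last by apply/funext => i; rewrite /C seq_catr.
  move=> fd; have {}fd := fd _; have := near_trans (fd _) (near_le (leq_maxl M N') (lexx _) dga).
  move=> H; apply: (near_le (leqnn _) _ (H _)) => [|i]; last by rewrite ltn_add2l.
  have : Num.min (inv m / 2) (inv l) <= inv m / 2 by rewrite ge_min lexx.
  by lra.
- move=> i ik; have iN := leq_trans ik kN; have iN' := leq_trans iN NN'.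
  have hl : l1 ('X^(N' + i) : {poly R}) + l1 'X^i <= 2 by rewrite !l1X; lra.
  have := near_pair fC (ltW t0) _ _ hl; rewrite !size_polyXn !lcpX /C seq_catr seq_catl//.
  rewrite ltn_add2l (leq_trans iN NM) => /(_ isT).
  rewrite (leq_trans iN' (leq_addr _ _)) => /(_ isT) h1.
  have h2 := fb i iN; rewrite bh// in h2; have h3 := dd' i ik.
  have h4 : Num.min (inv m / 2) (inv l) <= inv l by rewrite ge_min lexx orbT.
  rewrite -(subrK (f i) (f _)) -addrA (le_trans (ler_normD _ _))//; lra.
Qed.

Section Sufficiency.
Context {Y : normedModType R} (y : nat -> Y).
Hypothesis yd : dense_span y.
Hypothesis yG : forall k l, guard_condition y k l.
Hypothesis yE : forall al ga k N M q l m, extension_condition y al ga k N M q l m.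

(** The finite tuples of Y are almost combinations of initial segments of y, and these
    are almost copied in X. *)
Lemma guard_condition_age (b : nat -> Y) N eta : 0 < eta ->
  exists a : nat -> X, near_type N eta a b.
Proof.
move=> eta0; have eta20 := divr_gt0 eta0 (ltr0n R 2).
have /choice[w wb] : forall i, exists p : {poly R}, `|b i - lcp y p| < eta / 2.
  by move=> i; exact: yd.
have [K K0 wK] := finite_bound (fun i => l1 (w i)) N.
have [S wS] := finite_bound_nat (fun i => size (w i)) N.
have [l lK] := inv_small (divr_gt0 eta20 K0).
have [al [N' [q [s [/andP[SN' lq] s0 _ yal]]]]] := yG S l.
exists (fun i => lcp (tup al) (w i)).
have qK : inv q * K <= eta / 2.
  by rewrite -ler_pdivlMr// (le_trans _ (ltW lK))// inv_le.
have h : near_type N' (inv q) (tup al) y.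
  by apply: near_le (near_sym yal) => //; rewrite gerBl ltW.
have h1 : near_type N (inv q * K) (fun i => lcp (tup al) (w i)) (fun i => lcp y (w i)).
  apply: near_lcp (ltW (inv_gt0 q)) h _ => i iN; split; last exact: wK.
  exact: leq_trans (wS i iN) SN'.
have h2 : near_type N (eta / 2) (fun i => lcp y (w i)) b.
  by apply: near_dist => i _; rewrite distrC ltW.
apply: near_le (leqnn _) _ (near_trans h1 h2); lra.
Qed.

Lemma conditions_guarded : guarded X Y.
Proof.
apply: (dense_guarded yd) => k e e0; have [l l3] := inv_small (divr_gt0 e0 (ltr0n R 3)).
have [al [N [q [s [/andP[kN lq] s0 gal yal]]]]] := yG k l.
exists N, (s / 4); split=> //; first by rewrite divr_gt0.
move=> M c NM cy eta eta0.
pose t := Num.min (s / 4) (eta / 2); have t0 : 0 < t by rewrite lt_min !divr_gt0.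
have [ga cga] := tup_dense c M t0.
have ts : t <= s / 4 by rewrite ge_min lexx.
have te : t <= eta / 2 by rewrite ge_min lexx orbT.
have [m mP] := inv_small (divr_gt0 eta0 (ltr0n R 2)).
have gaal : near_type N (inv q) (tup ga) (tup al).
  have := near_trans (near_le NM ts (near_sym cga)) (near_trans cy yal).
  by apply: near_le => //; lra.
have yal' : near_type N (inv q) y (tup al).
  by apply: near_le yal => //; lra.
have [d [s' [s'0 dga dy]]] := @yE al ga k N M q l m kN NM gal gaal yal'.
exists d; split.
  by apply: near_le (leqnn _) _ (near_trans dga (near_sym cga)); lra.
by move=> i /dy; rewrite -(ltr_pM2l (ltr0n R 3)) mulrCA divff// in l3; lra.
Qed.

End Sufficiency.

(** The guards of X serve for Y because Y has no other finite tuples than X, and the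
    conditions provide guards in Y for the tuples of X: the back-and-forth applies. *)
Lemma conditions_isometric Y (y : nat -> Y) : seq_complete X -> seq_complete Y ->
    guarded X X -> dense_span y -> (forall k l, guard_condition y k l) ->
    (forall al ga k N M q l m, extension_condition y al ga k N M q l m) ->
  isometric Y X.
Proof.
move=> Xc Yc gX yd yG yE.
have xd' : dense_span x.
  by move=> z e e0; have [j zj] := xd z e0; exists 'X^j; rewrite lcpX.
have gXY := conditions_guarded yd yG yE.
apply: (back_and_forth Yc Xc yd xd' gXY) => [|b N eta eta0]; last first.
  exact (guard_condition_age yd yG b N eta0).
move=> b k e e0; have [b' [N [r [kN r0 bb' gb]]]] := gX b k e e0.
exists b', N, (r / 2); split=> //; first by rewrite divr_gt0.
move=> M c NM cb eta eta0.
pose t := Num.min (r / 2) (eta / 2); have t0 : 0 < t by rewrite lt_min !divr_gt0.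
have [a ac] := guard_condition_age yd yG c M t0.
have tr : t <= r / 2 by rewrite ge_min lexx.
have te : t <= eta / 2 by rewrite ge_min lexx orbT.
have ab : near_type N r a b'.
  by apply: near_le (leqnn _) _ (near_trans (near_le NM tr ac) cb); lra.
have [d [da db]] := gb M a NM ab (eta / 2) (divr_gt0 eta0 (ltr0n R 2)).
exists d; split=> //.
by apply: near_le (leqnn _) _ (near_trans da ac); lra.
Qed.

Lemma conditions_transfer Y (y : nat -> Y) (T : {linear Y -> X}) :
    isometric_embedding T -> range T = setT -> guarded X X -> dense_span y ->
  (forall k l, guard_condition y k l) /\
  (forall al ga k N M q l m, extension_condition y al ga k N M q l m).
Proof.
move=> iT rT gX yd; have hd := dense_span_surj iT rT yd.
have [S [iS TS ST]] := isometric_inverse iT rT.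
split=> [k l|al ga k N M q l m kN NM gal gaal yal].
  have [al [N [q [s [kN s0 gal hal]]]]] := guarded_guard_condition k l gX hd.
  by exists al, N, q, s; split=> //; move/(near_isometry _ _ _ _ iT): hal.
have hal : near_type N (inv q) (fun i => T (y i)) (tup al).
  exact/near_isometry.
have [d [s [s0 dga dh]]] := @guarded_extension_condition _ al ga k N M q l m gX kN NM gal gaal hal.
exists (fun i => S (d i)), s; split=> //; first exact/near_isometry.
by move=> i /dh; rewrite -[d i]ST -raddfB iT ST.
Qed.

End GuardConditions.

(** * The class of a guarded space is a countable intersection of open sets *)

Section OpenConditions.
Context {R : realType} {X : normedModType R} (x : nat -> X).

Lemma guard_condition_near (Y : normedModType R) (y : nat -> Y) k l :
    guard_condition x y k l ->
  exists N r, 0 < r /\ forall (Z : normedModType R) (z : nat -> Z),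
    near_type N r z y -> guard_condition x z k l.
Proof.
move=> [al [N [q [s [kN s0 gal yal]]]]].
exists N, (s / 2); split=> [|Z z zy]; first by rewrite divr_gt0.
exists al, N, q, (s / 2); split=> //; first by rewrite divr_gt0.
by apply: near_le (leqnn _) _ (near_trans zy yal); lra.
Qed.

(** Either the hypothesis on y fails, and then it fails in a neighbourhood because it
    is closed; or the realization in Y, approximated by combinations of terms of y,
    is transferred to every nearby sequence. *)
Lemma extension_condition_near (Y : normedModType R) (y : nat -> Y)
    al ga k N M q l m : dense_span y ->
    extension_condition x y al ga k N M q l m ->
  exists N' r, 0 < r /\ forall (Z : normedModType R) (z : nat -> Z),
    near_type N' r z y -> extension_condition x z al ga k N M q l m.
Proof.
move=> yd yE.
have [nyal|yal] := pselect (~ near_type N (inv q) y (tup x al)).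
  have [p [pN py]] : exists p : {poly R}, (size p <= N)%N /\
      inv q * l1 p < `| `|lcp y p| - `|lcp (tup x al) p| |.
    apply: contrapT => h; apply: nyal => p pN; rewrite leNgt; apply/negP => ph.
    by apply: h; exists p.
  have l0 : 0 < l1 p + 1 by rewrite ltr_wpDl// l1_ge0.
  pose g := `| `|lcp y p| - `|lcp (tup x al) p| | - inv q * l1 p.
  have g0 : 0 < g by rewrite subr_gt0.
  exists N, (g / (l1 p + 1)); split; first by rewrite divr_gt0.
  move=> Z z zy kN NM gal gaal /(_ p pN); have := zy p pN.
  have : g / (l1 p + 1) * l1 p < g.
    by rewrite mulrAC ltr_pdivrMr// ltr_pM2l// ltrDl.
  move=> h1 h2 h3; exfalso.
  have := ler_normD (`|lcp y p| - `|lcp z p|) (`|lcp z p| - `|lcp (tup x al) p|).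
  rewrite addrA subrK (distrC `|lcp y p| `|lcp z p|) => h4.
  have : g = g by []; rewrite {2}/g => h5; lra.
have {}yal := contrapT yal.
have [[kN NM gal gaal]|nh] := pselect [/\ (k <= N)%N, (N <= M)%N,
    amalgam_guard (tup x al) k N (inv q) (inv l) &
    near_type N (inv q) (tup x ga) (tup x al)]; last first.
  by exists 0%N, 1; split=> // Z z _ kN NM gal gaal; exfalso; apply: nh.
have [d [s [s0 dga dy]]] := yE kN NM gal gaal yal.
have /choice[w wd] : forall i, exists p : {poly R}, `|d i - lcp y p| < s / 4.
  by move=> i; apply: yd; rewrite divr_gt0.
have [K K0 wK] := finite_bound (fun i => l1 (w i)) M.
have [S wS] := finite_bound_nat (fun i => size (w i)) M.
pose r := s / (4 * (K + 1)); have K10 : 0 < K + 1 by rewrite ltr_wpDl// ltW.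
have r0 : 0 < r by rewrite divr_gt0// mulr_gt0.
have rK1 : r * (K + 1) = s / 4 by rewrite /r invfM mulrA divfK// gt_eqF.
have rK : r * K <= s / 4 by rewrite -rK1 ler_wpM2l ?(ltW r0)// lerDl.
exists (maxn k S), r; split=> // Z z zy _ _ _ _ _.
exists (fun i => lcp z (w i)), (s / 4); split; first by rewrite divr_gt0.
- have h1 : near_type M (r * K) (fun i => lcp z (w i)) (fun i => lcp y (w i)).
    apply: near_lcp (ltW r0) zy _ => i iM; split; last exact: wK.
    by rewrite (leq_trans (wS i iM))// leq_maxr.
  have h2 : near_type M (s / 4) (fun i => lcp y (w i)) d.
    by apply: near_dist => i _; rewrite distrC ltW.
  by apply: near_le (leqnn _) _ (near_trans h1 (near_trans h2 dga)); lra.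
- move=> i ik; have iM : (i < M)%N by rewrite (leq_trans ik)// (leq_trans kN).
  have hl : l1 (w i) + l1 ('X^i : {poly R}) <= K + 1 by rewrite l1X lerD2r wK.
  have := near_pair zy (ltW r0) _ _ hl; rewrite size_polyXn !lcpX rK1 => h.
  have {}h := h (leq_trans (wS i iM) (leq_maxr _ _)) (leq_trans ik (leq_maxl _ _)).
  have h1 : `|lcp y (w i) - y i| <= `|d i - lcp y (w i)| + `|d i - y i|.
    have := ler_normD (lcp y (w i) - d i) (d i - y i).
    by rewrite addrA subrK (distrC (lcp y (w i)) (d i)).
  by have := wd i; have := dy i ik; lra.
Qed.

End OpenConditions.

Lemma separable_sequence (R : realType) (X : normedModType R) : separable X ->
  exists x : nat -> X, forall z e, 0 < e -> exists j, `|z - x j| < e.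
Proof.
move=> [D /countable_injP[f fD] dD].
exists (fun n => xget 0 [set d | D d /\ f d = n]) => z e e0.
have [d [zd Dd]] : ball z e `&` D !=set0.
  by apply: dD; [exists z; exact: ballxx|exact: ball_open].
exists (f d).
have [Dd' fdd'] : [set d' | D d' /\ f d' = f d] (xget 0 [set d' | D d' /\ f d' = f d]).
  by apply: (@xgetPex _ 0 [set d' | D d' /\ f d' = f d]); exists d.
have -> : xget 0 [set d' | D d' /\ f d' = f d] = d by apply: fD; rewrite ?inE.
by move: zd; rewrite -ball_normE.
Qed.

Section GdeltaClass.
Context {R : realType} (X : completeNormedModType R) (J : set {ptws {poly rat} -> R}).
Hypothesis Jpn : J `<=` pseudonorms R.

Let J_pn (mu : J) : pseudonorms R (set_val mu).
Proof. by apply: Jpn; exact: set_valP. Qed.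

Lemma open_near (S : set J) : (forall mu : J, S mu -> exists N r, 0 < r /\
    forall nu : J, near_type N r (gen (set_val nu)) (gen (set_val mu)) -> S nu) ->
  open S.
Proof.
move=> h; rewrite openE => mu /h[N [r [r0 SN]]].
have h2 : nbhs mu ((set_val : J -> {ptws {poly rat} -> R}) @^-1` [set nu |
    pseudonorms R nu -> near_type N r (gen nu) (gen (set_val mu))]).
  exact: (@initial_continuous _ _ (set_val : J -> {ptws {poly rat} -> R}) mu _
    (near_nbhs N (J_pn mu) r0)).
have sub : (set_val : J -> {ptws {poly rat} -> R}) @^-1` [set nu |
    pseudonorms R nu -> near_type N r (gen nu) (gen (set_val mu))] `<=` S.
  by move=> nu /(_ (J_pn nu)); exact: SN.
exact: (filterS sub h2).
Qed.

(** The conditions are countably many, since they are indexed by integers and finite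
    sequences of integers. *)
Theorem guarded_Gdelta : separable X -> guarded X X -> Gdelta (isometry_class X J).
Proof.
move=> /separable_sequence[x xd] gX.
pose idx := ((nat * nat) + (seq nat * seq nat * (nat * nat * nat * nat * nat * nat)))%type.
pose cond (i : idx) : set J := match i with
  | inl (k, l) => [set mu | guard_condition x (gen (set_val mu)) k l]
  | inr (al, ga, (k, N, M, q, l, m)) =>
      [set mu | extension_condition x (gen (set_val mu)) al ga k N M q l m]
  end.
have cond_open i : open (cond i).
  case: i => [[k l]|[[al ga] [[[[[k N] M] q] l] m]]]; apply: open_near => mu.
    by move=> /guard_condition_near[N [r [r0 h]]]; exists N, r; split=> // nu /h.
  move=> /(extension_condition_near (@gen_dense R _))[N' [r [r0 h]]].
  by exists N', r; split=> // nu /h.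
exists (fun n => if @unpickle idx n is Some i then cond i else setT).
  by move=> n; case: unpickle => [i|]; [exact: cond_open|exact: openT].
apply/seteqP; split=> mu /=.
  move=> [T [iT rT]] n _; case: unpickle => [i|//].
  have [yG yE] := conditions_transfer xd iT rT gX (@gen_dense R _).
  by case: i => [[k l]|[[al ga] [[[[[k N] M] q] l] m]]] /=; [exact: yG|exact: yE].
move=> h; have hc i : cond i mu by have := h (pickle i) I; rewrite pickleK.
apply: (conditions_isometric xd _ _ gX (@gen_dense R _)).
- exact: complete_seq_complete.
- exact: complete_seq_complete.
- by move=> k l; exact: hc (inl (k, l)).
- by move=> al ga k N M q l m; exact: hc (inr (al, ga, (k, N, M, q, l, m))).
Qed.

End GdeltaClass.

(** * Almost isometric embeddings and ages *)

Section Operators.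
Context {R : realType}.
Implicit Types E F X Y Z : normedModType R.

Lemma opnorm_le Y Z (f : Y -> Z) M : 0 <= M -> (forall y, `|f y| <= M * `|y|) ->
  opnorm f <= M.
Proof.
move=> M0 fM; apply: ge_sup; first by exists `|f 0|, 0 => //=; rewrite normr0.
move=> _ [y /= y1 <-]; apply: (le_trans (fM y)).
by rewrite -[leRHS]mulr1 ler_wpM2l.
Qed.

Lemma opnorm_ge0 Y Z (f : Y -> Z) : 0 <= opnorm f.
Proof.
rewrite /opnorm; set S := (X in sup X).
have [hS|/sup_out ->//] := pselect (has_sup S).
apply: (@le_trans _ _ `|f 0|) => //; apply: ub_le_sup; first by case: hS.
by exists 0 => //=; rewrite normr0.
Qed.

Lemma le_opnorm Y Z (f : Y -> Z) M y : (forall a y, f (a *: y) = a *: f y) ->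
  (forall y, `|f y| <= M * `|y|) -> `|f y| <= opnorm f * `|y|.
Proof.
move=> fZ fM; have [->|y0] := eqVneq y 0.
  have -> : f 0 = 0 by rewrite -[X in f X](scale0r 0) fZ scale0r.
  by rewrite !normr0 mulr0.
have ny : 0 < `|y| by rewrite normr_gt0.
have h : `|f (`|y|^-1 *: y)| <= opnorm f.
  apply: ub_le_sup; last first.
    by exists (`|y|^-1 *: y) => //=; rewrite normrZ normfV normr_id mulVf// gt_eqF.
  exists `|M| => _ [z /= z1 <-]; apply: (le_trans (fM z)).
  rewrite (le_trans (ler_wpM2r (normr_ge0 z) (ler_norm M)))//.
  by rewrite -[leRHS]mulr1 ler_wpM2l.
by move: h; rewrite fZ normrZ normfV normr_id ler_pdivrMl// mulrC.
Qed.

Lemma finite_dim_bounded E Z (f : {linear E -> Z}) : finite_dim E ->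
  exists2 M, 0 <= M & forall x, `|f x| <= M * `|x|.
Proof.
move=> /basis_exists[n [b [K [_ bs K0 bK]]]].
have [M M0 fM] := finite_bound (fun i => `|f (b i)|) n.
exists (K * M) => [|x]; first by rewrite mulr_ge0// ltW.
have [p pn ->] := bs x; rewrite lcp_map (le_trans (norm_lcp_le pn fM))//.
by rewrite mulrAC ler_wpM2r ?(ltW M0)// bK.
Qed.

Lemma Emb_ge C Y Z (T : {linear Y -> Z}) y : Emb C T -> expR (- C) * `|y| <= `|T y|.
Proof. by move=> /(_ y)/andP[]. Qed.

Lemma Emb_le C Y Z (T : {linear Y -> Z}) y : Emb C T -> `|T y| <= expR C * `|y|.
Proof. by move=> /(_ y)/andP[]. Qed.

Lemma Emb_inj C Y Z (T : {linear Y -> Z}) y : Emb C T -> T y = 0 -> y = 0.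
Proof.
move=> TC Ty; apply/eqP; rewrite -normr_le0 -(ler_pM2l (expR_gt0 (- C))).
by rewrite mulr0 (le_trans (Emb_ge y TC))// Ty normr0.
Qed.

Lemma Emb_mono C D Y Z (T : {linear Y -> Z}) : C <= D -> Emb C T -> Emb D T.
Proof.
move=> CD TC y; apply/andP; split.
  by rewrite (le_trans _ (Emb_ge y TC))// ler_wpM2r// ler_expR lerN2.
by rewrite (le_trans (Emb_le y TC))// ler_wpM2r// ler_expR.
Qed.

Lemma Emb_isometric C Y Z (T : {linear Y -> Z}) : 0 <= C -> isometric_embedding T -> Emb C T.
Proof.
move=> C0 iT y; rewrite iT; apply/andP; split.
  by rewrite -[leRHS]mul1r ler_wpM2r// -expR0 ler_expR oppr_le0.
by rewrite -[leLHS]mul1r ler_wpM2r// -expR0 ler_expR.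
Qed.

Lemma Emb_comp C D X Y Z (S : {linear X -> Y}) (T : {linear Y -> Z}) :
  Emb C S -> Emb D T -> Emb (C + D) (T \o S)%FUN.
Proof.
move=> SC TD x; apply/andP; split => /=.
  rewrite opprD addrC expRD -mulrA (le_trans _ (Emb_ge _ TD))//.
  by rewrite ler_wpM2l ?expR_ge0// Emb_ge.
rewrite addrC expRD -mulrA (le_trans (Emb_le _ TD))//.
by rewrite ler_wpM2l ?expR_ge0// Emb_le.
Qed.

Lemma Emb_comp_le C D c X Y Z (S : {linear X -> Y}) (T : {linear Y -> Z}) :
  C + D <= c -> Emb C S -> Emb D T -> Emb c (T \o S)%FUN.
Proof. by move=> h SC TD; apply: Emb_mono h _; exact: Emb_comp. Qed.

(** Multiplicative and additive control of the distortion are equivalent. *)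
Lemma Emb_of_dist (C : R) : 0 < C -> exists2 t, 0 < t &
  forall Y Z (T : {linear Y -> Z}), (forall y, `| `|T y| - `|y| | <= t * `|y|) -> Emb C T.
Proof.
move=> C0; have e1 : expR (- C) < 1 by rewrite -expR0 ltr_expR oppr_lt0.
exists (1 - expR (- C)); first by rewrite subr_gt0.
move=> Y Z T Tt y; have := Tt y; rewrite ler_distl => /andP[h1 h2].
apply/andP; split; first by apply: le_trans h1; lra.
apply: (le_trans h2).
have -> : `|y| + (1 - expR (- C)) * `|y| = (2 - expR (- C)) * `|y| by ring.
rewrite ler_wpM2r//.
have := sqr_ge0 (expR C - 1); have := expR_gt0 C; rewrite expRN expr2.
move: (expR C) => u u0 h.
by rewrite -(ler_pM2l u0) mulrBr mulfV ?gt_eqF//; lra.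
Qed.

Lemma dist_of_Emb (t : R) : 0 < t -> exists2 C, 0 < C &
  forall Y Z (T : {linear Y -> Z}), Emb C T -> forall y, `| `|T y| - `|y| | <= t * `|y|.
Proof.
move=> t0; have t1 : 0 < 1 + t by rewrite addr_gt0.
exists (ln (1 + t)); first by rewrite ln_gt0// ltrDl.
move=> Y Z T TC y; have := TC y; rewrite expRN lnK ?posrE// => /andP[h1 h2].
rewrite ler_distl; apply/andP; split; last by apply: (le_trans h2); lra.
apply: le_trans h1; have -> : `|y| - t * `|y| = (1 - t) * `|y| by ring.
rewrite ler_wpM2r//.
rewrite -(ler_pM2l t1) mulfV ?gt_eqF//.
have : (1 + t) * (1 - t) = 1 - t ^+ 2 by ring.
by have := sqr_ge0 t; lra.
Qed.

Lemma near_of_dist Y Z (T : {linear Y -> Z}) N (a : nat -> Y) t M :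
    0 <= t -> (forall y, `| `|T y| - `|y| | <= t * `|y|) ->
    (forall i, (i < N)%N -> `|a i| <= M) ->
  near_type N (t * M) (fun i => T (a i)) a.
Proof.
move=> t0 Tt aM p pN; rewrite -lcp_map (le_trans (Tt _))// -mulrA ler_wpM2l//.
by rewrite mulrC (norm_lcp_le pN).
Qed.

End Operators.

Section Subspaces.
Context {R : realType}.
Implicit Types E F X : normedModType R.

Lemma subspace_eltP (V : lmodType R) (E : subspace_of V) x :
  (E : set V) x -> x \in subspace_pred E.
Proof. by move=> Ex; apply/mem_set. Qed.

Definition subspace_elt (V : lmodType R) (E : subspace_of V) x (Ex : (E : set V) x) :
  subspace_type E := SubspaceElt (subspace_eltP Ex).

Fact subspace_val_is_linear (V : lmodType R) (E : subspace_of V) :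
  linear (@subspace_val R V E).
Proof. by move=> a x y; exact: (linearP (\val : {linear subspace_type E -> V})). Qed.

HB.instance Definition _ (V : lmodType R) (E : subspace_of V) :=
  GRing.isLinear.Build R (subspace_type E) V _ (@subspace_val R V E)
    (@subspace_val_is_linear V E).

Lemma subspace_val_isometric X (E : subspace_of X) :
  isometric_embedding (@subspace_val R X E).
Proof. by []. Qed.

Lemma subspace_mem (V : lmodType R) (E : subspace_of V) (x : subspace_type E) :
  (E : set V) (subspace_val x).
Proof. exact/set_mem/subspace_valP. Qed.

Section Span.
Context (V : lmodType R) (N : nat) (a : nat -> V).

Definition span_set : set V := [set x | exists2 p : {poly R}, (size p <= N)%N & x = lcp a p].

Fact span_set0 : span_set 0.
Proof. by exists 0; rewrite ?size_poly0// raddf0. Qed.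

Fact span_setL (c : R) x y : span_set x -> span_set y -> span_set (c *: x + y).
Proof.
move=> [p pN ->] [q qN ->]; exists (c *: p + q); last by rewrite linearP.
rewrite (leq_trans (size_polyD _ _))// geq_max qN andbT.
exact: leq_trans (size_scale_leq _ _) pN.
Qed.

Definition span_space : subspace_of V := Subspace span_set0 span_setL.

Lemma span_mem i : (i < N)%N -> span_set (a i).
Proof. by move=> iN; exists 'X^i; rewrite ?size_polyXn// lcpX. Qed.

Definition span_gen i : subspace_type span_space :=
  if pselect (i < N)%N is left iN then subspace_elt (E := span_space) (span_mem iN) else 0.

Lemma span_genE i : (i < N)%N -> subspace_val (span_gen i) = a i.
Proof. by move=> iN; rewrite /span_gen; case: pselect. Qed.

Lemma span_gen_lcp (p : {poly R}) : (size p <= N)%N -> subspace_val (lcp span_gen p) = lcp a p.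
Proof. by move=> pN; rewrite lcp_map; apply: eq_lcp pN _ => i /span_genE. Qed.

Lemma span_gen_spanning : spanning N span_gen.
Proof.
move=> x; have [p pN xp] := subspace_mem x; exists p => //.
by apply: val_inj; rewrite [RHS]span_gen_lcp.
Qed.

Lemma span_finite_dim : finite_dim (subspace_type span_space).
Proof. exact: finite_dim_range span_gen_spanning. Qed.

End Span.

Lemma near_span_gen X N (a : nat -> X) : near_type N 0 (span_gen N a) a.
Proof.
by move=> p pN; rewrite mul0r -(span_gen_lcp a pN) subspace_val_isometric subrr normr0.
Qed.

End Subspaces.

Section Ages.
Context {R : realType}.
Implicit Types E F X : normedModType R.

Lemma Age_Age_cl X E : Age X E -> Age_cl X E.
Proof.
move=> aE; split=> [|e e0]; first by case: aE.
exists E => //; apply: (@le_lt_trans _ _ 0%E); last by rewrite lte_fin.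
pose id : {linear E -> E} := idfun.
have id1 : opnorm id <= 1 by apply: opnorm_le => // y; rewrite mul1r.
apply: (@le_trans _ _ (ln (opnorm id * opnorm id))%:E).
  by apply: ereal_inf_lbound; exists id, id; split.
rewrite lee_fin ln_le0//.
by rewrite -[leRHS]mulr1 ler_pM ?opnorm_ge0.
Qed.

Lemma subspace_Age_cl X (E : subspace_of X) : finite_dim (subspace_type E) ->
  Age_cl X (subspace_type E).
Proof.
move=> fE; apply: Age_Age_cl; split=> //; exists (@subspace_val R X E : {linear _ -> _}).
exact: subspace_val_isometric.
Qed.

(** An isomorphism of small distortion becomes an almost isometric embedding when it
    is divided by its norm. *)
Lemma Age_cl_Emb X F eta : Age_cl X F -> 0 < eta -> exists i : {linear F -> X}, Emb eta i.
Proof.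
move=> [fF aF] eta0; have [E [fE [j ij]]] := aF eta eta0.
move=> /ereal_inf_lt[_ [T [S [TS ST ->]]]]; rewrite lte_fin => TSeta.
have [MT _ TM] := finite_dim_bounded T fE; have [MS _ SM] := finite_dim_bounded S fF.
have TZ a x : T (a *: x) = a *: T x by rewrite linearZ.
have SZ a x : S (a *: x) = a *: S x by rewrite linearZ.
have Tle x := le_opnorm x TZ TM; have Sle x := le_opnorm x SZ SM.
have [F0|/existsNP[y /eqP y0]] := pselect (forall y : F, y = 0).
  exists (j \o S)%FUN => y; rewrite /= (F0 y) !raddf0 !normr0 !mulr0 lexx//.
have ny : 0 < `|y| by rewrite normr_gt0.
have s0 : 0 < opnorm S.
  rewrite lt0r opnorm_ge0 andbT; apply/eqP => S0; have := Sle y.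
  by rewrite S0 mul0r normr_le0 => /eqP Sy; move: y0; rewrite -(ST y) Sy raddf0 eqxx.
have t0 : 0 < opnorm T.
  rewrite lt0r opnorm_ge0 andbT; apply/eqP => T0; have := Tle (S y).
  by rewrite T0 mul0r ST normr_le0 (negbTE y0).
exists (j \o ( *:%R (opnorm S)^-1 \o S))%FUN => x /=.
rewrite ij normrZ gtr0_norm ?invr_gt0//; apply/andP; split.
  rewrite -[in leLHS](ST x) ler_pdivlMl// mulrCA -ler_pdivlMl ?expR_gt0// expRN invrK.
  apply: (@le_trans _ _ (opnorm S * (opnorm T * `|S x|))).
    by rewrite ler_wpM2l ?opnorm_ge0// Tle.
  rewrite mulrA ler_wpM2r// mulrC -[leLHS]lnK ?posrE ?mulr_gt0// ler_expR.
  exact: ltW.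
rewrite ler_pdivrMl// (le_trans (Sle x))// ler_wpM2l ?opnorm_ge0//.
by rewrite -[leLHS]mul1r ler_wpM2r// -expR0 ler_expR ltW.
Qed.

(** Let F be given by the first condition and psi : F -> G. As G almost embeds in X by
    some j, the inclusion of F and j \o psi differ on E by an isometry T of X, up to
    eps: the embedding T \o j is the one required. *)
Lemma gF1_gF2 (X : completeNormedModType R) : gF1 X -> gF2 X.
Proof.
move=> h E e fE e0; have [delta [F [EF [d0 fF TF]]]] := h E e fE e0.
pose inc : subspace_type E -> subspace_type F := subspace_incl EF.
have incl : linear inc by move=> a x y; exact: val_inj.
pose phi : {linear _ -> _} := HB.pack inc (GRing.isLinear.Build R _ _ _ inc incl).
exists (subspace_type F), phi, (delta / 2); split.
- exact: subspace_Age_cl.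
- by apply: Emb_isometric; [exact: ltW|].
- by rewrite divr_gt0.
move=> G psi eta aG psid eta0.
have d20 : 0 < delta / 2 by rewrite divr_gt0.
have m0 : 0 < Num.min eta (delta / 2) by rewrite lt_min eta0.
have [j jm] := Age_cl_Emb aG m0.
have jpsi : Emb delta (j \o psi)%FUN.
  apply: Emb_comp_le psid jm.
  have : Num.min eta (delta / 2) <= delta / 2 by rewrite ge_min lexx orbT.
  by lra.
have idF : Emb delta (@subspace_val R X F : {linear _ -> _}).
  by apply: Emb_isometric; [exact: ltW|exact: subspace_val_isometric].
have [T [[iT rT] Te]] := TF _ _ jpsi idF.
exists (T \o j)%FUN => //.
move=> x /=; rewrite iT; apply: Emb_mono jm x.
by rewrite ge_min lexx.
Qed.

End Ages.

(** * Guards from weak amalgamation *)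

Lemma Emb_id (R : realType) (Y : normedModType R) C : 0 <= C ->
  Emb C (idfun : {linear Y -> Y}).
Proof. by move=> C0; apply: Emb_isometric. Qed.

Section GuardsFromGF2.
Context {R : realType} (X : completeNormedModType R).

(** The abstract guard F is embedded in X next to E by the second condition
    applied to the identity of F; a tuple continuing an almost copy of it spans a
    space G to which the condition applies. *)
Theorem gF2_guarded : gF2 X -> guarded X X.
Proof.
move=> g2 a k e e0; have [A A0 aA] := finite_bound (fun i => `|a i|) k.
pose E := span_space k a.
pose e1 := e / (8 * (A + 1)); have A10 : 0 < A + 1 by rewrite addr_gt0.
have e10 : 0 < e1 by rewrite divr_gt0// mulr_gt0.
have e1A : e1 * A <= e / 8.
  rewrite /e1 invfM mulrA mulrAC ler_pdivrMr// ler_wpM2l ?divr_ge0 ?(ltW e0)//.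
  by rewrite lerDl.
have [F [phi [delta [aF ephi d0 gF]]]] := g2 E e1 (span_finite_dim k a) e10.
have [td td0 tdE] := Emb_of_dist d0.
have [eta0 eta00 eta0E] := dist_of_Emb (divr_gt0 td0 (ltr0n R 2)).
have [i0 ei0 i0e] := gF F idfun eta0 aF (@Emb_id _ F _ (ltW d0)) eta00.
have [n [f [K [fi fs K0 fK]]]] := basis_exists (proj1 aF).
have opE (G : normedModType R) (psi : {linear F -> G}) (i : {linear G -> X}) C D :
    Emb C psi -> Emb D i ->
    opnorm (fun x : subspace_type E => subspace_val x - i (psi (phi x))) < e1 ->
    forall x : subspace_type E, `|subspace_val x - i (psi (phi x))| <= e1 * `|x|.
  move=> Cpsi Di op x.
  have hZ c (y : subspace_type E) : subspace_val (c *: y) - i (psi (phi (c *: y))) =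
      c *: (subspace_val y - i (psi (phi y))).
    by rewrite !linearZ/= -scalerDr.
  have hM (y : subspace_type E) : `|subspace_val y - i (psi (phi y))| <=
      (1 + expR D * (expR C * expR e1)) * `|y|.
    have nE : `|subspace_val y| = `|y| by [].
    rewrite (le_trans (ler_normB _ _))// nE mulrDl mul1r lerD2l -!mulrA.
    rewrite (le_trans (Emb_le _ Di))// ler_wpM2l ?expR_ge0//.
    rewrite (le_trans (Emb_le _ Cpsi))// ler_wpM2l ?expR_ge0//.
    exact: (Emb_le y ephi).
  by apply: (le_trans (le_opnorm x hZ hM)); rewrite ler_wpM2r// ltW.
pose b := seq_cat k a (fun j => i0 (f j)).
pose L := 1 + K * (expR e1 * A); have L0 : 0 < L.
  by rewrite addr_gt0// !mulr_gt0// expR_gt0.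
pose r := Num.min (td / 2 / K) (e / 8 / L).
have r0 : 0 < r by rewrite lt_min !divr_gt0.
have rK : r * K <= td / 2 by rewrite -ler_pdivlMr// ge_min lexx.
have rL : r * L <= e / 8 by rewrite -ler_pdivlMr// ge_min lexx orbT.
exists b, (k + n)%N, r; split=> //; first exact: leq_addr.
  by move=> i ik; exact: seq_catl.
move=> M c NM cb eta etap; pose G := span_space M c.
have cbn : near_type n r (fun j => c (k + j)%N) (fun j => i0 (f j)).
  have := @near_reindex _ (k + n)%N n _ (fun j => k + j)%N _ _ c b (ltW r0) cb.
  rewrite (_ : (fun j => b _) = fun j => i0 (f j)); last first.
    by apply/funext => j; rewrite /b seq_catr.
  by apply => j; rewrite ltn_add2l.
pose c' j : subspace_type G := span_gen M c (k + j)%N.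
have kM j : (j < n)%N -> (k + j < M)%N by move=> jn; rewrite (leq_trans _ NM)// ltn_add2l.
have c'n : near_type n 0 c' (fun j => c (k + j)%N).
  have := @near_reindex _ M n _ (fun j => k + j)%N _ _ _ _ (lexx _) (@near_span_gen _ _ M c).
  by apply.
have [psi psiE] := basis_map c' fi fs.
have psid : Emb delta psi.
  apply: tdE => y; have [p pn ->] := fs y; rewrite psiE//.
  have h1 := near_trans c'n cbn pn; rewrite add0r -lcp_map in h1.
  have h2 := eta0E _ _ _ ei0 (lcp f p).
  have h3 : r * l1 p <= td / 2 * `|lcp f p|.
    apply: (@le_trans _ _ (r * (K * `|lcp f p|))); first by rewrite ler_wpM2l ?(ltW r0)// fK.
    by rewrite mulrA ler_wpM2r.
  rewrite -(subrK `|i0 (lcp f p)| `|lcp c' p|) -addrA (le_trans (ler_normD _ _))//.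
  by rewrite (splitr td) mulrDl; apply: lerD => //; exact: le_trans h1 h3.
have [C C0 cC] := finite_bound (fun i => `|span_gen M c i|) M.
pose t := Num.min 1 (eta / C).
have t0 : 0 < t by rewrite lt_min ltr01 divr_gt0.
have [eta' eta'0 eta'E] := dist_of_Emb t0.
have aG : Age_cl X (subspace_type G) by exact/subspace_Age_cl/span_finite_dim.
have [i ei ie] := gF _ psi eta' aG psid eta'0.
exists (fun j => i (span_gen M c j)); split.
  have := near_of_dist (ltW t0) (eta'E _ _ _ ei) cC => h.
  apply: near_le (leqnn _) _ (near_trans h (@near_span_gen _ _ M c)).
  by rewrite addr0 -ler_pdivlMr// ge_min lexx orbT.
move=> j jk; have jN : (j < k + n)%N by rewrite (leq_trans jk)// leq_addr.
pose x : subspace_type E := span_gen k a j.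
have xA : `|x| <= A by rewrite /= -[leLHS]/`|subspace_val x| span_genE// aA.
have h1 : `|a j - i (psi (phi x))| <= e / 8.
  have := opE _ psi i _ _ psid ei ie x; rewrite span_genE// => /le_trans; apply.
  by apply: le_trans e1A; rewrite ler_wpM2l// ltW.
have h2 : `|a j - i0 (phi x)| <= e / 8.
  have := opE _ idfun i0 _ _ (@Emb_id _ F _ (lexx 0)) ei0 i0e x.
  rewrite span_genE// => /le_trans; apply.
  by apply: le_trans e1A; rewrite ler_wpM2l// ltW.
have [p pn phix] := fs (phi x).
have l1p : 1 + l1 p <= L.
  rewrite lerD2l (le_trans (fK _ pn))// -phix ler_wpM2l ?(ltW K0)//.
  by rewrite (le_trans (Emb_le _ ephi))// ler_wpM2l ?expR_ge0.
have h3 : `|span_gen M c j - psi (phi x)| <= e / 4.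
  rewrite phix psiE// -[leLHS]/`|subspace_val _| raddfB/=.
  rewrite span_genE ?(leq_trans jN NM)// lcp_map.
  have -> : lcp (fun l => subspace_val (c' l)) p = lcp (fun l => c (k + l)%N) p.
    by apply: eq_lcp pn _ => l ln; rewrite span_genE// kM.
  pose q : {poly R} := lcp (fun l => 'X^(k + l)) p.
  have hl : l1 ('X^j : {poly R}) + l1 q <= L.
    rewrite l1X (le_trans _ l1p)// lerD2l -[leRHS]mulr1.
    by apply: (l1_lcp_le (leqnn _)) => l _; rewrite l1X.
  have := near_pair cb (ltW r0) _ _ hl; rewrite size_polyXn /q !lcp_reindex !lcpX.
  rewrite {1}/b seq_catl// (_ : (fun l => b _) = fun l => i0 (f l)); last first.
    by apply/funext => l; rewrite /b seq_catr.
  rewrite -lcp_map -phix => h; apply: (le_trans (h jN _)); last by lra.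
  by apply: (size_lcp pn) => l ln; rewrite size_polyXn ltn_add2l.
have h4 : `|i (span_gen M c j) - i (psi (phi x))| <= e / 2.
  rewrite -raddfB; have := eta'E _ _ _ ei (span_gen M c j - psi (phi x)).
  rewrite ler_distl => /andP[_ h]; apply: (le_trans h).
  have : t * `|span_gen M c j - psi (phi x)| <= 1 * `|span_gen M c j - psi (phi x)|.
    by rewrite ler_wpM2r// ge_min lexx.
  by lra.
rewrite -(subrK (i (psi (phi x))) (i _)) -addrA (le_lt_trans (ler_normD _ _))//.
by rewrite distrC in h1; rewrite /b seq_catl//; lra.
Qed.

End GuardsFromGF2.

(** * The direct limit *)

Section AmbientSpace.
Context {R : realType} (E : nat -> normedModType R).

Local Notation L := (linfty E).
Local Notation A := (dirlim_ambient E).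
Local Notation cls := (to_quot (dist_seminorm (c0_subspace E))).

Lemma linfty_norm_le (s : L) r : (forall k, `|linfty_seq s k| <= r) -> `|s| <= r.
Proof.
move=> sr; apply: ge_sup; first by exists `|linfty_seq s 0|, 0%N.
by move=> _ [n _ <-].
Qed.

Lemma le_linfty_norm (s : L) k : `|linfty_seq s k| <= `|s|.
Proof.
have [M sM] : bounded_seqs (linfty_seq s) by exact/set_mem/subspace_valP.
by apply: ub_le_sup; [exists M => _ [j _ <-]|exists k].
Qed.

Lemma linfty_seqB (s t : L) k : linfty_seq (s - t) k = linfty_seq s k - linfty_seq t k.
Proof. by []. Qed.

Definition mk_linfty (s : seq_prod E) (sb : bounded_seqs s) : L :=
  subspace_elt (E := bounded_subspace E) sb.

Lemma cls_norm_lt (s : L) r : `|cls s| < r ->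
  exists2 z : L, null_seqs z & `|s - z| < r.
Proof.
rewrite to_quot_norm /= => /inf_lt[|_ [z z0 <-] h]; last by exists z.
by exists `|s - 0|, 0 => //; exact: null_seqs0.
Qed.

(** This and the next lemma together: the norm of a class is the upper limit of the
    norms of the terms. *)
Lemma cls_norm_le (s : L) K r : 0 <= r -> (forall k, (K <= k)%N -> `|linfty_seq s k| <= r) ->
  `|cls s| <= r.
Proof.
move=> r0 sr; pose t : seq_prod E := fun k => if (k < K)%N then linfty_seq s k else 0.
have tb : bounded_seqs t.
  exists `|s| => k; rewrite /t; case: ifP => _; rewrite ?normr0//; exact: le_linfty_norm.
have t0 : null_seqs (mk_linfty tb).
  rewrite /null_seqs/=; apply/cvgrPdist_lt => e e0; exists K => // k /= Kk.
  by rewrite /linfty_seq/= /t ltnNge Kk/= normr0 subr0 normr0.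
rewrite to_quot_norm /=; apply: (@le_trans _ _ `|s - mk_linfty tb|).
  by apply: ge_inf; [exists 0 => _ [z _ <-]|exists (mk_linfty tb)].
apply: linfty_norm_le => k; rewrite linfty_seqB {2}/linfty_seq/= /t.
by case: ltnP => [_|/sr]; rewrite ?subrr ?normr0 ?subr0.
Qed.

Lemma cls_norm_ge (s : L) K r : (forall k, (K <= k)%N -> r <= `|linfty_seq s k|) ->
  r <= `|cls s|.
Proof.
move=> sr; apply/ler_addgt0Pr => e e0; rewrite leNgt; apply/negP => h.
have {}h : `|cls s| < r - e by lra.
have [z z0 sz] := cls_norm_lt h.
have /cvgrPdist_lt/(_ _ e0)[M _ MP] := z0.
pose k := maxn K M; have := MP k (leq_maxr _ _); rewrite sub0r normrN normr_id.
have := sr k (leq_maxl _ _); have := le_lt_trans (le_linfty_norm (s - z) k) sz.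
rewrite linfty_seqB; have := ler_normD (linfty_seq s k - linfty_seq z k) (linfty_seq z k).
by rewrite subrK; lra.
Qed.

Lemma complete_of_geometric (Z : normedModType R) :
    (forall u : nat -> Z, (forall m, `|u m.+1 - u m| < 2^-1 ^+ m) ->
       exists l, forall m, `|u m - l| <= 2 * 2^-1 ^+ m) ->
  seq_complete Z.
Proof.
move=> h u cu; have p0 m : 0 < 2^-1 ^+ m :> R by rewrite exprn_gt0.
have /choice[N NP] : forall j, exists N, forall m n, (N <= m)%N -> (N <= n)%N ->
    `|u m - u n| < 2^-1 ^+ j by move=> j; exact: cu.
pose M j := (\max_(i < j.+1) N i)%N.
have NM i j : (i <= j)%N -> (N i <= M j)%N.
  move=> ij.
  exact: (@leq_bigmax _ (fun i : 'I_j.+1 => N i) (Ordinal (ij : (i < j.+1)%N))).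
have [l lP] := h (fun j => u (M j)) (fun m => NP m _ _ (NM _ _ (leqnSn m)) (NM _ _ (leqnn m))).
exists l => e e0; have [J JP] := half_power_lt (divr_gt0 e0 (ltr0n R 3)).
exists (M J) => n Mn; rewrite -(subrK (u (M J)) (u n)) -addrA.
rewrite (le_lt_trans (ler_normD _ _))//.
have := NP J n (M J) (leq_trans (NM _ _ (leqnn J)) Mn) (NM _ _ (leqnn J)).
by have := lP J; have := JP J (leqnn J); lra.
Qed.

(** Along a fast Cauchy sequence the representatives can be chosen uniformly close,
    and then the diagonal represents the limit: the spaces E n themselves need not be
    complete. *)
Lemma dirlim_ambient_complete : seq_complete A.
Proof.
apply: complete_of_geometric => u uu.
have [t tP] : exists t : nat -> L, forall n, u n = cls (t n) /\
    `|t n.+1 - t n| < 2^-1 ^+ n.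
  apply: (@indexed_choice _ (fun n t => u n = cls t) (fun n t t' => `|t' - t| < 2^-1 ^+ n)).
    by have [s ->] := to_quot_surj (u 0%N); exists s.
  move=> n t un; have [s us] := to_quot_surj (u n.+1).
  have := uu n; rewrite un us -raddfB => /cls_norm_lt[z z0 szt].
  exists (s - z); split; last by rewrite addrAC.
  apply/to_quot_eq; rewrite opprB addrCA subrr addr0.
  apply/le_anti; rewrite seminorm_ge0 andbT.
  have z0' : subspace_set (c0_subspace E) z by [].
  rewrite /=; apply: (@le_trans _ _ `|z - z|); last by rewrite subrr normr0.
  by apply: ge_inf; [exists 0 => _ [y _ <-]|exists z].
have td m n k : (m <= n)%N ->
    `|linfty_seq (t n) k - linfty_seq (t m) k| <= 2 * 2^-1 ^+ m - 2 * 2^-1 ^+ n.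
  move=> /subnKC <-; elim: (n - m)%N => [|d IH]; first by rewrite addn0 !subrr normr0.
  have := le_trans (le_linfty_norm (t (m + d).+1 - t (m + d)%N) k) (ltW (proj2 (tP _))).
  rewrite addnS linfty_seqB => h.
  rewrite -(subrK (linfty_seq (t (m + d)%N) k) (linfty_seq _ k)) -addrA.
  by rewrite (le_trans (ler_normD _ _))// (le_trans (lerD h IH))// exprS; lra.
have p0 m : 0 < 2^-1 ^+ m :> R by rewrite exprn_gt0.
pose s : seq_prod E := fun k => linfty_seq (t k) k.
have sb : bounded_seqs s.
  exists (`|t 0%N| + 2) => k; have h := td 0%N k k (leq0n k).
  have := ler_normD (linfty_seq (t k) k - linfty_seq (t 0%N) k) (linfty_seq (t 0%N) k).
  rewrite subrK -/(s k); have := le_linfty_norm (t 0%N) k; have := p0 k.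
  by rewrite expr0 in h; lra.
exists (cls (mk_linfty sb)) => m; rewrite (proj1 (tP m)) -raddfB.
apply: (@cls_norm_le _ m) => [|k mk]; first by rewrite mulr_ge0// ltW.
rewrite linfty_seqB distrC {1}/linfty_seq/= (le_trans (td _ _ _ mk))//.
by have := p0 k; lra.
Qed.

End AmbientSpace.

Section Limit.
Context {R : realType} (E : nat -> normedModType R) (f : forall n, {linear E n -> E n.+1}).

(** The first terms of an orbit live in spaces with another index; casting by a decided
    equality of indices allows a definition by recursion on the place alone. *)
Definition cast_at n k (x : E n) : E k :=
  if pselect (n = k) is left e then ecast i (E i) e x else 0.

Lemma cast_at_eq n (x : E n) : cast_at n x = x.
Proof.
by rewrite /cast_at; case: pselect => // e; rewrite (eq_irrelevance e erefl).
Qed.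

Lemma cast_at_neq n k (x : E n) : n != k -> cast_at k x = 0.
Proof. by move=> /eqP nk; rewrite /cast_at; case: pselect. Qed.

Fact cast_at_is_linear n k : linear (@cast_at n k).
Proof.
move=> a x y; rewrite /cast_at; case: pselect => [e|_]; last by rewrite scaler0 addr0.
by case: _ / e.
Qed.

Fixpoint orbit_fix n (x : E n) k : E k :=
  if k is k'.+1 then cast_at k'.+1 x + f k' (orbit_fix x k') else cast_at 0 x.

Definition orbit_of n (x : E n) : seq_prod E := orbit_fix x.

Lemma orbit_lt n (x : E n) k : (k < n)%N -> orbit_of x k = 0.
Proof.
rewrite /orbit_of; elim: k => [|k IH] kn /=; first by rewrite cast_at_neq ?gtn_eqF.
by rewrite cast_at_neq ?gtn_eqF// IH ?raddf0 ?addr0// ltnW.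
Qed.

Lemma orbit_eq n (x : E n) : orbit_of x n = x.
Proof.
case: n x => [|n] x; first exact: cast_at_eq.
by rewrite /orbit_of/= cast_at_eq -/(orbit_of x n) orbit_lt// raddf0 addr0.
Qed.

Lemma orbitS n (x : E n) k : (n <= k)%N -> orbit_of x k.+1 = f k (orbit_of x k).
Proof. by move=> nk; rewrite /orbit_of/= cast_at_neq ?add0r// ltn_eqF. Qed.

Lemma orbit_linear n k : linear (fun x : E n => orbit_of x k).
Proof.
move=> a x y; rewrite /orbit_of; elim: k => [|k IH]/=; first exact: cast_at_is_linear.
by rewrite IH linearP cast_at_is_linear scalerDr addrACA.
Qed.

Lemma orbit_step n (x : E n) k : (n < k)%N -> orbit_of (f n x) k = orbit_of x k.
Proof.
elim: k => // k IH; rewrite ltnS leq_eqVlt => /predU1P[<-|nk].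
  by rewrite orbit_eq orbitS// orbit_eq.
by rewrite orbitS// IH// orbitS// ltnW.
Qed.

Lemma orbit_seqP n (x : E n) (s : linfty E) : orbit_seq f x s <-> linfty_seq s = orbit_of x.
Proof.
split=> [[s0 sd]|sx]; last rewrite /orbit_seq sx.
  apply/functional_extensionality_dep => k.
  case: (ltnP k n) => [kn|nk]; first by rewrite s0// orbit_lt.
  rewrite -(subnK nk) sd; elim: (k - n)%N => [|d IH] /=; first by rewrite orbit_eq.
  by rewrite IH cast_at_neq ?add0r// ltn_eqF// ltnS leq_addl.
split=> [k|d]; first exact: orbit_lt.
elim: d => [|d IH] /=; first exact: orbit_eq.
by rewrite -IH cast_at_neq ?add0r// ltn_eqF// ltnS leq_addl.
Qed.

Context (eps : nat -> R) (fE : forall n, Emb (eps n) (f n)) (eps_ge0 : forall n, 0 <= eps n).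

Lemma orbit_bounds n (x : E n) k : (n <= k)%N ->
  expR (- \sum_(n <= i < k) eps i) * `|x| <= `|orbit_of x k| <=
    expR (\sum_(n <= i < k) eps i) * `|x|.
Proof.
elim: k => [|k IH]; rewrite leq_eqVlt => /predU1P[nk|nk]//.
- by subst n; rewrite orbit_eq big_geq// oppr0 expR0 mul1r lexx.
- by subst n; rewrite orbit_eq big_geq// oppr0 expR0 mul1r lexx.
rewrite ltnS in nk *; have /andP[h1 h2] := IH nk.
rewrite orbitS// big_nat_recr//= opprD !expRD; apply/andP; split.
  rewrite (le_trans _ (Emb_ge _ (@fE k)))// mulrAC mulrC.
  by rewrite ler_wpM2l ?expR_ge0// mulrC.
rewrite (le_trans (Emb_le _ (@fE k)))// mulrAC [leRHS]mulrC.
by rewrite ler_wpM2l ?expR_ge0// mulrC.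
Qed.

Context (B : R) (epsB : forall m, \sum_(0 <= i < m) eps i <= B).

Lemma eps_sum_le n m : \sum_(n <= i < m) eps i <= B.
Proof.
apply: le_trans (epsB m); case: (leqP n m) => nm; last first.
  by rewrite big_geq ?sumr_ge0// ltnW.
by rewrite (big_cat_nat (leq0n n) nm)/= lerDr sumr_ge0.
Qed.

Lemma orbit_bounded n (x : E n) : bounded_seqs (orbit_of x).
Proof.
exists (expR B * `|x|) => k; case: (ltnP k n) => [kn|nk].
  by rewrite orbit_lt// normr0 mulr_ge0// expR_ge0.
have /andP[_ /le_trans] := orbit_bounds x nk; apply.
by rewrite ler_wpM2r// ler_expR eps_sum_le.
Qed.

Definition to_limit_fun n (x : E n) : dirlim_ambient E :=
  to_quot (dist_seminorm (c0_subspace E)) (mk_linfty (orbit_bounded x)).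

Fact to_limit_is_linear n : linear (@to_limit_fun n).
Proof.
move=> a x y; rewrite /to_limit_fun -linearP; congr to_quot.
apply: val_inj; apply/functional_extensionality_dep => k; exact: orbit_linear.
Qed.

HB.instance Definition _ n :=
  GRing.isLinear.Build R (E n) (dirlim_ambient E) _ (@to_limit_fun n) (@to_limit_is_linear n).

Definition to_limit n : {linear E n -> dirlim_ambient E} := @to_limit_fun n.

Lemma to_limitS n (x : E n) : to_limit n.+1 (f n x) = to_limit n x.
Proof.
apply/eqP; rewrite -subr_eq0 -normr_le0 /to_limit/= /to_limit_fun -raddfB.
apply: (@cls_norm_le _ _ _ n.+1) => // k nk.
by rewrite linfty_seqB /linfty_seq/= orbit_step// subrr normr0.
Qed.

Lemma to_limit_orbit n (x : E n) m : (n <= m)%N -> to_limit m (orbit_of x m) = to_limit n x.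
Proof.
elim: m => [|m IH]; rewrite leq_eqVlt => /predU1P[nm|nm]//.
- by subst n; rewrite orbit_eq.
- by subst n; rewrite orbit_eq.
by rewrite ltnS in nm *; rewrite orbitS// to_limitS IH.
Qed.

Lemma to_limit_Emb n T : (forall m, \sum_(n <= i < m) eps i <= T) -> Emb T (to_limit n).
Proof.
move=> hT x; apply/andP; split.
  apply: (@cls_norm_ge _ _ _ n) => k nk; have /andP[h _] := orbit_bounds x nk.
  by apply: le_trans h; rewrite ler_wpM2r// ler_expR lerN2.
apply: (@cls_norm_le _ _ _ n) => [|k nk]; first by rewrite mulr_ge0// expR_ge0.
have /andP[_ h] := orbit_bounds x nk.
by apply: (le_trans h); rewrite ler_wpM2r// ler_expR.
Qed.

Lemma dirlimP y : dirlim f y <-> forall e, 0 < e ->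
  exists n (x : E n), `|y - to_limit n x| < e.
Proof.
split=> [cy e e0|h].
  have [z [[n _ [x [s [/orbit_seqP sx ->]]]]]] := cy _ (nbhsx_ballx y e e0).
  rewrite -ball_normE/= => yz; exists n, x.
  rewrite (_ : to_limit n x = to_quot (dist_seminorm (c0_subspace E)) s)//.
  congr to_quot; apply: val_inj; exact/esym/sx.
move=> U /nbhs_ballP[e /= e0 eU]; have [n [x yx]] := h e e0.
exists (to_limit n x); split; last by apply: eU; rewrite -ball_normE.
by exists n => //; exists x, (mk_linfty (orbit_bounded x)); split=> //; exact/orbit_seqP.
Qed.

Lemma dirlim_to_limit n (x : E n) : dirlim f (to_limit n x).
Proof. by apply/dirlimP => e e0; exists n, x; rewrite subrr normr0. Qed.

Lemma to_limit_lcp (y : nat -> dirlim_ambient E) (p : {poly R}) :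
    (forall i, exists n (x : E n), y i = to_limit n x) ->
  exists n (x : E n), lcp y p = to_limit n x.
Proof.
move=> h; rewrite /lcp; elim/big_ind : _ => [|a b|i _].
- by exists 0%N, 0; rewrite raddf0.
- move=> [n [x ->]] [m [z ->]]; exists (maxn n m).
  exists (orbit_of x (maxn n m) + orbit_of z (maxn n m)).
  by rewrite raddfD/= !to_limit_orbit ?leq_maxl ?leq_maxr.
- by have [n [x ->]] := h i; exists n, (p`_i *: x); rewrite linearZ.
Qed.

(** To identify X with the limit it is enough to compare a sequence with dense span in
    X with a sequence of elements coming from the spaces E n. *)
Theorem isometric_onto_dirlim (X : normedModType R) (x : nat -> X)
    (y : nat -> dirlim_ambient E) : seq_complete X -> dense_span x ->
    (forall p, `|lcp x p| = `|lcp y p|) ->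
    (forall i, exists n (z : E n), y i = to_limit n z) ->
    (forall n (z : E n) e, 0 < e -> exists p, `|to_limit n z - lcp y p| < e) ->
  isometric_onto X (dirlim f).
Proof.
move=> Xc xd xy yl ly.
have [T [iT Tx]] := isometry_extension (@dirlim_ambient_complete R E) xd xy.
exists T; split=> //; apply/seteqP; split=> [_ [w _ <-]|w /dirlimP wl].
  apply/dirlimP => e e0; have [p wp] := xd w e e0.
  have [n [z pz]] := to_limit_lcp p yl; exists n, z; rewrite -pz.
  by rewrite -(eq_lcp (leqnn _) (fun i _ => Tx i)) -lcp_map -raddfB iT.
have [u ->] : exists u, w = T u; last by exists u.
apply: (isometry_range_closed Xc iT) => e e0; have e20 := divr_gt0 e0 (ltr0n R 2).
have [n [z wz]] := wl _ e20; have [p zp] := ly n z _ e20; exists (lcp x p).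
rewrite lcp_map (eq_lcp (leqnn _) (fun i _ => Tx i)).
rewrite -(subrK (to_limit n z) w) -addrA (le_lt_trans (ler_normD _ _))//.
by rewrite (splitr e) ltrD.
Qed.

End Limit.

(** * Strategies and runs *)

Section Strategies.
Context {R : realType} (X : normedModType R).

Definition position_age n E eps (p : position X n E eps) : Age_cl X E :=
  match p with FirstMove o => opening_age o | NextMove _ _ _ _ m => move_age m end.

Definition position_eps n E eps (p : position X n E eps) : 0 < eps :=
  match p with FirstMove o => opening_eps_gt0 o | NextMove _ _ _ _ m => move_eps_gt0 m end.

Lemma half_lt (e : R) : 0 < e -> e / 2 < e.
Proof. by lra. Qed.

Lemma half_gt0 (e : R) : 0 < e -> 0 < e / 2.
Proof. by lra. Qed.

(** A move that is always legal, so that a partially described strategy can be completed. *)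
Definition stay E eps (aE : Age_cl X E) (eps0 : 0 < eps) : game_move X E eps :=
  Move aE (@Emb_id R E eps (ltW eps0)) (half_gt0 eps0) (half_lt eps0).

Definition pick (T : Type) (t0 : T) (P : T -> Prop) : T :=
  if pselect (exists t, P t) is left e then projT1 (cid e) else t0.

Lemma pickP (T : Type) (t0 : T) (P : T -> Prop) : (exists t, P t) -> P (pick t0 P).
Proof. by rewrite /pick; case: pselect => // e _; case: (cid e). Qed.

(** A strategy that speaks for both players determines the run; stages package the
    positions, whose types depend on the moves played. *)
Section Play.
Context (o : opening X) (u : strategy X).

Record stage n := Stage {
  stage_space : normedModType R ; stage_eps : R ;
  stage_position : position X n.+1 stage_space stage_eps }.

(* The moves are rebuilt from their projections so that the moves of the run below
   are convertible to them. *)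
Definition stage_move n (s : stage n) : game_move X (stage_space s) (stage_eps s) :=
  let m := u (stage_position s) in
  Move (move_age m) (@move_emb _ _ _ _ m) (move_eps_gt0 m) (move_eps_lt m).

Definition first_stage : stage 0 :=
  Stage (FirstMove (Opening (opening_age o) (opening_eps_gt0 o))).

Definition next_stage n (s : stage n) : stage n.+1 :=
  Stage (NextMove (stage_position s) (stage_move s)).

Fixpoint play_stage n : stage n :=
  if n is k.+1 then next_stage (play_stage k) else first_stage.

Definition play_run : run X := @Run R X
  (fun n => stage_space (play_stage n))
  (fun n => move_map (stage_move (play_stage n)))
  (fun n => stage_eps (play_stage n))
  (fun n => position_age (stage_position (play_stage n)))
  (fun n => @move_emb _ _ _ _ (stage_move (play_stage n)))
  (fun n => position_eps (stage_position (play_stage n)))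
  (fun n => move_eps_lt (stage_move (play_stage n))).

Lemma play_run_position n : run_position play_run n = stage_position (play_stage n).
Proof. by elim: n => [|n IH] //=; rewrite IH. Qed.

Lemma play_run_opening : run_opening play_run = o.
Proof. by rewrite /run_opening/=; case: o. Qed.

Lemma play_run_follows n : run_move play_run n = u (run_position play_run n).
Proof.
rewrite play_run_position; rewrite -[LHS]/(stage_move (play_stage n)) /stage_move.
by case: (u _).
Qed.

End Play.

(** Otherwise the two strategies, played against each other, produce a run that both
    players win. *)
Lemma winning_II_not_I : II_has_winning_strategy X -> ~ I_has_winning_strategy X.
Proof.
move=> [s sw] [op [t tw]].
pose u : strategy X := fun n E eps p => if odd n then s n E eps p else t n E eps p.
apply: (tw (play_run op u)).
  split; first exact: play_run_opening.
  by move=> n on; rewrite play_run_follows /u /= on.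
by apply: sw => n on; rewrite play_run_follows /u /= on.
Qed.

(** A position records the moves and not the reasons for them. The data D is recomputed
    from the position, with the same choices, which gives a strategy in the sense
    of the game out of a construction that carries data along: I is the invariant
    and T relates the data of consecutive positions. *)
Lemma strategy_with_data (D : normedModType R -> Type) (d0 : forall E, D E)
    (I : nat -> forall E, R -> D E -> Prop)
    (T : nat -> forall E eps, D E -> forall m : game_move X E eps, D (move_space m) -> Prop) :
    (forall o : opening X, exists d, I 0%N (opening_space o) (opening_eps o) d) ->
    (forall n E eps d (m : game_move X E eps), odd n -> I n E eps d ->
      exists d', I n.+1 (move_space m) (move_eps m) d' /\ T n E eps d m d') ->
    (forall n E eps d, Age_cl X E -> 0 < eps -> ~~ odd n -> I n E eps d ->
      exists (m : game_move X E eps) d',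
        I n.+1 (move_space m) (move_eps m) d' /\ T n E eps d m d') ->
  exists s : strategy X, forall r, follows_II s r ->
    exists d : forall n, D (run_space r n), forall n,
      I n (run_space r n) (run_eps r n) (d n) /\
      T n (run_space r n) (run_eps r n) (d n) (run_move r n) (d n.+1).
Proof.
move=> h0 hI hII.
pose good n E eps d (m : game_move X E eps) d' :=
  I n.+1 (move_space m) (move_eps m) d' /\ T n E eps d m d'.
pose st := fix st n E eps (p : position X n E eps) : D E :=
  match p in position _ n' E' eps' return D E' with
  | FirstMove o => pick (d0 _) (fun d => I 0%N (opening_space o) (opening_eps o) d)
  | NextMove k F e q m => pick (d0 _) (fun d' => good k.-1 F e (st k F e q) m d')
  end.
pose s : strategy X := fun n E eps p =>
  pick (stay (position_age p) (position_eps p))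
    (fun m => exists d', good n.-1 E eps (st n E eps p) m d').
exists s => r rs; exists (fun n => st _ _ _ (run_position r n)).
have step n : I n (run_space r n) (run_eps r n) (st _ _ _ (run_position r n)) ->
    good n _ _ (st _ _ _ (run_position r n)) (run_move r n) (st _ _ _ (run_position r n.+1)).
  move=> In; have : exists d', good n _ _ (st _ _ _ (run_position r n)) (run_move r n) d'.
    case: (boolP (odd n)) => on; first exact: hI.
    rewrite (rs n on) /s.
    exact: (@pickP _ _ (fun m => exists d', good n _ _ (st _ _ _ (run_position r n)) m d')
      (hII n _ _ _ (run_age r n) (run_eps_gt0 r n) on In)).
  exact: (@pickP _ _ (fun d' => good n _ _ (st _ _ _ (run_position r n)) (run_move r n) d')).
have In n : I n (run_space r n) (run_eps r n) (st _ _ _ (run_position r n)).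
  elim: n => [|n IH]; last by have [] := step n IH.
  exact: (@pickP _ _ (fun d => I 0%N _ _ d) (h0 (run_opening r))).
by move=> n; split=> //; have [] := step n (In n).
Qed.

End Strategies.

(** * A winning strategy for Player I when weak amalgamation fails *)

Section EpsilonSums.
Context {R : realType} (eps : nat -> R).
Hypothesis eps_gt0 : forall n, 0 < eps n.
Hypothesis eps_lt : forall n, eps n.+1 < eps n.

(** Halving every second term is enough to control the sum of a decreasing
    sequence. *)
Lemma halving_sum k m : (forall d, eps (k + d.*2).+2 <= eps (k + d.*2)%N / 2) ->
  \sum_(k <= i < m) eps i <= 4 * eps k.
Proof.
move=> h; suff H d : \sum_(k <= i < k + d.*2) eps i <= 4 * eps k - 4 * eps (k + d.*2)%N.
  apply: (@le_trans _ _ (\sum_(k <= i < k + m.*2) eps i)); last first.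
    by apply: (le_trans (H m)); rewrite gerBl mulr_ge0// ltW.
  case: (leqP k m) => km; last first.
    by rewrite (big_geq (ltnW km)) sumr_ge0// => i _; exact: ltW.
  have mk : (m <= k + m.*2)%N.
    by rewrite -addnn (leq_trans (leq_addr m m))// leq_addl.
  by rewrite (big_cat_nat km mk)/= lerDl sumr_ge0// => i _; exact: ltW.
elim: d => [|d IH]; first by rewrite addn0 big_geq// subrr.
rewrite doubleS !addnS !big_nat_recr/= ?leqW ?leq_addr//.
have := h d; have := eps_lt (k + d.*2)%N; lra.
Qed.

Lemma halving_small k (e : R) : (forall d, eps (k + d.*2).+2 <= eps (k + d.*2)%N / 2) ->
  0 < e -> exists d0, forall d, (d0 <= d)%N -> eps (k + d.*2)%N < e.
Proof.
move=> h e0; have H d : eps (k + d.*2)%N <= eps k * 2^-1 ^+ d.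
  elim: d => [|d IH]; first by rewrite addn0 expr0 mulr1.
  rewrite doubleS !addnS exprS; apply: (le_trans (h d)); move: IH.
  by rewrite mulrCA; lra.
have [N NP] := half_power_lt (divr_gt0 e0 (eps_gt0 k)); exists N => d /NP hd.
by apply: (le_lt_trans (H d)); rewrite mulrC -ltr_pdivlMr.
Qed.

End EpsilonSums.

Lemma isometric_lift (R : realType) (E X Z : normedModType R) (T : {linear X -> Z})
    (g : {linear E -> Z}) : isometric_embedding T -> (forall z, exists u, T u = g z) ->
  exists i : {linear E -> X}, forall z, T (i z) = g z.
Proof.
move=> iT /choice[i iP].
have Tinj u v : T u = T v -> u = v.
  by move=> uv; apply/eqP; rewrite -subr_eq0 -normr_eq0 -iT raddfB/= uv subrr normr0.
have il : linear i by move=> a u v; apply: Tinj; rewrite linearP/= !iP linearP.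
pose I : {linear E -> X} := HB.pack i (GRing.isLinear.Build R E X _ i il).
by exists I.
Qed.

(** Bounded vectors have bounded coefficients in a basis, and these have a finite
    rational net. *)
Lemma finite_dim_net (R : realType) (F : normedModType R) n (M t : R) : finite_dim F ->
    0 < M -> 0 < t -> exists q (z : nat -> nat -> F), forall y : nat -> F,
  (forall i, (i < n)%N -> `|y i| <= M) ->
  exists2 j, (j < q)%N & forall i, (i < n)%N -> `|y i - z j i| <= t.
Proof.
move=> /basis_exists[m [b [K [_ bs K0 bK]]]] M0 t0.
have [C C0 bC] := finite_bound (fun i => `|b i|) m.
have KM0 : 0 < K * M by rewrite mulr_gt0.
have s0 : 0 < t / (K * M * C) by rewrite divr_gt0// mulr_gt0.
have [S SP] := rational_net m s0.
pose w (v : {poly rat}) : F := (K * M) *: lcp b (rat_c00 v).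
have net (x : F) : `|x| <= M -> exists2 v, v \in S & `|x - w v| <= t.
  move=> xM; have [p pm xp] := bs x; pose c := (K * M)^-1.
  have c0 : 0 < c by rewrite invr_gt0.
  have [||v [vS vm pv]] := SP (c *: p).
  - exact: leq_trans (size_scale_leq _ _) pm.
  - rewrite l1Z gtr0_norm// ler_pdivrMl// mulr1 (le_trans (bK p pm))// -xp.
    by rewrite ler_wpM2l// ltW.
  exists v => //; have -> : x = (K * M) *: lcp b (c *: p).
    by rewrite linearZ/= scalerA mulfV ?gt_eqF// scale1r.
  rewrite /w -scalerBr -raddfB normrZ gtr0_norm//.
  have sz : (size (c *: p - rat_c00 v)%R <= m)%N.
    rewrite (leq_trans (size_polyD _ _))// size_polyN geq_max.
    by rewrite (leq_trans (size_scale_leq _ _) pm) (leq_trans (size_rat_c00 _) vm).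
  rewrite -ler_pdivlMl// (le_trans (norm_lcp_le sz bC))//.
  by rewrite -ler_pdivlMr// (le_trans pv)// (invfM (K * M)) mulrA (mulrC t).
pose z (f : {ffun 'I_n -> 'I_(size S).+1}) (i : nat) : F :=
  if insub i is Some k then w (nth 0 S (f k)) else 0.
exists #|{ffun 'I_n -> 'I_(size S).+1}|, (fun j => z (nth [ffun=> ord0] (enum {ffun 'I_n -> 'I_(size S).+1}) j)).
move=> y yM; have /choice[g gP] : forall i : 'I_n, exists k : 'I_(size S).+1,
    `|y i - w (nth 0 S k)| <= t.
  move=> i; have [v vS h] := net _ (yM i (ltn_ord i)).
  have vi : (index v S < (size S).+1)%N by rewrite ltnS index_size.
  by exists (Ordinal vi); rewrite /= nth_index.
pose f : {ffun 'I_n -> 'I_(size S).+1} := [ffun i => g i].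
exists (index f (enum {ffun 'I_n -> 'I_(size S).+1})).
  by rewrite cardE index_mem mem_enum.
move=> i iN; rewrite nth_index ?mem_enum// /z insubT/= ffunE.
exact: (gP (Ordinal iN)).
Qed.

Section PlayerIStrategy.
Context {R : realType} (X : completeNormedModType R).
Context (E : subspace_of X) (e : R) (fE : finite_dim (subspace_type E)) (e0 : 0 < e).
Local Notation ET := (subspace_type E).

(** No weak amalgamation over F for the embeddings of E in F: the continuation
    (G, psi) and the precision eta defeat phi. *)
Definition defeats (F G : normedModType R) (phi : {linear ET -> F}) (psi : {linear F -> G}) (eta r : R) : Prop :=
  forall i : {linear G -> X}, Emb eta i ->
    ~ (forall x : ET, `|subspace_val x - i (psi (phi x))| <= r * `|x|).

(* The bound 3/4 e lies between the norm e, for which the guarded condition fails,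
   and the bound e/2 used in the game; the difference absorbs the mesh of a net. *)
Hypothesis bad : forall (F : normedModType R) (phi : {linear ET -> F}) (delta : R),
  Age_cl X F -> Emb e phi -> 0 < delta ->
  exists (G : normedModType R) (psi : {linear F -> G}) (eta : R),
    [/\ Age_cl X G, Emb delta psi, 0 < eta & defeats phi psi eta (3 / 4 * e)].

(** A single continuation defeats all the embeddings: one defeats successively a
    finite net of embeddings, which is possible as each continuation is almost
    isometric over the preceding ones. *)
Lemma defeat_all (F : normedModType R) delta : Age_cl X F -> 0 < delta ->
  exists (G : normedModType R) (psi : {linear F -> G}) (eta : R),
    [/\ Age_cl X G, Emb delta psi, 0 < eta &
      forall phi : {linear ET -> F}, Emb (e / 2) phi -> defeats phi psi eta (e / 2)].
Proof.
move=> aF d0; have [n [b [K [_ bs K0 bK]]]] := basis_exists fE.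
have [B B0 bB] := finite_bound (fun i => `|b i|) n.
have M0 : 0 < expR (e / 2) * B by rewrite mulr_gt0// expR_gt0.
pose t := e / 4 / (2 * K * expR (1 + 1)).
have c0 : 0 < 2 * K * expR (1 + 1) by rewrite !mulr_gt0// expR_gt0.
have t0 : 0 < t by rewrite !divr_gt0.
have [q [z zP]] := finite_dim_net n (proj1 aF) M0 t0.
suff H k delta' : 0 < delta' -> delta' <= 1 -> delta' <= e / 2 ->
    exists (G : normedModType R) (psi : {linear F -> G}) (eta : R),
    [/\ Age_cl X G, Emb delta' psi, 0 < eta, eta <= 1 & forall phi : {linear ET -> F},
      Emb (e / 2) phi ->
      forall j, (j < k)%N -> (forall i, (i < n)%N -> `|phi (b i) - z j i| <= t) ->
      defeats phi psi eta (e / 2)].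
  have m0 : 0 < Num.min delta (Num.min 1 (e / 2)) by rewrite !lt_min d0 ltr01 divr_gt0.
  have [| |G [psi [eta [aG psid eta0 _ h]]]] := H q _ m0.
  - by rewrite !ge_min lexx orbT.
  - by rewrite !ge_min lexx !orbT.
  exists G, psi, eta; split=> //.
    by apply: Emb_mono psid; rewrite ge_min lexx.
  move=> phi ephi; have [|j jq zj] := zP (fun i => phi (b i)); last exact: h jq zj.
  move=> i iN; apply: (le_trans (Emb_le _ ephi)).
  by rewrite ler_wpM2l ?expR_ge0// bB.
elim: k delta' => [|k IH] delta' d'0 d'1 d'e.
  exists F, idfun, 1; split=> //; exact: Emb_id (ltW d'0).
have d'20 : 0 < delta' / 2 by rewrite divr_gt0.
have [| |G1 [psi1 [eta1 [aG1 psi1d eta10 eta11 h1]]]] := IH _ d'20; [lra|lra|].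
have [[phik ephik zk]|nphi] := pselect (exists2 phi : {linear ET -> F}, Emb (e / 2) phi &
    forall i, (i < n)%N -> `|phi (b i) - z k i| <= t); last first.
  exists G1, psi1, eta1; split=> //; first by apply: Emb_mono psi1d; lra.
  move=> phi ephi j; rewrite ltnS leq_eqVlt => /predU1P[->|jk] zj; last exact: h1 jk zj.
  by exfalso; apply: nphi; exists phi.
have m0 : 0 < Num.min (delta' / 2) (eta1 / 2) by rewrite lt_min d'20 divr_gt0.
have phi1 : Emb e (psi1 \o phik)%FUN by apply: Emb_comp_le ephik psi1d; lra.
have [G2 [psi2 [eta2 [aG2 psi2d eta20 h2]]]] := bad aG1 phi1 m0.
have m1 : Num.min (delta' / 2) (eta1 / 2) <= delta' / 2 by rewrite ge_min lexx.
have m2 : Num.min (delta' / 2) (eta1 / 2) <= eta1 / 2 by rewrite ge_min lexx orbT.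
have psi21 : Emb delta' (psi2 \o psi1)%FUN by apply: Emb_comp_le psi1d psi2d; lra.
exists G2, (psi2 \o psi1)%FUN, (Num.min eta2 (eta1 / 2)).
have m3 : Num.min eta2 (eta1 / 2) <= eta1 / 2 by rewrite ge_min lexx orbT.
split=> //; [by rewrite lt_min eta20 divr_gt0|lra|].
move=> phi ephi j; rewrite ltnS leq_eqVlt => /predU1P[->|jk] zj i ei hi; last first.
  have ei2 : Emb eta1 (i \o psi2)%FUN by apply: Emb_comp_le psi2d ei; lra.
  exact: (h1 phi ephi j jk zj _ ei2 hi).
apply: (h2 i) => [|x]; first by apply: Emb_mono ei; rewrite ge_min lexx.
have [p pn xp] := bs x.
have d1 : `|phi x - phik x| <= 2 * t * (K * `|x|).
  have -> : phi x - phik x = lcp (fun l => phi (b l) - phik (b l)) p.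
    by rewrite xp (lcp_map phi) (lcp_map phik) lcpB.
  have bt l : (l < n)%N -> `|phi (b l) - phik (b l)| <= 2 * t.
    move=> ln; rewrite -(subrK (z k l) (phi (b l))) -addrA.
    rewrite (le_trans (ler_normD _ _))//; have := zj l ln; have := zk l ln.
    by rewrite (distrC (phik _)); lra.
  rewrite (le_trans (norm_lcp_le pn bt))// mulrC ler_wpM2l//; first by rewrite mulr_ge0// ltW.
  by rewrite xp bK.
have ei21 : Emb (1 + 1) (i \o (psi2 \o psi1))%FUN by apply: Emb_comp_le psi21 ei; lra.
have d2 : `|i (psi2 (psi1 (phi x - phik x)))| <= e / 4 * `|x|.
  apply: (le_trans (Emb_le _ ei21)).
  apply: (@le_trans _ _ (expR (1 + 1) * (2 * t * (K * `|x|)))).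
    by rewrite ler_wpM2l ?expR_ge0.
  have -> : expR (1 + 1) * (2 * t * (K * `|x|)) = t * (2 * K * expR (1 + 1)) * `|x| by ring.
  by rewrite /t divfK// gt_eqF.
have -> : subspace_val x - i (psi2 ((psi1 \o phik)%FUN x)) =
    (subspace_val x - i (psi2 (psi1 (phi x)))) + i (psi2 (psi1 (phi x - phik x))).
  by rewrite !raddfB/= addrA subrK.
rewrite (le_trans (ler_normD _ _))//; have := hi x; rewrite /= => hx.
by apply: (le_trans (lerD hx d2)); rewrite -mulrDl ler_wpM2r//; lra.
Qed.

(** Player I also shrinks eps so much that the limit map from the new space, whose
    distortion is at most 4 eps, is among the embeddings that are defeated. *)
Definition good_move (F : normedModType R) eps (m : game_move X F eps) : Prop :=
  move_eps m <= eps / 2 /\ forall phi : {linear ET -> F}, Emb (e / 2) phi ->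
    defeats phi (move_map m) (4 * move_eps m) (e / 2).

Lemma good_move_exists (F : normedModType R) eps : Age_cl X F -> 0 < eps -> exists m : game_move X F eps, good_move m.
Proof.
move=> aF eps0; have [G [psi [eta [aG psid eta0 h]]]] := defeat_all aF eps0.
pose eps' := Num.min (eps / 2) (eta / 4).
have eps'0 : 0 < eps' by rewrite lt_min !divr_gt0.
have eps'1 : eps' <= eps / 2 by rewrite ge_min lexx.
have eps'2 : eps' <= eta / 4 by rewrite ge_min lexx orbT.
have eps'lt : eps' < eps by lra.
exists (Move aG psid eps'0 eps'lt); split=> //= phi ephi i ei; apply: (h phi ephi).
by apply: Emb_mono ei; lra.
Qed.

(** If the limit were isometric to X, the copy of E in it would be approximated by
    an embedding in some space of the run, which the next move of Player I has
    defeated. *)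
Lemma good_run_not_won (r : run X) : (forall n, odd n -> good_move (run_move r n)) -> ~ wins_II r.
Proof.
move=> good [_ [T [iT rT]]].
have eps0 n := run_eps_gt0 r n; have epsS n := run_eps_lt r n.
have half k d : ~~ odd k -> run_eps r (k + d.*2).+2 <= run_eps r (k + d.*2)%N / 2.
  move=> ok; have od : odd (k + d.*2).+1 by rewrite /= oddD odd_double addbF.
  by have [/= h _] := good _ od; have := epsS (k + d.*2)%N; lra.
have tail k m : ~~ odd k -> \sum_(k <= i < m) run_eps r i <= 4 * run_eps r k.
  by move=> ok; apply: halving_sum => // d; exact: half.
have eps_ge n : 0 <= run_eps r n := ltW (eps0 n).
have epsB m := tail 0%N m isT.
pose lim n : {linear run_space r n -> _} := to_limit (@run_emb _ _ r) eps_ge epsB n.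
have [n [b [K [bi bs K0 bK]]]] := basis_exists fE.
have e40 : 0 < e / 4 by rewrite divr_gt0.
have [t1 t10 t1E] := Emb_of_dist e40.
pose t := Num.min t1 (e / 2); have t0 : 0 < t by rewrite lt_min t10 divr_gt0.
have /choice[z zP] : forall i, exists z : {m & run_space r m},
    `|T (subspace_val (b i)) - lim (projT1 z) (projT2 z)| < t / K.
  move=> i; have : dirlim (run_map r) (T (subspace_val (b i))).
    by rewrite -rT; exists (subspace_val (b i)).
  move=> /(dirlimP (@run_emb _ _ r) eps_ge epsB)/(_ (t / K)).
  by case=> [|m [y h]]; [rewrite divr_gt0|exists (existT _ m y)].
pose a i := projT1 (z i); pose y i : run_space r (a i) := projT2 (z i).
have [m0 aM] := finite_bound_nat a n.
have e80 : 0 < e / 20 by rewrite divr_gt0.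
have [d0 dP] := halving_small eps0 (fun d => half 0%N d isT) e80.
pose N := (maxn m0 d0).*2.+1.
have oN : odd N by rewrite /N /= odd_double.
have oN1 : ~~ odd N.+1 by rewrite -[odd N.+1]/(~~ odd N) negbK.
have aN i : (i < n)%N -> (a i <= N)%N.
  by move=> /aM h; rewrite (leq_trans h)// /N -addnn leqW// (leq_trans (leq_maxl m0 d0))// leq_addr.
have epsN : run_eps r N < e / 20.
  by apply: lt_trans (epsS _) _; have := dP (maxn m0 d0) (leq_maxr _ _).
have tailN m : \sum_(N <= i < m) run_eps r i <= e / 4.
  case: (ltnP N m) => Nm; last by rewrite big_geq// ltW.
  rewrite big_ltn//; have := tail N.+1 m oN1; by have := epsS N; lra.
have limN := to_limit_Emb (@run_emb _ _ r) eps_ge epsB tailN.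
have [phi phiE] := basis_map (fun i => orbit_of (run_map r) (y i) N) bi bs.
have dist (x : ET) : `|T (subspace_val x) - lim N (phi x)| <= t * `|x|.
  have [p pn xp] := bs x.
  have -> : T (subspace_val x) - lim N (phi x) =
      lcp (fun i => T (subspace_val (b i)) - lim N (orbit_of (run_map r) (y i) N)) p.
    by rewrite xp phiE// (lcp_map (@subspace_val R X E : {linear _ -> _})) (lcp_map T) (lcp_map (lim N)) lcpB.
  have bt i : (i < n)%N -> `|T (subspace_val (b i)) - lim N (orbit_of (run_map r) (y i) N)| <= t / K.
    by move=> iN; rewrite /lim to_limit_orbit ?aN// ltW.
  rewrite (le_trans (norm_lcp_le pn bt))// mulrC mulrAC ler_pdivrMr// -mulrA.
  by rewrite ler_wpM2l ?(ltW t0)// mulrC xp bK.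
have ephi : Emb (e / 2) phi.
  have h : Emb (e / 4) (lim N \o phi)%FUN.
    apply: t1E => x /=; have nx : `|x| = `|T (subspace_val x)| by rewrite iT.
    rewrite {1}nx distrC (le_trans (ler_dist_dist _ _))// (le_trans (dist x))//.
    by rewrite ler_wpM2r// ge_min lexx.
  have e2 : e / 2 = e / 4 + e / 4 by lra.
  move=> x; rewrite e2 expRN expRD invfM; have u0 := expR_gt0 (e / 4).
  have /andP[g1 g2] := h x; have /andP[l1 l2] := limN (phi x).
  rewrite expRN in g1 l1; rewrite -!mulrA ler_pdivrMl// (le_trans g1 l2)/=.
  rewrite ler_pdivrMl// in l1; apply: (le_trans l1); rewrite ler_pM2l//.
have [i iP] : exists i : {linear run_space r N.+1 -> X}, forall z, T (i z) = lim N.+1 z.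
  apply: isometric_lift => // w; have : dirlim (run_map r) (lim N.+1 w).
    exact: dirlim_to_limit.
  by rewrite -rT => -[u _ <-]; exists u.
have ei : Emb (4 * run_eps r N.+1) i.
  have h := to_limit_Emb (@run_emb _ _ r) eps_ge epsB (fun m => tail N.+1 m oN1).
  by move=> z'; rewrite -iT iP; exact: h.
have [_ /(_ phi ephi i ei)] := good N oN; apply => x.
rewrite -iT raddfB/= iP /lim to_limitS (le_trans (dist x))// ler_wpM2r//.
by rewrite ge_min lexx orbT.
Qed.

Lemma defeat_strategy : I_has_winning_strategy X.
Proof.
pose op := Opening (subspace_Age_cl fE) (@ltr01 R).
pose s : strategy X := fun n F eps p =>
  pick (stay (position_age p) (position_eps p)) (@good_move F eps).
exists op, s => r [_ rs]; apply: good_run_not_won => n on; rewrite (rs n on).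
by apply: pickP; apply: good_move_exists; [exact: run_age|exact: run_eps_gt0].
Qed.

End PlayerIStrategy.

(** The failure of the condition for E and e says that no F, phi and delta work, and this
    is just what the strategy of Player I feeds on. *)
Theorem not_I_gF2 (R : realType) (X : completeNormedModType R) :
  ~ I_has_winning_strategy X -> gF2 X.
Proof.
move=> nI; apply: contrapT => ng2; apply: nI.
have [E [e [fE [e0 bad]]]] : exists (E : subspace_of X) (e : R),
    finite_dim (subspace_type E) /\ 0 < e /\
    forall (F : normedModType R) (phi : {linear subspace_type E -> F}) (delta : R),
    Age_cl X F -> Emb e phi -> 0 < delta -> ~ (forall (G : normedModType R)
      (psi : {linear F -> G}) (eta : R), Age_cl X G -> Emb delta psi -> 0 < eta ->
      exists2 i : {linear G -> X}, Emb eta i &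
        opnorm (fun x : subspace_type E => subspace_val x - i (psi (phi x))) < e).
  apply: contrapT => h; apply: ng2 => E e fE e0; apply: contrapT => h'; apply: h.
  exists E, e; split=> //; split=> // F phi delta aF ephi d0 hG; apply: h'.
  by exists F, phi, delta.
apply: (defeat_strategy fE e0) => F phi delta aF ephi d0.
apply: contrapT => h; apply: (bad F phi delta aF ephi d0) => G psi eta aG psid eta0.
apply: contrapT => h'; apply: h; exists G, psi, eta; split=> // i ei hi.
apply: h'; exists i => //; apply: (@le_lt_trans _ _ (3 / 4 * e)); last by lra.
by apply: opnorm_le => //; rewrite mulr_ge0 ?divr_ge0// ltW.
Qed.

(** * Comeager classes and generating sequences *)

Section SubspaceNeighbourhoods.
Context {T : topologicalType} (A : set T).

Lemma nbhs_set_val (x : A) (U : set A) : nbhs x U ->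
  exists V, nbhs (set_val x) V /\ forall y : A, V (set_val y) -> U y.
Proof.
move=> [_ [[B Bop <-] Bx BU]]; exists B; split; first exact: open_nbhs_nbhs.
by move=> y By; exact: BU.
Qed.

Lemma nbhs_preimage_val (x : A) (V : set T) : nbhs (set_val x) V ->
  nbhs x ((set_val : A -> T) @^-1` V).
Proof. exact: (@initial_continuous _ _ (set_val : A -> T)). Qed.

End SubspaceNeighbourhoods.

(** Within the closure of A the complement of an open set that contains A is closed
    and misses the dense set A. *)
Lemma Gdelta_comeager (T : topologicalType) (A : set T) :
  Gdelta A -> comeager_in_closure A.
Proof.
move=> [F Fop AF].
have AE y : A y <-> forall n, F n y.
  by rewrite {1}AF; split=> [h n|h n _]; [exact: h|exact: h].
exists (fun n => [set x : closure A | ~ F n (set_val x)]); last first.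
  move=> x nAx; apply: contrapT => h; apply: nAx; apply/AE => n.
  by apply: contrapT => nF; apply: h; exists n.
move=> n; apply/seteqP; split=> // x cx.
have cF : closed [set x : closure A | ~ F n (set_val x)].
  rewrite (_ : [set _ | _] = ~` ((set_val : closure A -> T) @^-1` F n))//.
  apply: open_closedC; have := Fop n; apply: open_comp => y _.
  exact: (@initial_continuous _ _ (set_val : closure A -> T)).
have {}cx : nbhs x [set x : closure A | ~ F n (set_val x)].
  have clE := (closure_id [set x : closure A | ~ F n (set_val x)]).1 cF.
  by rewrite [X in nbhs x X]clE; exact: cx.
have [V [xV Vn]] := nbhs_set_val cx.
have /(_ _ xV)[a [Aa Va]] : closure A (set_val x) by exact: set_valP.
have aC : closure A a by exact: subset_closure.
apply: (Vn (SigSub (mem_set aC))) => //=.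
by move/AE: Aa.
Qed.

Section GeneratingSequences.
Context {R : realType} (X : normedModType R).

Definition generating (h : nat -> X) : Prop := (forall N, independent N h) /\ dense_span h.

Lemma infinite_dim_outside N (b : nat -> X) : ~ finite_dim X ->
  exists w, ~ exists2 p : {poly R}, (size p <= N)%N & w = lcp b p.
Proof.
move=> nX; apply: contrapT => h; apply: nX; apply: (@finite_dim_range _ N _ b) => x.
by apply: contrapT => nx; apply: h; exists x.
Qed.

(** The terms are chosen one at a time, a small multiple of a vector outside the span
    being added to the intended term if this lies in the span of the preceding ones;
    after the tuple t, the intended terms are those of a dense sequence, each of
    them infinitely often. *)
Lemma generating_extension (t : nat -> X) N r : ~ finite_dim X -> separable X -> 0 < r ->
  exists h, [/\ generating h, forall i, (i < N)%N -> `|h i - t i| < r &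
    independent N t -> forall i, (i < N)%N -> h i = t i].
Proof.
move=> nX /separable_sequence[x xd] r0; have [sg sgP] := infinitely_often.
pose tgt i := if (i < N)%N then t i else x (sg i).
pose tol i : R := Num.min r (2^-1 ^+ i).
have tol0 i : 0 < tol i by rewrite lt_min r0 exprn_gt0.
pose P n (s : nat -> X) := [/\ independent n s, forall i, (i < n)%N -> `|s i - tgt i| < tol i &
  independent N t -> forall i, (i < n)%N -> (i < N)%N -> s i = t i].
pose Q n (s s' : nat -> X) := forall i, (i < n)%N -> s' i = s i.
have [s sPQ] : exists s, forall n, P n (s n) /\ Q n (s n) (s n.+1).
  apply: (@indexed_choice _ P Q).
    by exists (fun=> 0); split=> // p; rewrite leqn0 size_poly_eq0 => /eqP.
  move=> n s [si st sN].
  suff [z [zs zt zN]] : exists z, [/\ ~ exists2 p : {poly R}, (size p <= n)%N & z = lcp s p,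
      `|z - tgt n| < tol n & independent N t -> (n < N)%N -> z = t n].
    pose s' i := if i == n then z else s i.
    have s's i : (i < n)%N -> s i = s' i by move=> /ltn_eqF; rewrite /s' => ->.
    exists s'; split; last by move=> i /s's.
    split.
    - apply: independentS; first exact: eq_independent s's _.
      rewrite /s' eqxx => -[p pn zp]; apply: zs; exists p => //.
      by rewrite zp; apply/esym/(eq_lcp pn s's).
    - move=> i; rewrite ltnS leq_eqVlt => /predU1P[->|iN]; first by rewrite /s' eqxx.
      by rewrite -s's// st.
    - move=> ti i; rewrite ltnS leq_eqVlt => /predU1P[->|iN] iN'.
        by rewrite /s' eqxx zN.
      by rewrite -s's// sN.
  have [[p pn tp]|ns] := pselect (exists2 p : {poly R}, (size p <= n)%N & tgt n = lcp s p);
      last first.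
    exists (tgt n); split=> //; first by rewrite subrr normr0.
    by move=> _ nN; rewrite /tgt nN.
  have [w ws] := infinite_dim_outside n s nX.
  pose c := tol n / 2 / (`|w| + 1); have w0 : 0 < `|w| + 1 by rewrite ltr_wpDl.
  have c0 : 0 < c by rewrite !divr_gt0.
  exists (tgt n + c *: w); split.
  - move=> [q qn]; rewrite tp => h; apply: ws; exists (c^-1 *: (q - p)).
      rewrite (leq_trans (size_scale_leq _ _))// (leq_trans (size_polyD _ _))//.
      by rewrite size_polyN geq_max qn.
    by rewrite linearZ/= raddfB/= -h addrC addKr scalerK// gt_eqF.
  - rewrite addrAC subrr add0r normrZ gtr0_norm// /c mulrAC ltr_pdivrMr//.
    rewrite -mulrA; have := tol0 n; have : 0 <= `|w| by []; move: (tol n) `|w| => a b; nra.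
  - move=> ti nN; exfalso; move: tp; rewrite /tgt nN => tp.
    have st' i : (i < n)%N -> s i = t i by move=> i_n; apply: sN => //; exact: ltn_trans nN.
    have := ti ('X^n - p); rewrite raddfB/= lcpX tp (eq_lcp pn st') subrr => /(_ _ erefl) h.
    have : ('X^n - p)`_n = 0.
      rewrite h ?coef0// (leq_trans (size_polyD _ _))// size_polyN size_polyXn geq_max nN.
      by rewrite (leq_trans pn)// ltnW.
    by rewrite coefB coefXn eqxx nth_default// subr0 => /eqP; rewrite oner_eq0.
have sE n m i : (i < n)%N -> (n <= m)%N -> s m i = s n i.
  move=> i_n /subnKC <-; elim: (m - n)%N => [|d IH]; first by rewrite addn0.
  by have [_ q] := sPQ (n + d)%N; rewrite addnS q ?IH// (leq_trans i_n)// leq_addr.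
pose h i := s i.+1 i.
have hE : forall m i, (i < m)%N -> h i = s m i.
  by move=> m i im; rewrite /h -(sE i.+1 m).
exists h; split; first split.
- move=> m; have [[si _ _] _] := sPQ m.
  by apply: eq_independent si => i im; rewrite (hE m).
- have xds : dense_span x.
    by move=> z e e0; have [j zj] := xd z e e0; exists 'X^j; rewrite lcpX.
  apply: dense_span_approx xds _ => j e e0; have [M MP] := half_power_lt e0.
  have [n Mn sn] := sgP j (maxn M N); exists 'X^n; rewrite lcpX.
  have [[_ + _] _] := sPQ n.+1 => /(_ n (leqnn _)); rewrite -/(h n) /tgt ltnNge.
  rewrite (leq_trans (leq_maxr M N) Mn)/= sn distrC => /lt_trans; apply.
  by rewrite gt_min MP ?orbT// (leq_trans (leq_maxl M N) Mn).
- move=> i iN; have [[_ + _] _] := sPQ i.+1 => /(_ i (leqnn _)); rewrite -/(h i) /tgt iN.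
  by move=> /lt_le_trans; apply; rewrite ge_min lexx.
- move=> ti i iN; have [[_ _ +] _] := sPQ i.+1 => /(_ ti i (leqnn _) iN).
  by rewrite -/(h i).
Qed.

End GeneratingSequences.

Lemma code_norms_infty (R : realType) (X : normedModType R) (y : nat -> X) :
  (forall N, independent N y) -> norms_infty R (code y).
Proof.
move=> yi; have ext p : pseudonorm_ext (code y) p = `|lcp y p|.
  by rewrite -norm_lcp_gen code_near.
split; last first.
  by move=> p; rewrite ext => /normr0_eq0; exact: (yi (size p)).
split; first exact: code_pseudonorm.
apply: (@independent_infinite_dim _ _ (gen (code y))) => N p pN /eqP.
by rewrite -normr_eq0 code_near normr_eq0 => /eqP; exact: yi.
Qed.

Section OpenPlay.
Context {R : realType} (X : completeNormedModType R) (J : set {ptws {poly rat} -> R}).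
Hypothesis nX : ~ finite_dim X.
Hypothesis Xsep : separable X.
Hypothesis Jpn : J `<=` pseudonorms R.
Hypothesis normsJ : norms_infty R `<=` J.

Local Notation C := (closure (isometry_class X J)).

Let J_pn (mu : J) : pseudonorms R (set_val mu).
Proof. by apply: Jpn; exact: set_valP. Qed.

Definition code_elt (h : nat -> X) (hi : forall N, independent N h) : J :=
  SigSub (mem_set (normsJ (code_norms_infty hi))).

Lemma code_elt_class (h : nat -> X) (hi : forall N, independent N h) :
  dense_span h -> isometry_class X J (code_elt hi).
Proof. exact: isometric_code. Qed.

(** The codes of generating sequences belong to all the spaces of codes considered, so
    that they are available as approximations in each of them. *)
Lemma limit_in_closure (mu : J) : (forall N r, 0 < r ->
    exists h : nat -> X, generating h /\ near_type N r h (gen (set_val mu))) -> C mu.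
Proof.
move=> h U /nbhs_set_val[V [/(nbhs_near (J_pn mu))[N [r [r0 NV]]] VU]].
have [g [[gi gd] gmu]] := h N r r0; exists (code_elt gi); split.
  exact: code_elt_class.
apply/VU/NV; first exact: code_pseudonorm.
by move=> p pN; rewrite code_near; exact: gmu.
Qed.

(** The n-th condition is to avoid the n-th of the nowhere dense sets that cover the rest
    of the closure. Some open set near the code of h avoids it; since the class is
    dense in its closure, this open set contains a code of X, and then the code of a
    generating sequence of X that perturbs h. *)
Theorem comeager_conditions : comeager_in_closure (isometry_class X J) ->
  exists O : nat -> ({poly rat} -> R) -> Prop,
    (forall n (h : nat -> X) N r, generating h -> 0 < r -> exists (h' : nat -> X) N' r',
      [/\ generating h', 0 < r', near_type N r h' h &
        forall mu, pseudonorms R mu -> near_type N' r' (gen mu) h' -> O n mu]) /\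
    (forall mu, norms_infty R mu -> (forall N r, 0 < r ->
        exists h : nat -> X, generating h /\ near_type N r h (gen mu)) ->
      (forall n, O n mu) -> isometric (X_ mu) X).
Proof.
move=> [F Fnd Fcov].
exists (fun n mu => forall x : C, set_val (set_val x) = mu -> ~ F n x); split; last first.
  move=> mu muB mulim muO; have muJ := normsJ muB.
  pose m : J := SigSub (mem_set muJ); have mC : C m by exact: limit_in_closure.
  pose x : C := SigSub (mem_set mC).
  have [//|nA] := pselect (isometric (X_ mu) X).
  by have [n _ /(muO n x erefl)] := Fcov x nA.
move=> n h N r [hi hd] r0.
have cC : C (code_elt hi) by apply: subset_closure; exact: code_elt_class.
pose c : C := SigSub (mem_set cC).
have r40 : 0 < r / 4 by rewrite divr_gt0.
have Wc : nbhs c [set x : C | near_type N (r / 4) (gen (set_val (set_val x))) h].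
  have h1 := near_nbhs N (code_pseudonorm h) r40.
  have h2 : nbhs (set_val c) [set y : J | near_type N (r / 4) (gen (set_val y)) (gen (code h))].
    have h3 := @nbhs_preimage_val _ J (set_val c) _ h1.
    by apply: filterS h3 => y /(_ (J_pn y)).
  apply: filterS (@nbhs_preimage_val _ C c _ h2) => y hy p pN.
  by rewrite -(code_near h); exact: hy.
have [x [Wx nFx]] : exists x : C, near_type N (r / 4) (gen (set_val (set_val x))) h /\
    ~ closure (F n) x.
  apply: contrapT => nex; have : (closure (F n))° c.
    rewrite /interior; apply: filterS Wc => y Wy; apply: contrapT => nF.
    by apply: nex; exists y.
  by rewrite (Fnd n).
have [U [xU UF]] : exists U, nbhs x U /\ forall y, U y -> ~ F n y.
  apply: contrapT => nex; apply: nFx => U xU; apply: contrapT => nUF; apply: nex.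
  by exists U; split=> // y Uy Fy; apply: nUF; exists y.
have [V1 [xV1 V1U]] := nbhs_set_val xU; have [V2 [xV2 V2V1]] := nbhs_set_val xV1.
have [N1 [r1 [r10 NV]]] := nbhs_near (J_pn _) xV2.
pose N' := maxn N N1; pose s := Num.min (r / 4) (r1 / 3).
have s0 : 0 < s by rewrite lt_min r40 divr_gt0.
have sr : s <= r / 4 by rewrite ge_min lexx.
have sr1 : s <= r1 / 3 by rewrite ge_min lexx orbT.
have [a [Aa ax]] : exists a : J, isometry_class X J a /\
    near_type N' s (gen (set_val a)) (gen (set_val (set_val x))).
  have xC : C (set_val x) by exact: set_valP.
  have h1 := @nbhs_preimage_val _ J (set_val x) _ (near_nbhs N' (J_pn (set_val x)) s0).
  by have [a [Aa /(_ (J_pn a)) ax]] := xC _ h1; exists a.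
have [h0 h0d ah0] := isometric_codeP (J_pn a) Aa.
have [h' [gh' h'h0 _]] := generating_extension h0 N' nX Xsep s0.
have h'x : near_type N' (s + s) h' (gen (set_val (set_val x))).
  apply: near_trans (near_dist (fun i iN => ltW (h'h0 i iN))) _ => p pN.
  by rewrite -(code_near h0) -ah0; exact: ax.
exists h', N', s; split=> //.
  apply: near_le (leqnn _) _ (near_trans (near_le (leq_maxl _ _) (lexx _) h'x) Wx); lra.
move=> mu muP muh' y ymu; apply: UF; apply/V1U/V2V1; rewrite ymu; apply: NV => //.
apply: near_le (leq_maxr N N1) _ (near_trans muh' h'x); lra.
Qed.

End OpenPlay.

(** * A winning strategy for Player II in infinite dimension *)

Section InfiniteDimensionalGame.
Context {R : realType} (X : completeNormedModType R).
Hypothesis nX : ~ finite_dim X.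
Hypothesis Xsep : separable X.
Context (O : nat -> ({poly rat} -> R) -> Prop).
Hypothesis Odense : forall n (h : nat -> X) N r, generating h -> 0 < r ->
  exists (h' : nat -> X) N' r', [/\ generating h', 0 < r', near_type N r h' h &
    forall mu, pseudonorms R mu -> near_type N' r' (gen mu) h' -> O n mu].
Hypothesis Oforce : forall mu, norms_infty R mu -> (forall N r, 0 < r ->
    exists h : nat -> X, generating h /\ near_type N r h (gen mu)) ->
  (forall n, O n mu) -> isometric (X_ mu) X.

(** The data of Player II: the first dt_size terms of dt_basis are independent in the
    space played last; after a move of Player II they form a basis, isometric to the
    beginning of the generating sequence dt_model. *)
Record game_data (E : normedModType R) := GameData {
  dt_basis : nat -> E ; dt_model : nat -> X ; dt_size : nat ; dt_err : R }.

(** The last clause reserves room for the distortion of all the later moves. *)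
Definition modelled n (E : normedModType R) (eps : R) (d : game_data E) : Prop :=
  [/\ independent (dt_size d) (dt_basis d) /\ spanning (dt_size d) (dt_basis d),
    generating (dt_model d), 0 < dt_err d <= 2^-1 ^+ n,
    near_type (dt_size d) 0 (dt_basis d) (dt_model d) &
    (forall mu, pseudonorms R mu ->
      near_type (dt_size d) (dt_err d) (gen mu) (dt_model d) -> O n./2 mu) /\
    forall (Y : normedModType R) (T : {linear E -> Y}), Emb (4 * eps) T ->
      near_type (dt_size d) (dt_err d) (fun i => T (dt_basis d i)) (dt_basis d)].

Definition data_valid n (E : normedModType R) (eps : R) (d : game_data E) : Prop :=
  if odd n then modelled n eps d else independent (dt_size d) (dt_basis d).

Definition data_step n (E : normedModType R) (eps : R) (d : game_data E)
    (m : game_move X E eps) (d' : game_data (move_space m)) : Prop :=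
  [/\ (~~ odd n + dt_size d <= dt_size d')%N,
    forall i, (i < dt_size d)%N -> dt_basis d' i = move_map m (dt_basis d i) &
    ~~ odd n -> move_eps m <= eps / 2].

(** The space played last is embedded in X, its basis prolonged to a generating
    sequence, and this sequence modified to meet the next condition O; the new space
    is the span of enough of its terms, and eps is then chosen so small that the
    condition survives in the limit. *)
Lemma data_step_II n (E : normedModType R) eps (d : game_data E) : Age_cl X E -> 0 < eps ->
    ~~ odd n -> data_valid n eps d ->
  exists (m : game_move X E eps) (d' : game_data (move_space m)),
    data_valid n.+1 (move_eps m) d' /\ data_step n d d'.
Proof.
case: d => b h0 N r0 aE eps0 en; rewrite /data_valid (negbTE en)/= => bi.
have [n1 [b1 [Nn1 b1i b1s b1b]]] := basis_extension (proj1 aE) bi.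
have [K K0 b1K] := independent_bound b1i.
have [t t0 tE] := Emb_of_dist eps0.
have [del del0 delE] := dist_of_Emb (divr_gt0 t0 (ltr0n R 2)).
have [j ej] := Age_cl_Emb aE del0.
pose s := t / 2 / K; have s0 : 0 < s by rewrite !divr_gt0.
have [h1 [gh1 _ h1j]] := generating_extension (fun i => j (b1 i)) n1 nX Xsep s0.
have {}h1j i : (i < n1)%N -> h1 i = j (b1 i).
  apply: h1j; apply: independent_inj b1i => x; exact: Emb_inj ej.
have [h' [N' [r' [gh' r'0 h'h1 h'O]]]] := Odense n./2 n1 gh1 s0.
pose N2 := maxn N' n1.+1; pose r2 : R := Num.min r' (2^-1 ^+ n.+1).
have r20 : 0 < r2 by rewrite lt_min r'0 exprn_gt0.
have n1N2 : (n1 < N2)%N by rewrite /N2 leq_max leqnn orbT.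
pose G := span_space N2 h'; pose b2 := span_gen N2 h'.
have [psi psiE] := basis_map b2 b1i b1s.
have epsi : Emb eps psi.
  apply: tE => y; have [p pn ->] := b1s y; rewrite psiE//.
  have h2 := @near_span_gen _ _ N2 h' p (leq_trans pn (ltnW n1N2)).
  have h3 := h'h1 p pn; have h4 := delE _ _ _ ej (lcp b1 p).
  rewrite lcp_map -(eq_lcp pn h1j) in h4; rewrite mul0r in h2.
  have h5 : s * l1 p <= t / 2 * `|lcp b1 p|.
    apply: (@le_trans _ _ (s * (K * `|lcp b1 p|))); first by rewrite ler_wpM2l ?(ltW s0)// b1K.
    by rewrite mulrA /s divfK// gt_eqF.
  have -> : `|lcp b2 p| - `|lcp b1 p| = (`|lcp b2 p| - `|lcp h' p|) +
      ((`|lcp h' p| - `|lcp h1 p|) + (`|lcp h1 p| - `|lcp b1 p|)) by ring.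
  rewrite (le_trans (ler_normD _ _))// (le_trans (lerD h2 (ler_normD _ _)))// add0r.
  by rewrite (splitr t) mulrDl; apply: lerD => //; exact: le_trans h3 h5.
have [C C0 b2C] := finite_bound (fun i => `|b2 i|) N2.
have [eta eta0 etaE] := dist_of_Emb (divr_gt0 r20 C0).
pose eps' := Num.min (eps / 2) (eta / 4).
have eps'0 : 0 < eps' by rewrite lt_min !divr_gt0.
have eps'1 : eps' <= eps / 2 by rewrite ge_min lexx.
have eps'2 : eps' <= eta / 4 by rewrite ge_min lexx orbT.
have eps'lt : eps' < eps by lra.
have aG : Age_cl X (subspace_type G) by exact/subspace_Age_cl/span_finite_dim.
exists (Move aG epsi eps'0 eps'lt), (@GameData (subspace_type G) b2 h' N2 r2).
have b2i : independent N2 b2.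
  move=> p pN p0; apply: (gh'.1 N2 p pN).
  by rewrite -(span_gen_lcp h' pN) [lcp _ p]p0.
split; last first.
  split=> //=; first by rewrite en add1n (leq_trans _ n1N2).
  move=> i iN; have in1 := leq_trans iN Nn1; rewrite -b1b//.
  by have := psiE 'X^i; rewrite size_polyXn !lcpX => /(_ in1).
rewrite /data_valid /= en; split=> //=.
- by split=> //; exact: span_gen_spanning.
- by rewrite r20 ge_min lexx orbT.
- exact: near_span_gen.
split=> [mu muP muh'|Y T eT].
  rewrite uphalf_half (negbTE en) add0n; apply: h'O => //.
  by apply: near_le muh'; [exact: leq_maxl|rewrite ge_min lexx].
have eT' : Emb eta T by apply: Emb_mono eT; lra.
have := near_of_dist (ltW (divr_gt0 r20 C0)) (etaE _ _ _ eT') b2C.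
by rewrite divfK// gt_eqF.
Qed.

Lemma data_step_I n (E : normedModType R) eps (d : game_data E) (m : game_move X E eps) :
    odd n -> data_valid n eps d ->
  exists d' : game_data (move_space m), data_valid n.+1 (move_eps m) d' /\ data_step n d d'.
Proof.
move=> on; rewrite /data_valid on => -[[bi _] _ _ _ _].
exists (GameData (fun i => move_map m (dt_basis d i)) (dt_model d) (dt_size d) (dt_err d)).
rewrite /data_valid /data_step /= on; split=> //.
apply: independent_inj bi => x; exact: (Emb_inj (@move_emb _ _ _ _ m)).
Qed.

(** The bases chosen by Player II fit together into a sequence y of independent
    vectors of the limit. Its code lies in all the conditions O, so that the space
    that it spans is isometric to X. *)
Lemma modelled_run_won (r : run X) (d : forall n, game_data (run_space r n)) :
    (forall n, data_valid n (run_eps r n) (d n) /\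
      @data_step n _ _ (d n) (run_move r n) (d n.+1)) ->
  wins_II r.
Proof.
move=> dP; have valid n := proj1 (dP n); have step n := proj2 (dP n).
have eps0 n := run_eps_gt0 r n; have epsS n := run_eps_lt r n.
have half k i : odd k -> run_eps r (k + i.*2).+2 <= run_eps r (k + i.*2)%N / 2.
  move=> ok; have ek : ~~ odd (k + i.*2).+1 by rewrite /= oddD odd_double addbF ok.
  by have [_ _ /(_ ek)/= h] := step (k + i.*2).+1; have := epsS (k + i.*2)%N; lra.
have tail k m : odd k -> \sum_(k <= i < m) run_eps r i <= 4 * run_eps r k.
  by move=> ok; apply: halving_sum => // i; exact: half.
have eps_ge n : 0 <= run_eps r n := ltW (eps0 n).
pose B := run_eps r 0 + 4 * run_eps r 1.
have epsB m : \sum_(0 <= i < m) run_eps r i <= B.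
  case: m => [|m]; first by rewrite big_geq// addr_ge0// mulr_ge0.
  by rewrite big_ltn// lerD2l tail.
split.
  apply: nondecreasing_is_cvgn.
    apply/nondecreasing_seqP => n; rewrite /series/= big_nat_recr//= lerDl.
    exact: eps_ge.
  by exists B => _ [n _ <-]; exact: epsB.
pose lim n : {linear run_space r n -> _} := to_limit (@run_emb _ _ r) eps_ge epsB n.
pose b n := dt_basis (d n); pose N n := dt_size (d n).
have bS n i : (i < N n)%N -> b n.+1 i = run_map r n (b n i) by have [_ + _] := step n; exact.
have NS n : (N n <= N n.+1)%N.
  by have [+ _ _] := step n; apply: leq_trans; exact: leq_addl.
have Nmono n k : (n <= k)%N -> (N n <= N k)%N.
  by move=> /subnKC <-; elim: (k - n)%N => [|l IH]; rewrite ?addn0// addnS (leq_trans IH).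
have Nlarge n : (n <= N n.*2)%N.
  elim: n => [//|n IH]; rewrite doubleS (leq_trans _ (NS _))//.
  by have [+ _ _] := step n.*2; rewrite odd_double add1n; apply: leq_trans; rewrite ltnS.
have limS n k i : (n <= k)%N -> (i < N n)%N -> lim k (b k i) = lim n (b n i).
  move=> /subnKC <- iN; elim: (k - n)%N => [|l IH]; first by rewrite addn0.
  rewrite addnS bS; last by rewrite (leq_trans iN)// Nmono// leq_addr.
  by rewrite [LHS]to_limitS.
pose y i := lim i.+1.*2 (b i.+1.*2 i).
have yE n i : (i < N n)%N -> y i = lim n (b n i).
  move=> iN; case: (leqP n i.+1.*2) => h; first exact: limS.
  by rewrite (limS i.+1.*2)// ltnW.
have lcpE n (p : {poly R}) : (size p <= N n)%N -> lcp y p = lim n (lcp (b n) p).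
  by move=> pN; rewrite lcp_map; apply: eq_lcp pN _ => i; exact: yE.
have odd_valid n : odd n -> modelled n (run_eps r n) (d n).
  by move=> on; have := valid n; rewrite /data_valid on.
have limE n : odd n -> Emb (4 * run_eps r n) (lim n).
  by move=> on; apply: to_limit_Emb => m; exact: tail.
have odd2 n : odd n.*2.+1 by rewrite /= odd_double.
have Nodd n : (n <= N n.*2.+1)%N by rewrite (leq_trans (Nlarge n))// NS.
have yi M : independent M y.
  move=> p pM; have pN := leq_trans pM (Nodd M).
  have [[bi _] _ _ _ _] := odd_valid _ (odd2 M).
  by rewrite (lcpE _ _ pN) => /(Emb_inj (limE _ (odd2 M))); exact: bi.
have mu_near n : odd n -> near_type (N n) (dt_err (d n)) (gen (code y)) (dt_model (d n)).
  move=> on; have [_ _ _ bh [_ /(_ _ _ (limE n on)) h]] := odd_valid n on.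
  have := near_trans h bh; rewrite addr0 => h' p pN; rewrite code_near (lcpE n p pN) lcp_map.
  exact: h'.
have Xmu : isometric (X_ (code y)) X.
  apply: Oforce; first exact: code_norms_infty.
    move=> M e e0; have [L /(_ _ (leq_maxl L M)) Le] := half_power_lt e0.
    pose n := (maxn L M).*2.+1; have on : odd n := odd2 _.
    have [_ gh /andP[_ rn] _ _] := odd_valid n on.
    exists (dt_model (d n)); split=> //.
    apply: near_le (near_sym (mu_near n on)).
      by rewrite (leq_trans (leq_maxr L M))// Nodd.
    rewrite (le_trans rn)// (le_trans _ (ltW Le))// /n ler_wiXn2l//; first by lra.
    by rewrite -addnn leqW// leq_addr.
  move=> n; have [_ _ _ _ [h _]] := odd_valid _ (odd2 n).
  have -> : n = n.*2.+1./2 by rewrite -uphalfE uphalf_double.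
  by apply: h; [exact: code_pseudonorm|exact: mu_near].
have [x xd codeE] := isometric_codeP (code_pseudonorm y) Xmu.
apply: (@isometric_onto_dirlim _ _ _ _ (@run_emb _ _ r) eps_ge B epsB X x y).
- exact: complete_seq_complete.
- exact: xd.
- by move=> p; rewrite -(code_near x) -codeE code_near.
- by move=> i; exists i.+1.*2, (b i.+1.*2 i).
- move=> n z e e0; have nm : (n <= n.*2.+1)%N by rewrite -addnn leqW// leq_addr.
  have [[_ bs] _ _ _ _] := odd_valid _ (odd2 n).
  have [p pN zp] := bs (orbit_of (run_map r) z n.*2.+1); exists p.
  rewrite -(to_limit_orbit (@run_emb _ _ r) eps_ge epsB z nm) zp.
  by rewrite (lcpE n.*2.+1 p pN) subrr normr0.
Qed.

Theorem open_conditions_winning : II_has_winning_strategy X.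
Proof.
have [h [gh _ _]] := generating_extension (fun=> 0 : X) 0 nX Xsep ltr01.
have [|n E eps d m on|n E eps d aE eps0 en|s sP] := @strategy_with_data _ X game_data
    (fun E => GameData (fun=> 0) h 0 1) data_valid data_step.
- move=> op; exists (GameData (fun=> 0) h 0 1) => p.
  by rewrite leqn0 size_poly_eq0 => /eqP.
- exact: data_step_I.
- exact: data_step_II.
by exists s => r /sP[d dP]; exact: (modelled_run_won dP).
Qed.

End InfiniteDimensionalGame.

(** * A winning strategy for Player II in finite dimension *)

Lemma bounded_rV_cluster (R : realType) D (v : nat -> 'rV[R]_D) (M : R) :
    (forall m l, `|v m ord0 l| <= M) ->
  exists c : 'rV[R]_D, forall s m0, 0 < s ->
    exists2 m, (m0 <= m)%N & forall l, `|v m ord0 l - c ord0 l| < s.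
Proof.
move=> vM; pose A := [set w : 'rV[R]_D | forall l, w ord0 l \in `[(- M), M]].
have Ac : compact A.
  apply: (@rV_compact _ _ (fun=> `[(- M), M]%classic)) => _; exact: segment_compact.
have vA : (v @ \oo) A.
  by exists 0%N => // m _ l; rewrite in_itv/= -ler_norml.
have [c [_ cc]] := Ac (v @ \oo) _ vA.
exists c => s m0 s0.
have h1 : (v @ \oo) [set w | exists2 m, (m0 <= m)%N & w = v m].
  by exists m0 => // m /= mm; exists m.
have [w [[m mm ->] cm]] := cc _ _ h1 (nbhsx_ballx c s s0).
exists m => // l; have [_ /(_ ord0 l)] := cm.
by rewrite -ball_normE /= distrC.
Qed.

Section FiniteDimensionalGame.
Context {R : realType} (X : completeNormedModType R) (fX : finite_dim X).

(** Coordinates in a basis reduce this to the compactness of cubes. *)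
Lemma finite_dim_cluster d (g : nat -> nat -> X) M :
    (forall m i, (i < d)%N -> `|g m i| <= M) ->
  exists x : nat -> X, (forall i, (d <= i)%N -> x i = 0) /\ forall s m0, 0 < s ->
    exists2 m, (m0 <= m)%N & forall i, (i < d)%N -> `|g m i - x i| <= s.
Proof.
move=> gM; have [n [e [K [_ es K0 eK]]]] := basis_exists fX.
have /choice[k kP] : forall x, exists p : {poly R}, (size p <= n)%N /\ x = lcp e p.
  by move=> x; have [p ? ?] := es x; exists p.
have [B B0 eB] := finite_bound (fun i => `|e i|) n.
pose v m : 'rV[R]_(d * n) := \row_l (k (g m (l %/ n)%N))`_(l %% n)%N.
have [|c cP] := @bounded_rV_cluster R _ v (K * M).
  move=> m l; rewrite mxE; have n0 : (0 < n)%N by case: n l {es eK kP eB v} => // -[l]; rewrite muln0.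
  have ld : (l %/ n < d)%N by rewrite ltn_divLR// (ltn_ord l).
  have [kn kE] := kP (g m (l %/ n)%N).
  rewrite (le_trans (l1_coef _ _))// (le_trans (eK _ kn))// -kE.
  by rewrite ler_wpM2l ?(ltW K0)// gM.
pose q i : {poly R} := \poly_(j < n) (if insub (i * n + j)%N is Some l then c ord0 l else 0).
exists (fun i => if (i < d)%N then lcp e (q i) else 0); split.
  by move=> i; rewrite leqNgt => /negbTE ->.
move=> s m0 s0; have nB : 0 < n.+1%:R * B by rewrite mulr_gt0.
have [m mm vc] := cP (s / (n.+1%:R * B)) m0 (divr_gt0 s0 nB).
exists m => // i i_d; rewrite i_d; have [kn kE] := kP (g m i).
have sz : (size (k (g m i) - q i)%R <= n)%N.
  by rewrite (leq_trans (size_polyD _ _))// size_polyN geq_max kn size_poly.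
rewrite kE -raddfB (le_trans (norm_lcp_le sz eB))// -ler_pdivlMr// (l1E sz).
apply: (@le_trans _ _ (\sum_(j < n) s / (n.+1%:R * B))).
  apply: ler_sum => j _; rewrite coefB /q coef_poly ltn_ord.
  have lt : (i * n + j < d * n)%N.
    by rewrite (@leq_trans (i.+1 * n))// ?leq_mul2r ?i_d ?orbT// mulSn addnC ltn_add2r.
  have := vc (Ordinal lt); rewrite insubT mxE /= => h; apply/ltW; move: h.
  have n0 : (0 < n)%N by rewrite (leq_trans _ (ltn_ord j)).
  by rewrite divnMDl// (divn_small (ltn_ord j)) addn0 modnMDl modn_small// (sub_ordK lt).
rewrite sumr_const card_ord -[_ *+ n]mulr_natr invfM mulrA mulrAC.
rewrite ler_pM2r ?invr_gt0// mulrAC ler_pdivrMr// ler_pM2l// ler_nat.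
exact: leqnSn.
Qed.

(** When Player II keeps playing X itself, the limit has the dimension of X and
    contains images of X by maps of arbitrarily small distortion. The vectors of a
    basis of the limit come from tuples g j of X that remain bounded; a cluster
    point of these tuples has exactly the type of the basis. *)
Lemma finite_dim_run_won (r : run X) : (forall n, ~~ odd n ->
    isometric X (run_space r n.+1) /\ run_eps r n.+1 <= run_eps r n / 2) -> wins_II r.
Proof.
move=> iX; have eps0 n := run_eps_gt0 r n; have epsS n := run_eps_lt r n.
have half k i : odd k -> run_eps r (k + i.*2).+2 <= run_eps r (k + i.*2)%N / 2.
  move=> ok; have ek : ~~ odd (k + i.*2).+1 by rewrite /= oddD odd_double addbF ok.
  by have [_ h] := iX _ ek; have := epsS (k + i.*2)%N; lra.
have tail k m : odd k -> \sum_(k <= i < m) run_eps r i <= 4 * run_eps r k.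
  by move=> ok; apply: halving_sum => // i; exact: half.
have eps_ge n : 0 <= run_eps r n := ltW (eps0 n).
pose B := run_eps r 0 + 4 * run_eps r 1.
have epsB m : \sum_(0 <= i < m) run_eps r i <= B.
  case: m => [|m]; first by rewrite big_geq// addr_ge0// mulr_ge0.
  by rewrite big_ltn// lerD2l tail.
split.
  apply: nondecreasing_is_cvgn.
    apply/nondecreasing_seqP => n; rewrite /series/= big_nat_recr//= lerDl.
    exact: eps_ge.
  by exists B => _ [n _ <-]; exact: epsB.
pose lim n : {linear run_space r n -> _} := to_limit (@run_emb _ _ r) eps_ge epsB n.
have odd2 n : odd n.*2.+1 by rewrite /= odd_double.
have limE n : odd n -> Emb (4 * run_eps r n) (lim n).
  by move=> on; apply: to_limit_Emb => m; exact: tail.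
have ex j : exists V : {linear X -> run_space r j.*2.+1} *
    {linear run_space r j.*2.+1 -> X}, [/\ isometric_embedding V.1,
    isometric_embedding V.2, cancel V.1 V.2 & cancel V.2 V.1].
  have ej : ~~ odd j.*2 by rewrite odd_double.
  have [[T [iT rT]] _] := iX _ ej; have [S [iS TS ST]] := isometric_inverse iT rT.
  by exists (T, S).
pose V j := projT1 (cid (ex j)).
have VP j : [/\ isometric_embedding (V j).1, isometric_embedding (V j).2,
    cancel (V j).1 (V j).2 & cancel (V j).2 (V j).1] := projT2 (cid (ex j)).
have [d [e [K [ei es K0 eK]]]] := basis_exists fX.
pose b i : run_space r 1 := if (i < d)%N then (V 0%N).1 (e i) else 0.
have bi : independent d b.
  have [i1 _ _ _] := VP 0%N.
  apply: eq_independent (independent_inj (f := (V 0%N).1) _ ei); last first.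
    by move=> x /eqP; rewrite -normr_eq0 i1 normr_eq0 => /eqP.
  by move=> i i_d; rewrite /b i_d.
pose y i := lim 1 (b i).
have lcpE p : lcp y p = lim 1 (lcp b p) by rewrite (lcp_map (lim 1)).
have oddn j : (1 <= j.*2.+1)%N by [].
have ol j := @orbit_linear _ _ (run_map r) 1 j.*2.+1.
pose OL j : {linear run_space r 1 -> run_space r j.*2.+1} :=
  HB.pack (fun x : run_space r 1 => orbit_of (run_map r) x j.*2.+1)
    (GRing.isLinear.Build R _ _ _ _ (ol j)).
have limOL j z : lim j.*2.+1 (OL j z) = lim 1 z by exact: to_limit_orbit.
pose g j i := (V j).2 (OL j (b i)).
have gE j p : `|lcp (g j) p| = `|OL j (lcp b p)|.
  by have [_ i2 _ _] := VP j; rewrite -i2 (lcp_map (OL j)) (lcp_map (V j).2).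
have OLB j z : `|OL j z| <= expR B * `|z|.
  have /andP[_ h] := orbit_bounds (@run_emb _ _ r) z (oddn j); apply: (le_trans h).
  by rewrite ler_wpM2r// ler_expR (eps_sum_le eps_ge epsB).
have gy p (s : R) : 0 < s -> exists j0, forall j, (j0 <= j)%N ->
    `| `|lcp (g j) p| - `|lcp y p| | <= s.
  move=> s0; have W0 : 0 < expR B * `|lcp b p| + 1.
    by rewrite ltr_wpDl// mulr_ge0// expR_ge0.
  have [C C0 CE] := dist_of_Emb (divr_gt0 s0 W0).
  have [j0 jP] := halving_small eps0 (fun i => half 1%N i isT) (divr_gt0 C0 (ltr0n R 4)).
  exists j0 => j /jP; rewrite add1n => hj; rewrite gE lcpE -(limOL j) distrC.
  have lC : Emb C (lim j.*2.+1) by apply: Emb_mono (limE _ (odd2 j)); lra.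
  rewrite (le_trans (CE _ _ _ lC _))// mulrAC ler_pdivrMr// ler_pM2l//.
  by rewrite (le_trans (OLB j _))// lerDl.
have [M M0 bM] := finite_bound (fun i => expR B * `|b i|) d.
have [|x [x0 xP]] := @finite_dim_cluster d g M.
  move=> j i i_d; have [_ i2 _ _] := VP j.
  by rewrite i2 (le_trans (OLB j _))// bM.
have xy p : `|lcp x p| = `|lcp y p|.
  apply/eqP; rewrite -subr_eq0 -normr_le0; apply/ler_addgt0Pr => s s0; rewrite add0r.
  have s20 := divr_gt0 s0 (ltr0n R 2); have [j0 jP] := gy p _ s20.
  have l0 : 0 < l1 p + 1 by rewrite ltr_wpDl// l1_ge0.
  have [j jj gx] := xP _ j0 (divr_gt0 s20 l0).
  have gx' i : (i < size p)%N -> `|x i - g j i| <= s / 2 / (l1 p + 1).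
    move=> _; case: (ltnP i d) => i_d; first by rewrite distrC gx.
    have b0 : b i = 0 by rewrite /b ltnNge i_d.
    have -> : g j i = 0 by rewrite /g b0 (raddf0 (OL j)) raddf0.
    rewrite x0// subr0 normr0.
    by rewrite divr_ge0 ?ltW.
  have h1 : `| `|lcp x p| - `|lcp (g j) p| | <= s / 2.
    rewrite (le_trans (ler_dist_dist _ _))// lcpB.
    rewrite (le_trans (norm_lcp_le (leqnn _) gx'))// mulrA ler_pdivrMr//.
    by rewrite mulrC ler_pM2l// lerDl.
  rewrite -(subrK `|lcp (g j) p| `|lcp x p|) -addrA (le_trans (ler_normD _ _))//.
  by rewrite (splitr s) lerD// jP.
have y0 (p : {poly R}) : (size p <= d)%N -> lcp y p = 0 -> p = 0.
  by move=> pd; rewrite lcpE => /(Emb_inj (limE 1%N isT)); exact: bi.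
have xi : independent d x.
  by move=> p pd /eqP; rewrite -normr_eq0 xy normr_eq0 => /eqP; exact: y0.
have xs := spanning_card es xi (leqnn d).
apply: (@isometric_onto_dirlim _ _ _ _ (@run_emb _ _ r) eps_ge B epsB X x y).
- exact: complete_seq_complete.
- by move=> w e0 e00; have [p _ ->] := xs w; exists p; rewrite subrr normr0.
- exact: xy.
- by move=> i; exists 1%N, (b i).
- move=> n z e0 e00; have nm : (n <= n.*2.+1)%N by rewrite -addnn leqW// leq_addr.
  have [_ _ _ V21] := VP n.
  have s1 : spanning d (fun i => (V n).1 (e i)).
    by move=> w; have [p pd wp] := es ((V n).2 w); exists p => //; rewrite -lcp_map -wp V21.
  have ci : independent d (fun i => OL n (b i)).
    by move=> p pd; rewrite -lcp_map => p0; apply: y0 => //; rewrite lcpE -(limOL n) p0 raddf0.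
  have [p pd zp] := spanning_card s1 ci (leqnn d) (orbit_of (run_map r) z n.*2.+1).
  exists p; rewrite -(to_limit_orbit (@run_emb _ _ r) eps_ge epsB z nm) zp.
  by rewrite -(lcp_map (OL n)) -/(lim _) limOL lcpE subrr normr0.
Qed.

Theorem finite_dim_winning : II_has_winning_strategy X.
Proof.
pose good E eps (m : game_move X E eps) := isometric X (move_space m) /\ move_eps m <= eps / 2.
exists (fun n E eps p => pick (stay (position_age p) (position_eps p)) (@good E eps)) => r rs.
apply: finite_dim_run_won => n /rs h.
suff : good _ _ (run_move r n) by [].
rewrite h; apply: pickP.
have aX : Age_cl X X by apply: Age_Age_cl; split=> //; exists idfun.
have eps0 := run_eps_gt0 r n.
have [u eu] := Age_cl_Emb (run_age r n) eps0.
exists (Move aX eu (half_gt0 eps0) (half_lt eps0)); split=> //=.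
by exists idfun; split=> //; apply/seteqP; split=> // x _; exists x.
Qed.

End FiniteDimensionalGame.

(** * The equivalence *)

Theorem theorem3p4 (R : realType) (X : completeNormedModType R)
    (J : set {ptws {poly rat} -> R})
    (Xsep : separable X)
    (HJ : (~ finite_dim X /\
             (J = pseudonorms R \/ J = pseudonorms_infty R \/ J = norms_infty R)) \/
          (finite_dim X /\ J = pseudonorms R)) :
  [<-> Gdelta (isometry_class X J);
       comeager_in_closure (isometry_class X J);
       II_has_winning_strategy X;
       ~ I_has_winning_strategy X;
       guarded_Fraisse X].
Proof.
have Jpn : J `<=` pseudonorms R.
  by case: HJ => [[_ [->|[->|->]]]|[_ ->]] mu => [|[]|[[]]|].
tfae.
- exact: Gdelta_comeager.
- case: HJ => [[nX HJ]|[fX _]]; last by move=> _; exact: finite_dim_winning.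
  have normsJ : norms_infty R `<=` J.
    by case: HJ => [->|[->|->]] mu => [[[]]|[]|].
  move=> /(comeager_conditions nX Xsep Jpn normsJ) [U [Udense Uforce]].
  exact: (open_conditions_winning nX Xsep Udense Uforce).
- exact: winning_II_not_I.
- by move=> /not_I_gF2 XgF; split=> //; right.
- move=> [_ XgF]; apply: (guarded_Gdelta Jpn Xsep); apply: gF2_guarded.
  by case: XgF => // /gF1_gF2.
Qed.
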